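(* Let $\alpha,\beta,\gamma,\eta$ be real numbers with $\alpha,\beta>\gamma>0$ and $\eta>0$. Then the function $\det\mathcal{B}^{(\alpha,\beta,\gamma,\eta)}:\mathbb{D}^2\times\mathbb{D}^2\to\mathbb{C}$ is non-negative definite, and the Hilbert space $\mathbb{H}^{(\alpha,\beta,\gamma,\eta)}$ of holomorphic functions on $\mathbb{D}^2$ whose reproducing kernel is $\det\mathcal{B}^{(\alpha,\beta,\gamma,\eta)}$ is a Möb-homogeneous analytic Hilbert module.
   Context: $\mathbb{D}$ is the open unit disc in $\mathbb{C}$ and Möb is the group of biholomorphic automorphisms of $\mathbb{D}$. A function $K:\Omega\times\Omega\to\mathbb{C}$ is non-negative definite if $\sum_{i,j=1}^p K(w_i,w_j)\zeta_j\overline{\zeta_i}\ge 0$ for all $p\in\mathbb{N}$, $w_i\in\Omega$, $\zeta_i\in\mathbb{C}$. A Hilbert space $\mathcal{H}$ is an analytic Hilbert module (over $\mathbb{C}[\boldsymbol z]=\mathbb{C}[z_1,z_2]$, on $\mathbb{D}^2$) if it consists of holomorphic functions on $\mathbb{D}^2$, it possesses a reproducing kernel on $\mathbb{D}^2$, $\mathbb{C}[\boldsymbol z]$ is (contained and) dense in $\mathcal{H}$, and the multiplication operators $M_{z_1},M_{z_2}$ by the coordinate functions are bounded on $\mathcal{H}$. A commuting pair $(T_1,T_2)$ of bounded operators on a complex separable Hilbert space is Möb-homogeneous if its Taylor joint spectrum lies in $\overline{\mathbb{D}}^2$ and $(\varphi(T_1),\varphi(T_2))$ is unitarily equivalent to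 $(T_1,T_2)$ (by a single unitary intertwining both components) for every $\varphi\in$ Möb. An analytic Hilbert module on $\mathbb{D}^2$ is Möb-homogeneous if the pair $(M_{z_1},M_{z_2})$ is Möb-homogeneous. For $\alpha,\beta>\gamma>0$ let $$B_{(\alpha,\beta,\gamma)}(\boldsymbol z,\boldsymbol w)=(1-z_1\overline{w}_1)^{-\alpha}(1-z_2\overline{w}_2)^{-\beta}(1-z_1\overline{w}_2)^{\gamma}(1-z_2\overline{w}_1)^{\gamma}$$ (principal branches), and for $\eta>0$ let $\mathcal{B}^{(\alpha,\beta,\gamma,\eta)}:\mathbb{D}^2\times\mathbb{D}^2\to\mathcal{M}_2(\mathbb{C})$ be $$\mathcal{B}^{(\alpha,\beta,\gamma,\eta)}(\boldsymbol z,\boldsymbol w)=\big[B_{(\alpha,\beta,\gamma)}(\boldsymbol z,\boldsymbol w)\big]^{\eta}\left(\frac{\partial^2}{\partial z_i\partial\overline{w}_j}\log B_{(\alpha,\beta,\gamma)}(\boldsymbol z,\boldsymbol w)\right)_{i,j=1}^2 ,$$ where $[B_{(\alpha,\beta,\gamma)}]^{\eta}=B_{(\alpha\eta,\beta\eta,\gamma\eta)}$. Explicitly, $$\det\mathcal{B}^{(\alpha,\beta,\gamma,\eta)}(\boldsymbol z,\boldsymbol w)=(1-z_1\overline{w}_1)^{-2\alpha\eta}(1-z_2\overline{w}_2)^{-2\beta\eta}(1-z_1\overline{w}_2)^{2\gamma\eta}(1-z_2\overline{w}_1)^{2\gamma\eta}\left[\frac{\alpha\beta}{(1-z_1\overline{w}_1)^2(1-z_2\overline{w}_2)^2}-\frac{\gamma^2}{(1-z_1\overline{w}_2)^2(1-z_2\overline{w}_1)^2}\right].$$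 *)

(* Defs.v *)
From HB Require Import structures.
From mathcomp Require Import all_boot all_order all_algebra.
From mathcomp Require Import all_classical all_reals all_analysis.
From mathcomp Require Import complex.

Set Implicit Arguments.
Unset Strict Implicit.
Unset Printing Implicit Defensive.

Import Order.TTheory GRing.Theory Num.Theory.
Import numFieldNormedType.Exports.

Local Open Scope classical_set_scope.
Local Open Scope ring_scope.
Local Open Scope complex_scope.

(* The field of complex numbers is R[i] for an arbitrary R : realType; it is
   written R[i]^o where its structure of normed R[i]-module is needed.
   Points of C^2 are row vectors, z_1 = z 0 0 and z_2 = z 0 1. *)

Section Domains.
Variable R : realType.

Definition disc : set R[i]^o := [set z | `|z| < 1].

Definition bidisc : set 'rV[R[i]]_2 := [set z | forall i, `|z 0 i| < 1].

Definition closed_bidisc : set 'rV[R[i]]_2 :=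
  [set z | forall i, `|z 0 i| <= 1].

(* [differentiable] is Frechet differentiability over the base field R[i] of
   the normed modules, hence complex differentiability. *)
Definition holomorphic (V : normedModType R[i]) (D : set V)
    (f : V -> R[i]^o) : Prop :=
  forall z, D z -> differentiable f z.

(* The values of phi outside the disc are irrelevant. *)
Definition Mobius : set (R[i]^o -> R[i]^o) :=
  [set phi | exists psi : R[i]^o -> R[i]^o,
    [/\ holomorphic disc phi /\ holomorphic disc psi,
        (forall z, disc z -> disc (phi z)) /\
          (forall z, disc z -> disc (psi z)),
        forall z, disc z -> psi (phi z) = z &
        forall z, disc z -> phi (psi z) = z]].

End Domains.

Section Kernels.
Variable R : realType.

(* In the partial order of R[i], [0 <= a] means that a is real and
   nonnegative. *)
Definition nonneg_definite (T : Type) (D : set T) (K : T -> T -> R[i]) : Prop :=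
  forall (p : nat) (w : 'I_p -> T) (zeta : 'I_p -> R[i]),
    (forall i, D (w i)) ->
    0 <= \sum_(i < p) \sum_(j < p) K (w i) (w j) * zeta j * Num.conj (zeta i).

Definition expC (u : R[i]) : R[i] :=
  (expR (complex.Re u))%:C * (cos (complex.Im u) +i* sin (complex.Im u)).

(* Principal logarithm on C \ ]-oo, 0]: there the principal argument of
   u = x + i y is 2 atan (y / (|u| + x)), by the half-angle formula.
   It is only used at points with positive real part. *)
Definition LogC (u : R[i]) : R[i] :=
  let r := complex.Re `|u| in
  ln r +i* (2 * atan (complex.Im u / (r + complex.Re u))).

Definition powC (u : R[i]) (s : R) : R[i] := expC (s%:C * LogC u).

(* 1 - z_i \bar w_j *)
Definition one_sub (z w : 'rV[R[i]]_2) (i j : 'I_2) : R[i] :=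
  1 - z 0 i * Num.conj (w 0 j).

Definition kerB (a b c : R) (z w : 'rV[R[i]]_2) : R[i] :=
  powC (one_sub z w 0 0) (- a) * powC (one_sub z w 1 1) (- b) *
  powC (one_sub z w 0 1) c * powC (one_sub z w 1 0) c.

(* The branch of log B given by the principal logarithms of the factors. *)
Definition log_kerB (a b c : R) (z w : 'rV[R[i]]_2) : R[i]^o :=
  - a%:C * LogC (one_sub z w 0 0) - b%:C * LogC (one_sub z w 1 1) +
  c%:C * LogC (one_sub z w 0 1) + c%:C * LogC (one_sub z w 1 0).

Definition conj_pt (w : 'rV[R[i]]_2) : 'rV[R[i]]_2 := map_mx Num.conj w.

Definition d_z (i : 'I_2) (f : 'rV[R[i]]_2 -> R[i]^o) (z : 'rV[R[i]]_2) :
    R[i]^o :=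
  'D_(delta_mx 0 i) f z.

(* For f antiholomorphic in w, the Wirtinger derivative with respect to
   \bar w_j is the complex derivative of u |-> f (\bar u) at u = \bar w. *)
Definition d_wbar (j : 'I_2) (f : 'rV[R[i]]_2 -> R[i]^o) (w : 'rV[R[i]]_2) :
    R[i]^o :=
  d_z j (fun u => f (conj_pt u)) (conj_pt w).

(* The power B_(a,b,c)^e is B_(a e,b e,c e). *)
Definition calB (a b c e : R) (z w : 'rV[R[i]]_2) : 'M[R[i]]_2 :=
  kerB (a * e) (b * e) (c * e) z w *:
  \matrix_(i < 2, j < 2)
    d_z i (fun z' => d_wbar j (fun w' => log_kerB a b c z' w') w) z.

Definition det_calB (a b c e : R) (z w : 'rV[R[i]]_2) : R[i] :=
  \det (calB a b c e z w).

End Kernels.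

(* The inner product is linear in its first argument. *)
Record hilbertSpace (R : realType) := HilbertSpace {
  hilbert_sort :> completeNormedModType R[i];
  inner : {dot hilbert_sort for (@Num.conj R[i])};
  inner_norm : forall x : hilbert_sort, `|x| ^+ 2 = inner x x
}.

Section Operators.
Variables (R : realType) (H : hilbertSpace R).

Definition separable_space : Prop := exists2 A : set H, countable A & dense A.

Definition bounded_operator (T : {linear H -> H}) : Prop :=
  exists M : R[i], forall x, `|T x| <= M * `|x|.

(* The complement of the Taylor spectrum: exactness of the Koszul complex
   0 -> H -> H (+) H -> H -> 0,  u |-> (A_0 u, A_1 u),
   (x, y) |-> A_0 y - A_1 x,  where A_i = T_i - l_i. *)
Definition koszul_exact (T : 'I_2 -> {linear H -> H}) (l : 'rV[R[i]]_2) :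
    Prop :=
  let A i x := T i x - l 0 i *: x in
  [/\ forall u, A 0 u = 0 -> A 1 u = 0 -> u = 0,
      forall x y, A 0 y - A 1 x = 0 -> exists2 u, A 0 u = x & A 1 u = y &
      forall v, exists x y, A 0 y - A 1 x = v].

Definition taylor_spectrum (T : 'I_2 -> {linear H -> H}) : set 'rV[R[i]]_2 :=
  [set l | ~ koszul_exact T l].

(* S = phi(T): the holomorphic functional calculus for a function on a disc,
   with phi(T) the sum in operator norm of the Taylor series of phi at 0.
   An automorphism phi of the disc extends holomorphically to a disc of radius
   > 1, so for T with spectrum in the closed unit disc the series converges
   and its sum is the Riesz-Dunford phi(T). *)
Definition functional_calculus (phi : R[i]^o -> R[i]^o)
    (T S : {linear H -> H}) : Prop :=
  exists2 a : nat -> R[i],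
    forall z, disc z ->
      series (fun k => a k * z ^+ k : R[i]^o) n @[n --> \oo] --> phi z &
    forall e : R[i], 0 < e -> exists N, forall n, (N <= n)%N -> forall x,
      `|(\sum_(k < n) a k *: iter k T x) - S x| <= e * `|x|.

Definition unitarily_equivalent (S T : 'I_2 -> {linear H -> H}) : Prop :=
  exists U : {linear H -> H},
    [/\ bijective U,
        forall x y, inner H (U x) (U y) = inner H x y &
        forall i x, U (S i x) = T i (U x)].

Definition Mobius_homogeneous (T : 'I_2 -> {linear H -> H}) : Prop :=
  [/\ separable_space,
      forall i, bounded_operator (T i),
      forall i j x, T i (T j x) = T j (T i x),
      taylor_spectrum T `<=` closed_bidisc (R := R) &
      forall phi, Mobius (R := R) phi ->
        exists2 S : 'I_2 -> {linear H -> H},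
          forall i, functional_calculus phi (T i) (S i) &
          unitarily_equivalent S T].

End Operators.

(* A Hilbert space of functions on D: its elements are identified with functions
   on D through [eval]; the values of [eval f] outside D are irrelevant. *)
Record hilbertFunctionSpace (R : realType) (D : set 'rV[R[i]]_2) :=
  HilbertFunctionSpace {
  function_space :> hilbertSpace R;
  eval : function_space -> 'rV[R[i]]_2 -> R[i]^o;
  eval_linear : forall (a : R[i]) (f g : function_space) z, D z ->
    eval (a *: f + g) z = a * eval f z + eval g z;
  eval_inj : forall f g : function_space,
    (forall z, D z -> eval f z = eval g z) -> f = g
}.

Section Modules.
Variables (R : realType) (H : hilbertFunctionSpace (@bidisc R)).

Definition reproducing_kernel
    (K : 'rV[R[i]]_2 -> 'rV[R[i]]_2 -> R[i]) : Prop :=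
  forall w, bidisc w -> exists2 k : H,
    forall z, bidisc z -> eval k z = K z w &
    forall f : H, eval f w = inner H f k.

(* C[z_1, z_2] as polynomials in z_2 over C[z_1]. *)
Definition polyval (p : {poly {poly R[i]}}) (z : 'rV[R[i]]_2) : R[i] :=
  p.[(z 0 1)%:P].[z 0 0].

Definition is_polynomial (f : H) (p : {poly {poly R[i]}}) : Prop :=
  forall z, bidisc z -> eval f z = polyval p z.

Definition is_mult (i : 'I_2) (T : {linear H -> H}) : Prop :=
  forall f z, bidisc z -> eval (T f) z = z 0 i * eval f z.

Definition analytic_Hilbert_module : Prop :=
  [/\ forall f : H, holomorphic (@bidisc R) (eval f),
      exists K, reproducing_kernel K,
      forall p, exists f, is_polynomial f p,
      dense [set f : H | exists p, is_polynomial f p] &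
      forall i, exists2 T, is_mult i T & bounded_operator T].

Definition Mobius_homogeneous_module : Prop :=
  exists2 T : 'I_2 -> {linear H -> H},
    forall i, is_mult i (T i) & Mobius_homogeneous T.

End Modules.

(* Main.v *)
(* Write A, B, C, D = 1 - z_1 \bar w_1, 1 - z_2 \bar w_2, 1 - z_1 \bar w_2,
   1 - z_2 \bar w_1. The logarithm of CD/AB is the sum over n >= 1 of
   (z_1^n - z_2^n) \bar{(w_1^n - w_2^n)} / n, and (AB)^(-2) - (CD)^(-2) is a similar
   sum over the polynomials z_1^i z_2^j - z_1^j z_2^i. Since alpha, beta > gamma and
   alpha beta > gamma^2, the determinant is therefore a sum of f_k(z) \bar{f_k(w)}
   over polynomials f_k, one of which is a nonzero constant, with uniformly
   convergent majorants. Hence it is nonnegative definite; the f_k form a Parseval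
   frame of the reproducing kernel space, which gives holomorphy and the density of
   the polynomials. The factors A^(-lam), B^(-mu) with lam, mu > 0 show that
   multiplication by z_i^n has norm at most (1 + n/lam)^(1/2), so the functional
   calculus converges for every function holomorphic on a neighbourhood of the
   closed disc and the spectrum lies in the closed bidisc. An automorphism of the
   disc is c (z - a) / (1 - \bar a z), by the Schwarz lemma, and replacing z, w by
   their images multiplies the determinant by a cocycle j(z) \bar{j(w)}; the
   unitary is the corresponding weighted composition operator. *)
From HB Require Import structures.
Require Import Defs.
From mathcomp Require Import all_boot all_order all_algebra.
From mathcomp Require Import all_classical all_reals all_analysis.
From mathcomp Require Import complex ring lra zify.

Set Implicit Arguments.
Unset Strict Implicit.
Unset Printing Implicit Defensive.

Import Order.TTheory GRing.Theory Num.Theory.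
Import numFieldNormedType.Exports.

Local Open Scope classical_set_scope.
Local Open Scope ring_scope.
Local Open Scope complex_scope.

(** Automorphisms are given only as pointwise differentiable maps, so the Schwarz lemma cannot start
    from a power series; it is reached from a discrete Goursat theorem. [expC] and [LogC] are
    explicit real formulas, so their series have to be derived: the exponential of a power series is
    recognized from E' = L E, and identities between principal logarithms are checked after
    exponentiation and then for the branch, by bounding imaginary parts. Kernels are multiplied only
    by nonnegative power series in g(z) conj g(w), where positivity is visible term by term. The
    multiplications and weighted compositions come from one criterion: g lies in the space with norm
    at most r if r^2 K(z,w) - g(z) conj g(w) is nonnegative definite. The coordinate multiplications
    are not shown to be contractions, so von Neumann's inequality is not at hand; the bound on all
    powers replaces it, since growth like n^(1/2) still lets series with geometrically decaying
    coefficients converge. Existence of the space is separate from its properties, which are derived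
    for every space with this kernel. *)

(** * The modulus of complex numbers as a real number *)

Section Modulus.
Variable R : realType.
Implicit Types (z w u : R[i]) (x y : R).

(** The norm of [R[i]] is itself [R[i]]-valued; taking its real part moves estimates to [R], where
    [lra] and [nra] apply. *)
Definition modc z : R := complex.Re `|z|.

Lemma normE z : `|z| = (modc z)%:C.
Proof. by rewrite /modc normc_def. Qed.

Lemma real_complexP x y : (x%:C = y%:C) <-> x = y.
Proof. by split=> [[]|->]. Qed.

Lemma realcD x y : (x + y)%:C = x%:C + y%:C. Proof. exact: rmorphD. Qed.
Lemma realcB x y : (x - y)%:C = x%:C - y%:C. Proof. exact: rmorphB. Qed.
Lemma realcN x : (- x)%:C = - x%:C. Proof. exact: rmorphN. Qed.
Lemma realcM x y : (x * y)%:C = x%:C * y%:C. Proof. exact: rmorphM. Qed.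
Lemma realcX x n : (x ^+ n)%:C = x%:C ^+ n. Proof. exact: rmorphXn. Qed.
Lemma realcV x : (x^-1)%:C = x%:C^-1. Proof. exact: fmorphV. Qed.
Lemma realc_nat n : (n%:R : R)%:C = n%:R. Proof. exact: rmorph_nat. Qed.
Lemma realc0 : (0 : R)%:C = 0. Proof. by []. Qed.
Lemma realc1 : (1 : R)%:C = 1. Proof. by []. Qed.
Lemma realc_sum (I : Type) (r : seq I) (P : pred I) (F : I -> R) :
  (\sum_(i <- r | P i) F i)%:C = \sum_(i <- r | P i) (F i)%:C.
Proof. exact: rmorph_sum. Qed.

Definition realcE := (realcD, realcB, realcN, realcM, realcX, realcV,
  realc_nat, realc0, realc1).

Lemma realc_eq0 x : (x%:C == 0) = (x == 0).
Proof. by rewrite eq_complex /= eqxx andbT. Qed.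

Lemma realc_ge0 z : 0 <= z -> z = (complex.Re z)%:C.
Proof. by case: z => a b /ger0_Im /= ->. Qed.

Lemma ReD z w : complex.Re (z + w) = complex.Re z + complex.Re w.
Proof. by case: z; case: w. Qed.
Lemma ImD z w : complex.Im (z + w) = complex.Im z + complex.Im w.
Proof. by case: z; case: w. Qed.
Lemma ReN z : complex.Re (- z) = - complex.Re z. Proof. by case: z. Qed.
Lemma ImN z : complex.Im (- z) = - complex.Im z. Proof. by case: z. Qed.
Lemma ReB z w : complex.Re (z - w) = complex.Re z - complex.Re w.
Proof. by rewrite ReD ReN. Qed.
Lemma ImB z w : complex.Im (z - w) = complex.Im z - complex.Im w.
Proof. by rewrite ImD ImN. Qed.
Lemma ReM z w : complex.Re (z * w) =
  complex.Re z * complex.Re w - complex.Im z * complex.Im w.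
Proof. by case: z; case: w. Qed.
Lemma ImM z w : complex.Im (z * w) =
  complex.Re z * complex.Im w + complex.Im z * complex.Re w.
Proof. by case: z => a b; case: w => c d /=; rewrite addrC [b * c]mulrC mulrC. Qed.
Lemma ReJ z : complex.Re (Num.conj z) = complex.Re z. Proof. by case: z. Qed.
Lemma ImJ z : complex.Im (Num.conj z) = - complex.Im z. Proof. by case: z. Qed.
Lemma ReZ x z : complex.Re (x%:C * z) = x * complex.Re z.
Proof. by rewrite ReM /= mul0r subr0. Qed.
Lemma ImZ x z : complex.Im (x%:C * z) = x * complex.Im z.
Proof. by rewrite ImM /= mul0r addr0. Qed.

Lemma complex_ext z w : complex.Re z = complex.Re w ->
  complex.Im z = complex.Im w -> z = w.
Proof. by case: z; case: w => a b c d /= -> ->. Qed.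

Lemma conjR x : Num.conj (x%:C : R[i]) = x%:C.
Proof. by apply: complex_ext; rewrite ?ReJ ?ImJ /= ?oppr0. Qed.

Lemma modc_ge0 z : 0 <= modc z.
Proof. by rewrite -lecR -normE normr_ge0. Qed.
Hint Resolve modc_ge0 : core.

Lemma modcD z w : modc (z + w) <= modc z + modc w.
Proof. by rewrite -lecR realcD -!normE ler_normD. Qed.

Lemma modcM z w : modc (z * w) = modc z * modc w.
Proof. by apply/real_complexP; rewrite realcM -!normE normrM. Qed.

Lemma modc0 : modc 0 = 0.
Proof. by apply/real_complexP; rewrite -normE normr0. Qed.

Lemma modc1 : modc 1 = 1.
Proof. by apply/real_complexP; rewrite -normE normr1. Qed.

Lemma modcN z : modc (- z) = modc z.
Proof. by rewrite /modc normrN. Qed.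

Lemma modcBC z w : modc (z - w) = modc (w - z).
Proof. by rewrite -modcN opprB. Qed.

Lemma modcB z w : modc (z - w) <= modc z + modc w.
Proof. by rewrite -(modcN w) modcD. Qed.

Lemma modcV z : modc z^-1 = (modc z)^-1.
Proof. by apply/real_complexP; rewrite realcV -!normE normfV. Qed.

Lemma modcX z n : modc (z ^+ n) = modc z ^+ n.
Proof. by apply/real_complexP; rewrite realcX -!normE normrX. Qed.

Lemma modcJ z : modc (Num.conj z) = modc z.
Proof. by rewrite /modc norm_conjC. Qed.

Lemma modc_eq0 z : (modc z == 0) = (z == 0).
Proof. by rewrite -realc_eq0 -normE normr_eq0. Qed.

Lemma modc_gt0 z : (0 < modc z) = (z != 0).
Proof. by rewrite lt_def modc_ge0 andbT modc_eq0. Qed.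

Lemma modcR x : modc x%:C = `|x|.
Proof. by rewrite /modc normc_def /= expr0n addr0 sqrtr_sqr. Qed.

Lemma modc_nat n : modc n%:R = n%:R.
Proof. by rewrite -realc_nat modcR normr_nat. Qed.

Lemma sqr_modc z : modc z ^+ 2 = complex.Re z ^+ 2 + complex.Im z ^+ 2.
Proof. by rewrite /modc normc_def /= sqr_sqrtr // addr_ge0 ?sqr_ge0. Qed.

Lemma mulJc z : z * Num.conj z = (modc z ^+ 2)%:C.
Proof. by rewrite realcX -normE normCK. Qed.

Lemma modc_Re z : `|complex.Re z| <= modc z.
Proof. by rewrite -lecR -normE normc_ge_Re. Qed.

Lemma modc_Im z : `|complex.Im z| <= modc z.
Proof.
rewrite -ler_sqr ?nnegrE // real_normK ?num_real // sqr_modc.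
by rewrite lerDr sqr_ge0.
Qed.

Lemma modc_le z : modc z <= `|complex.Re z| + `|complex.Im z|.
Proof.
rewrite -ler_sqr ?nnegrE ?addr_ge0 // sqr_modc sqrrD !real_normK ?num_real //.
by rewrite addrAC lerDl mulrn_wge0 // mulr_ge0.
Qed.

Lemma modc_sum (I : Type) (r : seq I) (P : pred I) (F : I -> R[i]) :
  modc (\sum_(i <- r | P i) F i) <= \sum_(i <- r | P i) modc (F i).
Proof.
elim/big_rec2: _ => [|i a b _ h]; first by rewrite modc0.
by apply: (le_trans (modcD _ _)); rewrite lerD2l.
Qed.

Lemma modc_subadd z w : modc z - modc w <= modc (z - w).
Proof. by rewrite lerBlDr -{1}(subrK w z) modcD. Qed.

Lemma modc_small z : (forall e : R, 0 < e -> modc z <= e) -> z = 0.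
Proof.
move=> h; apply/eqP; rewrite -modc_eq0 eq_le modc_ge0 andbT leNgt.
by apply/negP => z0; have := h (modc z / 2) (divr_gt0 z0 (ltr0Sn _ 1)); lra.
Qed.

Lemma real_small x : 0 <= x -> (forall e : R, 0 < e -> x <= e) -> x = 0.
Proof.
move=> x0 h; apply/eqP; rewrite eq_le x0 andbT leNgt.
by apply/negP => xp; have := h (x / 2) (divr_gt0 xp (ltr0Sn _ 1)); lra.
Qed.

End Modulus.
#[global] Hint Extern 0 (is_true (0 <= modc _)%R) => solve [apply: modc_ge0] : core.

(** * Convergence of complex sequences and series *)

Section Sequences.
Variable R : realType.
Implicit Types (u v : nat -> R[i]) (l m : R[i]).

Definition cvs u l := forall e : R, 0 < e ->
  exists N, forall n, (N <= n)%N -> modc (u n - l) <= e.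

Definition sums u l := cvs (fun n => \sum_(k < n) u k) l.

Lemma cvs_ext u v l : (forall n, u n = v n) -> cvs u l -> cvs v l.
Proof. by move=> uv h e /h [N hN]; exists N => n /hN; rewrite uv. Qed.

Lemma cvs_cst l : cvs (fun=> l) l.
Proof. by move=> e e0; exists 0%N => n _; rewrite subrr modc0 ltW. Qed.

(** [K] may be any real, even negative: [e] is divided by [|K| + 1]. *)
Lemma cvsP u l K : (forall e : R, 0 < e ->
  exists N, forall n, (N <= n)%N -> modc (u n - l) <= K * e) -> cvs u l.
Proof.
move=> h e e0; have K0 : 0 < `|K| + 1 by rewrite ltr_wpDl.
have [N hN] := h (e / (`|K| + 1)) (divr_gt0 e0 K0).
exists N => n /hN /le_trans; apply.
rewrite mulrCA -[leRHS]mulr1; apply: ler_wpM2l; first exact: ltW.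
by rewrite ler_pdivrMr // mul1r (le_trans (ler_norm _)) // lerDl.
Qed.

Lemma cvs_uniq u l m : cvs u l -> cvs u m -> l = m.
Proof.
move=> ul um; apply/eqP; rewrite -subr_eq0; apply/eqP/modc_small => e e0.
have e2 : 0 < e / 2 by rewrite divr_gt0.
have [N hN] := ul _ e2; have [M hM] := um _ e2.
have -> : l - m = (u (maxn N M) - m) - (u (maxn N M) - l) by ring.
apply: (le_trans (modcB _ _)).
by rewrite [e]splitr lerD // ?hM ?hN // ?leq_maxl ?leq_maxr.
Qed.

Lemma cvsD u v l m : cvs u l -> cvs v m -> cvs (fun n => u n + v n) (l + m).
Proof.
move=> ul vm; apply: (@cvsP _ _ 2) => e e0.
have [N hN] := ul _ e0; have [M hM] := vm _ e0.
exists (maxn N M) => n; rewrite geq_max => /andP[/hN h1 /hM h2].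
by rewrite opprD addrACA (le_trans (modcD _ _)) // mulrDl mul1r lerD.
Qed.

Lemma cvs_bounded u l : cvs u l -> exists2 B : R, 0 <= B & forall n, modc (u n) <= B.
Proof.
move=> /(_ 1 ltr01) [N hN].
exists (\sum_(k < N) modc (u k) + (modc l + 1)) => [|n].
  by apply: addr_ge0; [exact: sumr_ge0 | exact: addr_ge0].
have [nN|/hN h] := ltnP n N.
  rewrite (bigD1 (Ordinal nN)) //= -!addrA lerDl !addr_ge0 ?sumr_ge0 //.
apply: ler_wpDl; first exact: sumr_ge0.
by rewrite -{1}(subrK l (u n)) addrC (le_trans (modcD _ _)) // lerD2l.
Qed.

Lemma cvsM u v l m : cvs u l -> cvs v m -> cvs (fun n => u n * v n) (l * m).
Proof.
move=> ul vm; have [B B0 hB] := cvs_bounded ul.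
apply: (@cvsP _ _ (B + modc m)) => e e0.
have [N hN] := ul _ e0; have [M hM] := vm _ e0.
exists (maxn N M) => n; rewrite geq_max => /andP[/hN h1 /hM h2].
have -> : u n * v n - l * m = u n * (v n - m) + (u n - l) * m by ring.
apply: (le_trans (modcD _ _)); rewrite !modcM mulrDl lerD //; first exact: ler_pM.
by rewrite mulrC ler_wpM2l.
Qed.

Lemma cvsZ u l m : cvs u l -> cvs (fun n => m * u n) (m * l).
Proof. exact/cvsM/cvs_cst. Qed.

Lemma cvsN u l : cvs u l -> cvs (fun n => - u n) (- l).
Proof. by move=> /(@cvsZ _ _ (-1)) h; rewrite -mulN1r; apply: cvs_ext h => n; rewrite mulN1r. Qed.

Lemma cvsB u v l m : cvs u l -> cvs v m -> cvs (fun n => u n - v n) (l - m).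
Proof. by move=> ul /cvsN; apply: cvsD. Qed.

Lemma cvsJ u l : cvs u l -> cvs (fun n => Num.conj (u n)) (Num.conj l).
Proof. by move=> ul e /ul [N hN]; exists N => n /hN; rewrite -rmorphB modcJ. Qed.

Lemma cvs_sum (I : Type) (r : seq I) (F : I -> nat -> R[i]) (L : I -> R[i]) :
  (forall i, cvs (F i) (L i)) ->
  cvs (fun n => \sum_(i <- r) F i n) (\sum_(i <- r) L i).
Proof.
move=> h; elim: r => [|i r IH].
  by rewrite big_nil; apply: cvs_ext (cvs_cst _) => n; rewrite big_nil.
rewrite big_cons; apply: cvs_ext (cvsD (h i) IH) => n.
by rewrite big_cons.
Qed.

Lemma cvs_sub u l (p : nat -> nat) : (forall n, (n <= p n)%N) ->
  cvs u l -> cvs (fun n => u (p n)) l.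
Proof.
move=> hp ul e /ul [N hN]; exists N => n Nn; apply: hN.
exact: leq_trans (hp n).
Qed.

Lemma cvs_shift u l (k : nat) : cvs (fun n => u (n + k)%N) l -> cvs u l.
Proof.
move=> ul e /ul [N hN]; exists (N + k)%N => n Nn.
by have := hN (n - k)%N; rewrite subnK; [apply; lia | lia].
Qed.

Lemma cvs_modc_le u l (B : R) : cvs u l -> (forall n, modc (u n) <= B) -> modc l <= B.
Proof.
move=> ul hB; apply/ler_addgt0Pr => e e0; have [N hN] := ul _ e0.
rewrite -(subrK (u N) l) addrC (le_trans (modcD _ _)) // lerD // modcBC.
exact: hN.
Qed.

Lemma cvs_ge0 u l : cvs u l -> (forall n, 0 <= u n) -> 0 <= l.
Proof.
move=> ul u0.
have e1 e : 0 < e -> (- complex.Re l <= e) /\ (`|complex.Im l| <= e).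
  move=> e0; have [N /(_ N (leqnn _)) hN] := ul _ e0.
  have uN := realc_ge0 (u0 N).
  have := le_trans (modc_Re _) hN; have := le_trans (modc_Im _) hN.
  rewrite ReB ImB uN /= sub0r normrN => -> ; split => //.
  have : 0 <= complex.Re (u N) by rewrite -lecR -uN.
  by move: H; rewrite ler_norml => /andP[_]; lra.
rewrite lecE /= eq_sym; apply/andP; split.
  by rewrite eq_sym -normr_eq0; apply/eqP/real_small => // e /e1 [].
by rewrite leNgt; apply/negP => l0;
   have [] := e1 (- complex.Re l / 2); lra.
Qed.

Lemma cvs_0 u : cvs u 0 <-> forall e : R, 0 < e ->
  exists N, forall n, (N <= n)%N -> modc (u n) <= e.
Proof. by split=> h e /h [N hN]; exists N => n /hN; rewrite subr0. Qed.

Definition cauchys u := forall e : R, 0 < e ->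
  exists N, forall i j, (N <= i)%N -> (N <= j)%N -> modc (u i - u j) <= e.

Lemma real_cauchy (x : nat -> R) : (forall e : R, 0 < e ->
    exists N, forall i j, (N <= i)%N -> (N <= j)%N -> `|x i - x j| <= e) ->
  exists a : R, forall e : R, 0 < e ->
    exists N, forall n, (N <= n)%N -> `|x n - a| <= e.
Proof.
move=> hx.
(* The supremum of the eventual lower bounds, that is the limit inferior, is the limit. *)
pose A : set R := [set y | exists N, forall n, (N <= n)%N -> y <= x n].
have key e N : (forall i j, (N <= i)%N -> (N <= j)%N -> `|x i - x j| <= e) ->
    A (x N - e) /\ ubound A (x N + e).
  move=> hN; split.
    by exists N => n Nn; have := hN _ _ (leqnn N) Nn; rewrite ler_norml; lra.
  move=> y [M hM]; have := hM (maxn N M) (leq_maxr _ _).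
  by have := hN _ _ (leq_maxl N M) (leqnn N); rewrite ler_norml; lra.
have supA : has_sup A.
  have [N hN] := hx _ ltr01; have [h1 h2] := key _ _ hN.
  by split; [exists (x N - 1) | exists (x N + 1)].
exists (sup A) => e e0; have [N hN] := hx _ (divr_gt0 e0 (ltr0Sn R 1)).
have [h1 h2] := key _ _ hN.
have h3 : x N - e / 2 <= sup A by apply: ub_le_sup => //; case: supA.
have h4 : sup A <= x N + e / 2 by apply: ge_sup => //; case: supA.
exists N => n Nn; have := hN _ _ Nn (leqnn N).
by rewrite !ler_norml; lra.
Qed.

Lemma cauchys_cvs u : cauchys u -> exists l, cvs u l.
Proof.
move=> hu.
have [|a ha] := @real_cauchy (fun n => complex.Re (u n)).
  move=> e /hu [N hN]; exists N => m n Nm Nn; rewrite -ReB.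
  exact: le_trans (modc_Re _) (hN _ _ Nm Nn).
have [|b hb] := @real_cauchy (fun n => complex.Im (u n)).
  move=> e /hu [N hN]; exists N => m n Nm Nn; rewrite -ImB.
  exact: le_trans (modc_Im _) (hN _ _ Nm Nn).
exists (a +i* b); apply: (@cvsP _ _ 2) => e e0.
have [N hN] := ha _ e0; have [M hM] := hb _ e0.
exists (maxn N M) => n; rewrite geq_max => /andP[/hN h1 /hM h2].
by rewrite (le_trans (modc_le _)) // mulrDl mul1r ReB ImB lerD.
Qed.

Lemma tail_small (x : nat -> R) (B : R) : (forall n, 0 <= x n) ->
  (forall n, \sum_(k < n) x k <= B) -> forall e : R, 0 < e ->
  exists N, forall n p : nat, (N <= n)%N -> \sum_(n <= k < p) x k <= e.
Proof.
move=> x0 hB e e0.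
pose A : set R := range (fun n => \sum_(k < n) x k).
have supA : has_sup A.
  by split; [exists (\sum_(k < 0) x k); exists 0%N | exists B => _ [n _ <-]].
have [_ [N _ <-] hN] := sup_adherent e0 supA.
exists N => n m Nn.
have [nm|mn] := leqP n m; last by rewrite big_geq ?ltW // ltnW.
have h1 : \sum_(k < m) x k <= sup A.
  by apply: ub_le_sup; [case: supA | exists m].
have : \sum_(k < m) x k = \sum_(k < n) x k + \sum_(n <= k < m) x k.
  by rewrite -!(big_mkord xpredT) (big_cat_nat (n := n)).
have : \sum_(k < N) x k <= \sum_(k < n) x k.
  rewrite -!(big_mkord xpredT) [leRHS](big_cat_nat (n := N)) //=.
  by rewrite lerDl sumr_ge0.
lra.
Qed.

Lemma psumB u (m n : nat) : (n <= m)%N ->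
  \sum_(k < m) u k - \sum_(k < n) u k = \sum_(n <= k < m) u k.
Proof.
move=> nm; rewrite -!(big_mkord xpredT) (big_cat_nat (n := n)) //=.
by rewrite addrAC subrr add0r.
Qed.

Lemma abs_sums u (x : nat -> R) (B : R) : (forall n, modc (u n) <= x n) ->
  (forall n, \sum_(k < n) x k <= B) -> exists2 l, sums u l & modc l <= B.
Proof.
move=> ux hB.
have x0 n : 0 <= x n by apply: le_trans (ux n).
have [|l hl] := @cauchys_cvs (fun n => \sum_(k < n) u k).
  move=> e e0; have [N hN] := tail_small x0 hB e0; exists N.
  have key (m n : nat) : (N <= m)%N -> (N <= n)%N -> (n <= m)%N ->
    modc (\sum_(k < m) u k - \sum_(k < n) u k) <= e.
    move=> Nm Nn nm; rewrite psumB // (le_trans (modc_sum _ _ _)) //.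
    by apply: le_trans (hN _ m Nn); apply: ler_sum.
  move=> m n Nm Nn; have [nm|/ltnW nm] := leqP n m; first exact: key.
  by rewrite modcBC key.
exists l => //; apply: (cvs_modc_le hl) => n.
by rewrite (le_trans (modc_sum _ _ _)) // (le_trans _ (hB n)) // ler_sum.
Qed.

Lemma sums_ext u v l : (forall n, u n = v n) -> sums u l -> sums v l.
Proof. by move=> uv; apply: cvs_ext => n; apply: eq_bigr. Qed.

Lemma sumsD u v l m : sums u l -> sums v m -> sums (fun n => u n + v n) (l + m).
Proof. by move=> ul vm; apply: cvs_ext (cvsD ul vm) => n; rewrite big_split. Qed.

Lemma sumsZ u l m : sums u l -> sums (fun n => m * u n) (m * l).
Proof. by move=> /(@cvsZ _ _ m); apply: cvs_ext => n; rewrite mulr_sumr. Qed.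

Lemma sumsB u v l m : sums u l -> sums v m -> sums (fun n => u n - v n) (l - m).
Proof. by move=> ul vm; apply: cvs_ext (cvsB ul vm) => n; rewrite sumrB. Qed.

Lemma sumsJ u l : sums u l -> sums (fun n => Num.conj (u n)) (Num.conj l).
Proof. by move=> /cvsJ; apply: cvs_ext => n; rewrite rmorph_sum. Qed.

Lemma sums_modc_le u l (x : nat -> R) (B : R) : sums u l ->
  (forall n, modc (u n) <= x n) -> (forall n, \sum_(k < n) x k <= B) -> modc l <= B.
Proof.
move=> ul ux hB; apply: (cvs_modc_le ul) => n.
by rewrite (le_trans (modc_sum _ _ _)) // (le_trans _ (hB n)) // ler_sum.
Qed.

Lemma sums_uniq u l m : sums u l -> sums u m -> l = m.
Proof. exact: cvs_uniq. Qed.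

Lemma sums0 : sums (fun=> 0) 0.
Proof. by apply: cvs_ext (cvs_cst _) => n; rewrite big1. Qed.

Lemma sums_shift1 u l : sums (fun n => u n.+1) l -> sums u (u 0%N + l).
Proof.
move=> h; apply: (@cvs_shift _ _ 1%N).
by apply: cvs_ext (cvsD (cvs_cst (u 0%N)) h) => n; rewrite addn1 big_ord_recl.
Qed.

(** The triangular sum differs from the product of the partial sums by the terms with [k + j >= n]:
    for [k] below a fixed [N] they meet only a tail of [y], and the other [k] lie in a tail of
    [x]. *)
Lemma sums_cauchy_product u v l m (x y : nat -> R) (Bx By : R) :
  (forall n, modc (u n) <= x n) -> (forall n, \sum_(k < n) x k <= Bx) ->
  (forall n, modc (v n) <= y n) -> (forall n, \sum_(k < n) y k <= By) ->
  sums u l -> sums v m ->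
  sums (fun n => \sum_(k < n.+1) u k * v (n - k)%N) (l * m).
Proof.
move=> ux hBx vy hBy ul vm.
have x0 n : 0 <= x n by apply: le_trans (ux n).
have y0 n : 0 <= y n by apply: le_trans (vy n).
have triangle (f : nat -> nat -> R[i]) n :
    \sum_(j < n) \sum_(k < j.+1) f k (j - k)%N =
    \sum_(k < n) \sum_(j < n - k) f k j.
  elim: n => [|n IH]; first by rewrite !big_ord0.
  rewrite big_ord_recr /= IH [in RHS]big_ord_recr /= subSnn big_ord1.
  rewrite [X in _ = X + _](eq_bigr (fun k : 'I_n => \sum_(j < n - k) f k j + f k (n - k)%N)).
    by rewrite big_split /= big_ord_recr /= subnn addrA.
  by move=> k _; rewrite subSn ?(ltnW (ltn_ord _)) // big_ord_recr.
have := cvsM ul vm => h.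
rewrite -[l * m]addr0.
have diff : cvs (fun n => \sum_(j < n) \sum_(k < j.+1) u k * v (j - k)%N -
   (\sum_(k < n) u k) * (\sum_(k < n) v k)) 0.
  apply/cvs_0 => e e0.
  have Bx0 : 0 <= Bx by have := hBx 0%N; rewrite big_ord0.
  have By0 : 0 <= By by have := hBy 0%N; rewrite big_ord0.
  have e1 : 0 < e / (Bx + By + 1) by rewrite divr_gt0 // ltr_wpDl ?addr_ge0.
  have [N hN] := tail_small x0 hBx e1; have [M hM] := tail_small y0 hBy e1.
  exists (N + M)%N => n NMn.
  rewrite (triangle (fun k j => u k * v j)) mulr_suml -sumrB.
  apply: (le_trans (modc_sum _ _ _)).
  have step (k : 'I_n) : modc (\sum_(j < n - k) u k * v j - u k * \sum_(j < n) v j) <=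
      x k * \sum_(n - k <= j < n) y j.
    rewrite -mulr_sumr -mulrBr modcM ler_pM // modcBC psumB ?leq_subr //.
    by rewrite (le_trans (modc_sum _ _ _)) // ler_sum.
  apply: (le_trans (ler_sum _ (fun k _ => step k))).
  rewrite -(big_mkord xpredT (fun k => x k * \sum_(n - k <= j < n) y j)).
  rewrite (big_cat_nat (n := N)) //=; last by lia.
  have h1 : \sum_(0 <= k < N) x k * \sum_(n - k <= j < n) y j <=
      Bx * (e / (Bx + By + 1)).
    rewrite (le_trans (y := (\sum_(k < N) x k) * (e / (Bx + By + 1)))) //.
      rewrite big_mkord mulr_suml ler_sum // => k _.
      by rewrite ler_wpM2l // hM //; have := ltn_ord k; lia.
    by rewrite ler_wpM2r // ltW.
  have h2 : \sum_(N <= k < n) x k * \sum_(n - k <= j < n) y j <=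
      By * (e / (Bx + By + 1)).
    rewrite (le_trans (y := (\sum_(N <= k < n) x k) * By)) //.
      rewrite mulr_suml; apply: ler_sum_nat => k _.
      rewrite ler_wpM2l // (le_trans _ (hBy n)) //.
      rewrite -(big_mkord xpredT) (big_cat_nat (n := (n - k)%N) (m := 0%N)) ?leq_subr //=.
      by rewrite lerDr sumr_ge0.
    by rewrite mulrC ler_wpM2l // hN.
  apply: (le_trans (lerD h1 h2)).
  rewrite -mulrDl mulrCA -[leRHS]mulr1; apply: ler_wpM2l; first exact: ltW.
  by rewrite ler_pdivrMr ?mul1r ?lerDl // ltr_wpDl ?addr_ge0.
apply: cvs_ext (cvsD h diff) => n.
by rewrite addrCA subrr addr0.
Qed.

End Sequences.

(** * Compactness of the unit interval and square by dyadic bisection *)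

Section Dyadic.
Variable R : realType.
Implicit Types (s t a b : R).

Definition dy (n : nat) : R := 2^-1 ^+ n.

Lemma dy_gt0 n : 0 < dy n. Proof. by rewrite exprn_gt0 // invr_gt0. Qed.
Hint Resolve dy_gt0 : core.
Lemma dy_ge0 n : 0 <= dy n. Proof. exact: ltW. Qed.
Hint Resolve dy_ge0 : core.
Lemma dyS n : dy n = dy n.+1 + dy n.+1.
Proof. by rewrite /dy exprS; field. Qed.

Lemma dy_small (e : R) : 0 < e -> exists N, forall n, (N <= n)%N -> dy n <= e.
Proof.
move=> e0; have dyn n : dy n <= n.+1%:R^-1.
  rewrite /dy exprVn lef_pV2 ?posrE ?ltr0n ?exprn_gt0 //.
  by rewrite -natrX ler_nat ltn_expl.
exists (Num.bound e^-1) => n Nn.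
apply: (le_trans (dyn n)); rewrite invf_ple ?posrE //.
apply: ltW; apply: lt_le_trans (archi_boundP _) _; first by rewrite invr_ge0 ltW.
by rewrite ler_nat ltnW.
Qed.

(** [P a b n] speaks of the square with corner (a, b) and side 2^-n. If it failed on the unit
    square, it would fail on nested squares shrinking to a point (s, t), against the local
    hypothesis there. The squares are closed, so the point may lie on their boundary. *)
Lemma dyadic_cousin (P : R -> R -> nat -> Prop) :
  (forall a b n, P a b n.+1 -> P (a + dy n.+1) b n.+1 -> P a (b + dy n.+1) n.+1 ->
     P (a + dy n.+1) (b + dy n.+1) n.+1 -> P a b n) ->
  (forall s t, 0 <= s <= 1 -> 0 <= t <= 1 -> exists N, forall n, (N <= n)%N ->
     forall a b, 0 <= a -> a + dy n <= 1 -> 0 <= b -> b + dy n <= 1 ->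
     a <= s <= a + dy n -> b <= t <= b + dy n -> P a b n) ->
  P 0 0 0%N.
Proof.
move=> glue loc; apply: contrapT => nP.
have step (x : R * R * nat) : exists y : R * R,
    ~ P x.1.1 x.1.2 x.2 -> [/\ ~ P y.1 y.2 x.2.+1,
     x.1.1 <= y.1, y.1 + dy x.2.+1 <= x.1.1 + dy x.2,
     x.1.2 <= y.2 & y.2 + dy x.2.+1 <= x.1.2 + dy x.2].
  case: x => [[a b] n] /=; have d0 := dy_ge0 n.+1; have dS := dyS n.
  have [h1|h1] := pselect (P a b n.+1); last by exists (a, b) => _; split => //=; lra.
  have [h2|h2] := pselect (P (a + dy n.+1) b n.+1);
    last by exists (a + dy n.+1, b) => _; split => //=; lra.
  have [h3|h3] := pselect (P a (b + dy n.+1) n.+1);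
    last by exists (a, b + dy n.+1) => _; split => //=; lra.
  have [h4|h4] := pselect (P (a + dy n.+1) (b + dy n.+1) n.+1);
    last by exists (a + dy n.+1, b + dy n.+1) => _; split => //=; lra.
  (* An arbitrary pair: with all four quarters satisfying [P], [glue] refutes the premise. *)
  by exists (0, 0) => /(_ (glue _ _ _ h1 h2 h3 h4)).
have [f hf] := choice step.
pose c := fix c n := if n is m.+1 then f (c m, m) else (0, 0).
have cS n : c n.+1 = f (c n, n) by [].
have hc n : ~ P (c n).1 (c n).2 n.
  by elim: n => // n IH; have [] := hf (c n, n) IH; rewrite -cS.
have mono1 n k : (c n).1 <= (c (n + k)%N).1 /\
    (c (n + k)%N).1 + dy (n + k)%N <= (c n).1 + dy n.
  elim: k => [|k [IH1 IH2]]; first by rewrite addn0.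
  rewrite addnS; have [] := hf (c (n + k)%N, (n + k)%N) (hc _).
  by rewrite -cS /= => _ h1 h2 _ _; split; lra.
have mono2 n k : (c n).2 <= (c (n + k)%N).2 /\
    (c (n + k)%N).2 + dy (n + k)%N <= (c n).2 + dy n.
  elim: k => [|k [IH1 IH2]]; first by rewrite addn0.
  rewrite addnS; have [] := hf (c (n + k)%N, (n + k)%N) (hc _).
  by rewrite -cS /= => _ _ _ h1 h2; split; lra.
have lim (g : nat -> R) : (forall n k, g n <= g (n + k)%N /\
    g (n + k)%N + dy (n + k)%N <= g n + dy n) ->
    exists l, forall n, g n <= l <= g n + dy n.
  move=> hg; have ub n : ubound (range g) (g n + dy n).
    move=> _ [m _ <-]; have d0 := dy_ge0.
    have [_] := hg n m; have [h1 _] := hg m n; rewrite addnC in h1.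
    by have := d0 (n + m)%N; lra.
  have sg : has_sup (range g).
    by split; [exists (g 0%N); exists 0%N | exists (g 0%N + dy 0); exact: ub].
  exists (sup (range g)) => n; apply/andP; split.
    by apply: ub_le_sup; [case: sg | exists n].
  by apply: ge_sup; [case: sg | exact: ub].
have [s hs] := lim _ mono1; have [t ht] := lim _ mono2.
have dy0 : dy 0 = 1 by rewrite /dy expr0.
have s01 : 0 <= s <= 1 by have := hs 0%N; rewrite /= dy0 add0r.
have t01 : 0 <= t <= 1 by have := ht 0%N; rewrite /= dy0 add0r.
have [N hN] := loc s t s01 t01.
apply: (hc N); apply: hN => //.
- by have [] := mono1 0%N N; rewrite add0n.
- by have [_] := mono1 0%N N; rewrite add0n /= dy0 add0r.
- by have [] := mono2 0%N N; rewrite add0n.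
- by have [_] := mono2 0%N N; rewrite add0n /= dy0 add0r.
Qed.

Lemma dyadic_cousin1 (P : R -> nat -> Prop) :
  (forall a n, P a n.+1 -> P (a + dy n.+1) n.+1 -> P a n) ->
  (forall s, 0 <= s <= 1 -> exists N, forall n, (N <= n)%N ->
     forall a, 0 <= a -> a + dy n <= 1 -> a <= s <= a + dy n -> P a n) ->
  P 0 0%N.
Proof.
move=> glue loc; apply: (@dyadic_cousin (fun a _ n => P a n)).
  by move=> a _ n h1 h2 _ _; apply: glue.
move=> s t s01 t01; have [N hN] := loc s s01; clear t01.
by exists N => n Nn a _ a0 a1 _ _ h _; apply: hN.
Qed.

End Dyadic.
#[global] Hint Extern 0 (is_true (0 < dy _ _)%R) => solve [apply: dy_gt0] : core.
#[global] Hint Extern 0 (is_true (0 <= dy _ _)%R) => solve [apply: dy_ge0] : core.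

Lemma ler_dist_both (R : realDomainType) (a s d : R) : a <= s -> s <= a + d ->
  `|a - s| <= d /\ `|a + d - s| <= d.
Proof. by move=> h1 h2; split; rewrite ler_norml; apply/andP; split; lra. Qed.

(** * Complex derivatives by explicit estimates *)

Section ComplexDerivative.
Variable R : realType.
Implicit Types (f g : R[i] -> R[i]) (z h d : R[i]).

Definition cderiv f z d := forall e : R, 0 < e -> exists2 r : R, 0 < r &
  forall h, modc h <= r -> modc (f (z + h) - f z - d * h) <= e * modc h.

Lemma cderivP f z d K : (forall e : R, 0 < e -> exists2 r : R, 0 < r &
  forall h, modc h <= r -> modc (f (z + h) - f z - d * h) <= K * e * modc h) ->
  cderiv f z d.
Proof.
move=> H e e0; have K0 : 0 < `|K| + 1 by rewrite ltr_wpDl.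
have [r r0 hr] := H (e / (`|K| + 1)) (divr_gt0 e0 K0).
exists r => // h /hr /le_trans; apply; apply: ler_wpM2r => //.
rewrite mulrCA -[leRHS]mulr1; apply: ler_wpM2l; first exact: ltW.
by rewrite ler_pdivrMr // mul1r (le_trans (ler_norm _)) // lerDl.
Qed.

Lemma cderiv_near f g z d (r : R) : 0 < r ->
  (forall h, modc h <= r -> f (z + h) = g (z + h)) -> cderiv f z d -> cderiv g z d.
Proof.
move=> r0 fg H e /H [r' r'0 hr']; exists (Num.min r r'); first by rewrite lt_min r0.
move=> h; rewrite le_min => /andP[h1 h2].
have gz : f z = g z by have := fg 0; rewrite modc0 addr0; apply; exact: ltW.
by rewrite -fg // -gz; exact: hr'.
Qed.

Lemma cderiv_ext f g z d : (forall w, f w = g w) -> cderiv f z d -> cderiv g z d.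
Proof. by move=> fg; apply: (cderiv_near (ltr01)) => h _. Qed.

Lemma cderiv_cst c z : cderiv (fun=> c) z 0.
Proof.
by move=> e e0; exists 1 => // h _; rewrite subrr mul0r subr0 modc0 mulr_ge0 // ltW.
Qed.

Lemma cderiv_id z : cderiv id z 1.
Proof.
move=> e e0; exists 1 => // h _.
have -> : id (z + h) - id z - 1 * h = 0 by rewrite /=; ring.
by rewrite modc0 mulr_ge0 // ltW.
Qed.

Lemma cderivD f g z d d' : cderiv f z d -> cderiv g z d' ->
  cderiv (fun w => f w + g w) z (d + d').
Proof.
move=> hf hg; apply: (@cderivP _ _ _ 2) => e e0.
have [r r0 hr] := hf _ e0; have [r' r'0 hr'] := hg _ e0.
exists (Num.min r r'); first by rewrite lt_min r0.
move=> h; rewrite le_min => /andP[/hr h1 /hr' h2].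
have -> : f (z + h) + g (z + h) - (f z + g z) - (d + d') * h =
  (f (z + h) - f z - d * h) + (g (z + h) - g z - d' * h) by ring.
by rewrite (le_trans (modcD _ _)) // mulrDl mul1r mulrDl lerD.
Qed.

Lemma cderiv_lip f z d : cderiv f z d -> exists2 r : R, 0 < r &
  forall h, modc h <= r -> modc (f (z + h) - f z) <= (modc d + 1) * modc h.
Proof.
move=> /(_ 1 ltr01) [r r0 hr]; exists r => // h /hr; rewrite mul1r => H.
rewrite -(subrK (d * h) (f _ - _)) (le_trans (modcD _ _)) // modcM; lra.
Qed.

Lemma cderiv_cont f z d : cderiv f z d -> forall e : R, 0 < e -> exists2 r : R, 0 < r &
  forall h, modc h <= r -> modc (f (z + h) - f z) <= e.
Proof.
move=> /cderiv_lip [r r0 hr] e e0; have d0 := modc_ge0 d.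
have d1 : 0 < modc d + 1 by lra.
exists (Num.min r (e / (modc d + 1))); first by rewrite lt_min r0 divr_gt0.
move=> h; rewrite le_min => /andP[/hr h1 h2]; apply: (le_trans h1).
by rewrite mulrC -ler_pdivlMr.
Qed.

Lemma cderivM f g z d d' : cderiv f z d -> cderiv g z d' ->
  cderiv (fun w => f w * g w) z (d * g z + f z * d').
Proof.
move=> hf hg; have [r1 r10 hr1] := cderiv_lip hf.
apply: (@cderivP _ _ _ (modc (g z) + modc (f z) + (modc d + 1))) => e e0.
have [r2 r20 hr2] := hf _ e0; have [r3 r30 hr3] := hg _ e0.
have [r4 r40 hr4] := cderiv_cont hg e0.
exists (Num.min (Num.min r1 r2) (Num.min r3 r4)); first by rewrite !lt_min r10 r20 r30.
move=> h; rewrite !le_min => /andP[/andP[/hr1 h1 /hr2 h2] /andP[/hr3 h3 /hr4 h4]].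
have -> : f (z + h) * g (z + h) - f z * g z - (d * g z + f z * d') * h =
  (f (z + h) - f z - d * h) * g z + f z * (g (z + h) - g z - d' * h) +
  (f (z + h) - f z) * (g (z + h) - g z) by ring.
apply: (le_trans (modcD _ _)); rewrite (mulrDl _ _ e) (mulrDl _ _ (modc h)).
apply: lerD.
  apply: (le_trans (modcD _ _)).
  rewrite !modcM (mulrDl _ _ e) (mulrDl _ _ (modc h)); apply: lerD.
    by rewrite -mulrA mulrC ler_wpM2l.
  by rewrite -mulrA ler_wpM2l.
rewrite modcM -mulrA [e * _]mulrC mulrA.
by apply: ler_pM.
Qed.

Lemma cderivZ f z d c : cderiv f z d -> cderiv (fun w => c * f w) z (c * d).
Proof. by move=> /(cderivM (cderiv_cst c z)); rewrite mul0r add0r. Qed.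

Lemma cderivN f z d : cderiv f z d -> cderiv (fun w => - f w) z (- d).
Proof.
by move=> /(@cderivZ _ _ _ (-1)); rewrite mulN1r; apply: cderiv_ext => w; rewrite mulN1r.
Qed.

Lemma cderivB f g z d d' : cderiv f z d -> cderiv g z d' ->
  cderiv (fun w => f w - g w) z (d - d').
Proof. by move=> hf /cderivN; apply: cderivD. Qed.

Lemma cderiv_comp f g z d d' : cderiv f z d -> cderiv g (f z) d' ->
  cderiv (fun w => g (f w)) z (d' * d).
Proof.
move=> hf hg; have [r1 r10 hr1] := cderiv_lip hf.
apply: (@cderivP _ _ _ (modc d + 1 + modc d')) => e e0.
have [r2 r20 hr2] := hg _ e0; have [r3 r30 hr3] := cderiv_cont hf r20.
have [r4 r40 hr4] := hf _ e0.
exists (Num.min r1 (Num.min r3 r4)); first by rewrite !lt_min r10 r30.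
move=> h; rewrite !le_min => /and3P[/hr1 h1 /hr3/hr2 h3 /hr4 h4].
rewrite [f z + _]addrC subrK in h3.
have -> : g (f (z + h)) - g (f z) - d' * d * h =
  (g (f (z + h)) - g (f z) - d' * (f (z + h) - f z)) +
  d' * (f (z + h) - f z - d * h) by ring.
apply: (le_trans (modcD _ _)); rewrite (mulrDl _ _ e) (mulrDl _ _ (modc h)).
apply: lerD.
  apply: (le_trans h3); rewrite [_ * e]mulrC -mulrA; apply: ler_wpM2l => //.
  exact: ltW.
by rewrite modcM -mulrA ler_wpM2l.
Qed.

Lemma cderivV z : z != 0 -> cderiv (fun w => w^-1) z (- z ^- 2).
Proof.
move=> z0; have mz : 0 < modc z by rewrite modc_gt0.
apply: (@cderivP _ _ _ (2 / modc z ^+ 3)) => e e0.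
exists (Num.min e (modc z / 2)); first by rewrite lt_min e0 divr_gt0.
move=> h; rewrite le_min => /andP[h1 h2].
have zh : modc z / 2 <= modc (z + h).
  by have := modc_subadd z (- h); rewrite opprK modcN; lra.
have zh0 : z + h != 0 by rewrite -modc_gt0; lra.
have -> : (z + h)^-1 - z^-1 - - z ^- 2 * h = h ^+ 2 / (z ^+ 2 * (z + h)).
  by field; rewrite z0 zh0.
rewrite modcM modcV modcX modcM modcX expr2 -mulrA [leRHS]mulrC ler_wpM2l //.
rewrite [2 / _ * e]mulrC; apply: ler_pM => //; rewrite ?invr_ge0 ?mulr_ge0 ?exprn_ge0 //.
have -> : 2 / modc z ^+ 3 = (modc z ^+ 2 * (modc z / 2))^-1.
  by field; rewrite gt_eqF.
rewrite lef_pV2 ?posrE ?mulr_gt0 ?exprn_gt0 ?divr_gt0 ?modc_gt0 //.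
by rewrite ler_wpM2l // exprn_ge0.
Qed.

(** It takes the place of integrating |f'| <= Re g' over [0, 1]. With an error proportional to the
    length, the inequality survives bisection, and on a short interval it follows from
    differentiability at a single point of it. *)
Lemma cderiv_mean_value (f g : R[i] -> R[i]) :
  (forall s : R, 0 <= s <= 1 -> exists d d',
     [/\ cderiv f s%:C d, cderiv g s%:C d' & modc d <= complex.Re d']) ->
  modc (f 1 - f 0) <= complex.Re (g 1 - g 0).
Proof.
move=> hfg; apply/ler_addgt0Pr => e e0.
have := @dyadic_cousin1 R (fun a n => modc (f (a + dy R n)%:C - f a%:C) <=
  complex.Re (g (a + dy R n)%:C - g a%:C) + e * dy R n).
have dy0 : dy R 0 = 1 by rewrite /dy expr0.
rewrite add0r dy0 mulr1; apply.
  move=> a n h1 h2; rewrite (dyS R n) addrA mulrDr.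
  have -> : f (a + dy R n.+1 + dy R n.+1)%:C - f a%:C =
    (f (a + dy R n.+1 + dy R n.+1)%:C - f (a + dy R n.+1)%:C) +
    (f (a + dy R n.+1)%:C - f a%:C) by ring.
  by apply: (le_trans (modcD _ _)); move: h1 h2; rewrite !ReB; lra.
move=> s s01; have [d [d' [hf hg dd]]] := hfg s s01.
have e4 : 0 < e / 2 by rewrite divr_gt0.
have [r r0 hr] := hf _ e4; have [r' r'0 hr'] := hg _ e4.
have rr0 : 0 < Num.min r r' by rewrite lt_min r0.
have [N hN] := dy_small rr0.
exists N => n Nn a _ _ /andP[hs1 hs2]; have d0 := dy_ge0 R n.
have key (c : R) : `|c - s| <= dy R n ->
    modc (f c%:C - f s%:C - d * (c - s)%:C) <= e / 2 * `|c - s| /\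
    modc (g c%:C - g s%:C - d' * (c - s)%:C) <= e / 2 * `|c - s|.
  move=> hc; have := le_trans hc (hN _ Nn); rewrite le_min => /andP[h1 h2].
  have := hr (c - s)%:C; have := hr' (c - s)%:C.
  have -> : s%:C + (c - s)%:C = c%:C by rewrite realcB; ring.
  by rewrite modcR => H' H; split; [apply: H | apply: H'].
have [n1 n2] := ler_dist_both hs1 hs2.
have [k1 k1'] := key _ n1; have [k2 k2'] := key _ n2.
(* As [s] lies between the endpoints, its distances to them add up to the length of the interval, so
   the two errors together cost at most [e / 2] times the length. *)
have e1 : `|a + dy R n - s| = a + dy R n - s by rewrite ger0_norm //; lra.
have e2 : `|a - s| = s - a by rewrite distrC ger0_norm //; lra.
rewrite e1 in k2 k2'; rewrite e2 in k1 k1'.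
set b := (a + dy R n) in k2 k2' *.
have A : modc (f b%:C - f a%:C) <= modc d * dy R n + e / 2 * dy R n.
  have -> : f b%:C - f a%:C = d * (dy R n)%:C +
     ((f b%:C - f s%:C - d * (b - s)%:C) - (f a%:C - f s%:C - d * (a - s)%:C)).
    by rewrite /b !realcB realcD; ring.
  apply: (le_trans (modcD _ _)); rewrite modcM modcR ger0_norm // lerD2l.
  apply: (le_trans (modcB _ _)); apply: (le_trans (lerD k2 k1)).
  by rewrite -mulrDr /b; apply: ler_wpM2l; lra.
have B : complex.Re d' * dy R n - e / 2 * dy R n <= complex.Re (g b%:C - g a%:C).
  have -> : g b%:C - g a%:C = (dy R n)%:C * d' +
     ((g b%:C - g s%:C - d' * (b - s)%:C) - (g a%:C - g s%:C - d' * (a - s)%:C)).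
    by rewrite /b !realcB realcD; ring.
  rewrite ReD ReZ mulrC lerD2l lerNl.
  apply: (le_trans (ler_norm _)); rewrite normrN; apply: (le_trans (modc_Re _)).
  apply: (le_trans (modcB _ _)); apply: (le_trans (lerD k2' k1')).
  by rewrite -mulrDr /b; apply: ler_wpM2l; lra.
have C : modc d * dy R n <= complex.Re d' * dy R n by rewrite ler_wpM2r.
lra.
Qed.

Lemma cderiv0_segment f (v : R[i]) :
  (forall s : R, 0 <= s <= 1 -> cderiv f (s%:C * v) 0) -> f v = f 0.
Proof.
move=> hf; have := @cderiv_mean_value (fun w => f (w * v)) (fun=> 0).
  rewrite mul1r mul0r subrr /= => h; apply/eqP; rewrite -subr_eq0 -modc_eq0.
  rewrite eq_le modc_ge0 andbT; apply: h.
  move=> s s01; exists 0, 0; split; rewrite ?modc0 //; last exact: cderiv_cst.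
  have := @cderiv_comp (fun w => w * v) f s%:C (1 * v + id s%:C * 0) 0.
  rewrite mul0r; apply; last exact: hf.
  exact: cderivM (cderiv_id _) (cderiv_cst _ _).
Qed.

End ComplexDerivative.

(** * The complex exponential *)

Section Exponential.
Variable R : realType.
Implicit Types (u v z h : R[i]) (x y : R).

Lemma is_derive_eps (f : R -> R) x d : is_derive x (1 : R) f d ->
  forall e : R, 0 < e -> exists2 r : R, 0 < r &
  forall h : R, `|h| <= r -> `|f (x + h) - f x - d * h| <= e * `|h|.
Proof.
move=> [df dv] e e0.
have : (fun h : R => h^-1 *: ((f \o shift x) (h *: (1 : R)) - f x)) @ 0^' --> d.
  by rewrite -dv; exact: df.
move/cvgrPdist_le => /(_ e e0); rewrite near_withinE => /nbhs_ballP[r /= r0 hr].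
exists (r / 2); first by rewrite divr_gt0.
move=> h hh; have [->|h0] := eqVneq h 0.
  by rewrite addr0 subrr mulr0 subr0 normr0 mulr0.
have rh : ball_ Num.norm 0 r h by rewrite /ball_ /= sub0r normrN; lra.
have := hr h rh h0; rewrite /= /GRing.scale /= mulr1 [h + x]addrC => H.
have -> : f (x + h) - f x - d * h = - (h * (d - h^-1 * (f (x + h) - f x))).
  by field.
by rewrite normrN normrM mulrC ler_wpM2r.
Qed.

Lemma expCE u : expC u = (expR (complex.Re u) * cos (complex.Im u)) +i*
  (expR (complex.Re u) * sin (complex.Im u)).
Proof. by apply: complex_ext; rewrite /expC ?ReZ ?ImZ. Qed.

Lemma expCD u v : expC (u + v) = expC u * expC v.
Proof.
by rewrite !expCE; apply: complex_ext; rewrite ?ReM ?ImM /= ReD ImD expRD ?cosD ?sinD; ring.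
Qed.

Lemma expC_real x : expC x%:C = (expR x)%:C.
Proof. by rewrite expCE /= cos0 sin0 mulr1 mulr0. Qed.

Lemma expC0 : expC 0 = 1 :> R[i].
Proof. by rewrite -[0]/((0 : R)%:C) expC_real expR0. Qed.

Lemma modc_expC u : modc (expC u) = expR (complex.Re u).
Proof.
apply/eqP; rewrite -(@eqrXn2 _ 2) ?expR_ge0 ?modc_ge0 // sqr_modc expCE /=.
by rewrite !exprMn -mulrDr cos2Dsin2 mulr1.
Qed.

Lemma expC_neq0 u : expC u != 0.
Proof. by rewrite -modc_gt0 modc_expC expR_gt0. Qed.

Lemma expCN u : expC (- u) = (expC u)^-1.
Proof.
apply: (mulfI (expC_neq0 u)).
by rewrite -expCD subrr expC0 divff // expC_neq0.
Qed.

Lemma expCB u v : expC (u - v) = expC u / expC v.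
Proof. by rewrite expCD expCN. Qed.

Lemma expCJ u : expC (Num.conj u) = Num.conj (expC u).
Proof.
by rewrite !expCE; apply: complex_ext; rewrite ?ReJ ?ImJ /= ?ReJ ?ImJ ?cosN ?sinN ?mulrN.
Qed.

Lemma expC_nat n u : expC (n%:R * u) = expC u ^+ n.
Proof.
elim: n => [|n IH]; first by rewrite mul0r expC0.
by rewrite exprS -IH -expCD -nat1r mulrDl mul1r.
Qed.

Lemma expC_eq1 u : expC u = 1 -> `|complex.Im u| < 2 * pi -> u = 0.
Proof.
move=> eu Iu; have := congr1 (@modc R) eu; rewrite modc_expC modc1 => Re0.
have {}Re0 : complex.Re u = 0 by apply: expR_inj; rewrite Re0 expR0.
have := congr1 (@complex.Re R) eu; have := congr1 (@complex.Im R) eu.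
rewrite expCE Re0 /= expR0 !mul1r => _ c1.
apply: complex_ext => //=; apply: contrapT => /eqP I0.
move: c1; rewrite -cos_norm => c1.
have a0 : 0 < `|complex.Im u| by rewrite normr_gt0.
(* 1 - cos x = 2 sin^2 (x / 2), and half of |Im u| lies in (0, pi), where the sine is positive. *)
have c2 : cos `|complex.Im u| = 1 - sin (`|complex.Im u| / 2) ^+ 2 *+ 2.
  rewrite {1}(splitr `|complex.Im u|) cosD -!expr2 cos2sin2; ring.
have s0 : 0 < sin (`|complex.Im u| / 2).
  by apply: sin_gt0_pi; apply/andP; split; lra.
by have := exprn_gt0 2 s0; lra.
Qed.

Lemma cderiv_expC0 : cderiv (@expC R) 0 1.
Proof.
apply: (@cderivP _ _ _ _ 9) => e e0.
(* The cap at 1 forces |h| <= 1 and hence [expR a <= 3]; the factor 9 is 4 from the real part [A1]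
   and 3 + 2 from the imaginary part [A2]. *)
pose e' := Num.min e 1.
have e'0 : 0 < e' by rewrite lt_min e0 ltr01.
have e'1 : e' <= 1 by rewrite ge_min lexx orbT.
have e'e : e' <= e by rewrite ge_min lexx.
move: e' e'0 e'1 e'e => e' e'0 e'1 e'e.
have [r1 r10 hr1] := is_derive_eps (is_derive_expR (0 : R)) e'0.
have [r2 r20 hr2] := is_derive_eps (is_derive_cos (0 : R)) e'0.
have [r3 r30 hr3] := is_derive_eps (is_derive_sin (0 : R)) e'0.
exists (Num.min (Num.min r1 r2) (Num.min r3 e')); first by rewrite !lt_min r10 r20 r30.
move=> h; rewrite !le_min => /andP[/andP[h1 h2] /andP[h3 h4]].
set a := complex.Re h; set b := complex.Im h.
have ha : `|a| <= modc h := modc_Re h; have hb : `|b| <= modc h := modc_Im h.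
have := hr1 a (le_trans ha h1); have := hr2 b (le_trans hb h2).
have := hr3 b (le_trans hb h3).
rewrite !add0r expR0 cos0 sin0 !mul1r !subr0 oppr0 mul0r subr0 => H3 H2 H1.
have m0 := modc_ge0 h.
have E1 : `|expR a - 1| <= 2 * modc h.
  rewrite -(subrK a (expR a - 1)) (le_trans (ler_normD _ _)) //.
  rewrite mulrDl mul1r lerD // (le_trans H1) //; nra.
have E2 : expR a <= 3.
  have : expR a - 1 <= 2 * modc h by apply: le_trans E1; rewrite ler_norm.
  have : modc h <= 1 by exact: le_trans e'1.
  by lra.
have E0 := expR_gt0 a.
have A1 : `|expR a * cos b - 1 - a| <= 4 * e' * modc h.
  have -> : expR a * cos b - 1 - a = (expR a - 1 - a) + expR a * (cos b - 1) by ring.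
  apply: (le_trans (ler_normD _ _)); rewrite normrM (ger0_norm (ltW E0)).
  have : expR a * `|cos b - 1| <= 3 * (e' * modc h).
    apply: ler_pM; rewrite ?(ltW E0) //.
    by apply: (le_trans H2); rewrite ler_wpM2l // ltW.
  have : e' * `|a| <= e' * modc h by rewrite ler_wpM2l // ltW.
  lra.
have A2 : `|expR a * sin b - b| <= 3 * e' * modc h + 2 * modc h * e'.
  have -> : expR a * sin b - b = expR a * (sin b - b) + (expR a - 1) * b by ring.
  apply: (le_trans (ler_normD _ _)); rewrite !normrM (ger0_norm (ltW E0)).
  apply: lerD.
    rewrite -mulrA; apply: ler_pM; rewrite ?(ltW E0) //.
    by apply: (le_trans H3); rewrite ler_wpM2l // ltW.
  apply: ler_pM => //; exact: le_trans hb h4.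
rewrite expC0; apply: (le_trans (modc_le _)).
rewrite expCE !ReB !ImB /= subr0 -/a -/b.
have e5 : e' * modc h <= e * modc h by rewrite ler_wpM2r.
have A12 := lerD A1 A2.
apply: le_trans A12 _; rewrite -!mulrA; set q := e' * modc h in e5 *.
have -> : modc h * e' = q by rewrite mulrC.
lra.
Qed.

Lemma cderiv_expC z : cderiv (@expC R) z (expC z).
Proof.
move=> e e0; have [r r0 hr] := cderiv_expC0 (divr_gt0 e0 (expR_gt0 (complex.Re z))).
exists r => // h /hr; rewrite add0r expC0 => H.
have -> : expC (z + h) - expC z - expC z * h = expC z * (expC h - 1 - 1 * h).
  by rewrite expCD; ring.
rewrite modcM modc_expC (le_trans (ler_wpM2l (expR_ge0 _) H)) //.
rewrite le_eqVlt; apply/orP; left; apply/eqP; field.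
by rewrite gt_eqF // expR_gt0.
Qed.

End Exponential.

(** * The principal logarithm on the right half-plane *)

Section Logarithm.
Variable R : realType.
Implicit Types (u v z h : R[i]) (x y : R).

Lemma modc_Re_gt0 u : 0 < complex.Re u -> 0 < modc u.
Proof. by move=> h; apply: lt_le_trans h (le_trans (ler_norm _) (modc_Re u)). Qed.

Lemma Re_LogC u : complex.Re (LogC u) = ln (modc u). Proof. by []. Qed.

Lemma LogC_real x : 0 < x -> LogC x%:C = (ln x)%:C.
Proof.
move=> x0; rewrite /LogC -/(modc _) modcR ger0_norm ?ltW //=.
by rewrite mul0r atan0 mulr0.
Qed.

Lemma expC_LogC u : 0 < complex.Re u -> expC (LogC u) = u.
Proof.
move=> Ru; have m0 := modc_Re_gt0 Ru; have h1 := sqr_modc u.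
rewrite expCE Re_LogC lnK ?posrE //=; change (Normc.normc u) with (modc u).
set t := _ / _; set r := modc u in m0 h1 t *.
set a := complex.Re u in Ru h1 t *; set b := complex.Im u in h1 t *.
have ra : 0 < r + a by rewrite addr_gt0.
have c2 : cos (atan t) ^+ 2 = (1 + t ^+ 2)^-1.
  by rewrite cos_atan exprVn sqr_sqrtr // addr_ge0 // sqr_ge0.
(* As b^2 = (r - a)(r + a), the tangent t = b / (r + a) of the half angle satisfies 1 + t^2 = 2 r /
   (r + a); the double-angle formulas then give a / r and b / r. *)
have t1 : 1 + t ^+ 2 = 2 * r / (r + a).
  have : (1 + t ^+ 2) * (r + a) ^+ 2 = 2 * r * (r + a).
    rewrite /t mulrDl mul1r expr_div_n divfK ?expf_neq0 ?gt_eqF //.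
    have -> : b ^+ 2 = r ^+ 2 - a ^+ 2 by rewrite h1; ring.
    by ring.
  move=> H; apply: (mulIf (x := (r + a) ^+ 2)); first by rewrite expf_neq0 // gt_eqF.
  by rewrite H; field; rewrite gt_eqF.
have cn0 : cos (atan t) != 0.
  by rewrite cos_atan invr_eq0 sqrtr_eq0 -ltNge t1 divr_gt0 // mulr_gt0.
have sn : sin (atan t) = t * cos (atan t).
  by rewrite -{2}(atanK t) /tan divfK.
have C : cos (2 * atan t) = a / r.
  rewrite mulrC mulr_natr cos_mulr2n c2 t1 invf_div -mulr_natr.
  by field; rewrite gt_eqF.
have S : sin (2 * atan t) = b / r.
  rewrite mulrC mulr_natr sin_mulr2n sn mulrCA -expr2 c2 t1 invf_div /t -mulr_natr.
  by field; rewrite !gt_eqF.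
by rewrite C S; apply: complex_ext => /=; field; rewrite gt_eqF.
Qed.

Lemma cos_gt0_Im x : - pi < x < pi -> 0 < cos x -> `|x| < pi / 2.
Proof.
move=> xpi c0; rewrite ltNge; apply/negP => hx.
have : cos `|x| <= 0.
  rewrite -cos_pihalf leNgt ltr_cos ?in_itv /= -?leNgt //.
    by apply/andP; split => //; rewrite ler_norml; lra.
  by have := @pi_gt0 R; lra.
by rewrite cos_norm; lra.
Qed.

(** The arctangent formula alone gives |Im| < pi; the cosine has the sign of the real part of [u],
    which sharpens the bound to pi / 2. *)
Lemma Im_LogC u : 0 < complex.Re u -> `|complex.Im (LogC u)| < pi / 2.
Proof.
move=> Ru; apply: cos_gt0_Im.
  rewrite /=; set t := _ / _; have := atan_gtNpi2 t; have := atan_ltpi2 t; lra.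
have := congr1 (@complex.Re R) (expC_LogC Ru); rewrite expCE [LHS]/= => h.
by move: Ru; rewrite -h pmulr_rgt0 ?expR_gt0.
Qed.

Lemma expC_inj u v : expC u = expC v ->
  `|complex.Im u| + `|complex.Im v| < 2 * pi -> u = v.
Proof.
move=> uv h; apply/eqP; rewrite -subr_eq0; apply/eqP/expC_eq1.
  by rewrite expCB uv divff // expC_neq0.
by rewrite ImB; apply: le_lt_trans (ler_normB _ _) h.
Qed.

Lemma Re_expC_gt0 u : `|complex.Im u| < pi / 2 -> 0 < complex.Re (expC u).
Proof.
rewrite ltr_norml expCE /= => h; rewrite pmulr_rgt0 ?expR_gt0 //.
exact: cos_gt0_pihalf.
Qed.

Lemma LogC_expC u : `|complex.Im u| < pi / 2 -> LogC (expC u) = u.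
Proof.
move=> hu; have h := Re_expC_gt0 hu; apply: expC_inj; first exact: expC_LogC.
by have := Im_LogC h; have := @pi_gt0 R; lra.
Qed.

Lemma LogC1 : LogC 1 = 0 :> R[i].
Proof. by rewrite -realc1 LogC_real // ln1. Qed.

Lemma Re_1sub (x : R[i]) : modc x < 1 -> 0 < complex.Re (1 - x).
Proof. by rewrite ReB /= => h; have := le_trans (ler_norm _) (modc_Re x); lra. Qed.

End Logarithm.

(** * Power series, their derivatives and their exponentials *)

Section PowerSeries.
Variable R : realType.
Implicit Types (a b : nat -> R[i]) (z h d : R[i]) (x y t rho M : R).

(* [q] and [q'] are the values at a point and at a displaced point, [dq] is the
   differential; the conjunction, unlike its last member alone, is stable under
   multiplication by a coordinate. *)
Definition taylor_bound M t (q q' dq : R[i]) :=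
  [/\ modc q' <= M, modc (q' - q) <= t * M & modc (q' - q - dq) <= t ^+ 2 * M].

Lemma taylor_bound_mul M t x rho (c k q q' dq : R[i]) :
  0 <= t <= 1 -> 0 <= rho -> modc c <= x -> modc k <= t * rho ->
  taylor_bound M t q q' dq ->
  taylor_bound ((x + rho) * M) t (c * q) ((c + k) * q') (c * dq + k * q).
Proof.
case/andP => t0 t1 rho0 cx kt [h1 h2 h3].
have x0 : 0 <= x by apply: le_trans cx.
have M0 : 0 <= M by apply: le_trans h1.
split.
- rewrite modcM; apply: ler_pM => //; apply: (le_trans (modcD _ _)).
  by apply: lerD => //; apply: (le_trans kt); nra.
- have -> : (c + k) * q' - c * q = c * (q' - q) + k * q' by ring.
  apply: (le_trans (modcD _ _)); rewrite !modcM.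
  have -> : t * ((x + rho) * M) = x * (t * M) + t * rho * M by ring.
  by apply: lerD; apply: ler_pM.
- have -> : (c + k) * q' - c * q - (c * dq + k * q) =
    c * (q' - q - dq) + k * (q' - q) by ring.
  apply: (le_trans (modcD _ _)); rewrite !modcM.
  have -> : t ^+ 2 * ((x + rho) * M) = x * (t ^+ 2 * M) + t * rho * (t * M) by ring.
  by apply: lerD; apply: ler_pM.
Qed.

Lemma taylor_bound1 t : 0 <= t -> taylor_bound 1 t 1 1 0.
Proof.
by move=> t0; split; rewrite ?modc1 // ?subr0 subrr modc0 mulr1 ?exprn_ge0.
Qed.

Lemma taylor_bound_X n z h x rho t : 0 <= t <= 1 -> 0 <= rho ->
  modc z <= x -> modc h <= t * rho ->
  taylor_bound ((x + rho) ^+ n) t (z ^+ n) ((z + h) ^+ n) (n%:R * z ^+ n.-1 * h).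
Proof.
move=> t01 rho0 zx ht; elim: n => [|n IH].
  by rewrite !mul0r !expr0; apply: taylor_bound1; case/andP: t01.
have := taylor_bound_mul t01 rho0 zx ht IH; rewrite -!exprS.
suff -> : z * (n%:R * z ^+ n.-1 * h) + h * z ^+ n = n.+1%:R * z ^+ n.+1.-1 * h by [].
case: n {IH} => [|n]; first by rewrite !mul0r mulr0 add0r /=; ring.
by rewrite /= exprS -[n.+2%:R]natr1; ring.
Qed.

(** At [t = 1] this plays the part of Cauchy's estimate for derivatives. *)
Lemma taylor_bound_diff M t (q q' dq : R[i]) : 0 <= t <= 1 ->
  taylor_bound M t q q' dq -> modc dq <= 2 * t * M.
Proof.
move=> /andP[t0 t1] [h1 h2 h3]; have M0 : 0 <= M by apply: le_trans h1.
have -> : dq = (q' - q) - (q' - q - dq) by ring.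
have h4 : t ^+ 2 * M <= t * M by apply: ler_wpM2r => //; rewrite expr2; nra.
by apply: (le_trans (modcB _ _)); lra.
Qed.

Lemma pseries_derivative a z (x rho B : R) : 0 < rho -> modc z <= x ->
  (forall n, \sum_(k < n) modc (a k) * (x + rho) ^+ k <= B) ->
  exists d, sums (fun k => a k * (k%:R * z ^+ k.-1)) d.
Proof.
move=> rho0 zx hB.
have [| |d hd _] := @abs_sums R (fun k => a k * (k%:R * z ^+ k.-1))
  (fun k => 2 / rho * (modc (a k) * (x + rho) ^+ k)) (2 / rho * B).
- move=> k; have t11 : 0 <= (1 : R) <= 1 by rewrite ler01 lexx.
  have hr : modc rho%:C <= 1 * rho by rewrite modcR mul1r ger0_norm // ltW.
  have := taylor_bound_diff t11 (taylor_bound_X k t11 (ltW rho0) zx hr).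
  rewrite modcM mulr1 modcR (ger0_norm (ltW rho0)) => H; rewrite modcM mulrCA.
  apply: ler_wpM2l => //; rewrite -(ler_pM2r rho0); apply: (le_trans H).
  by rewrite mulrAC divfK // gt_eqF.
- by move=> n; rewrite -mulr_sumr ler_wpM2l // divr_ge0 // ltW.
by exists d.
Qed.

Lemma cderiv_pseries a (f : R[i] -> R[i]) z d (x rho B : R) : 0 < rho -> modc z <= x ->
  (forall n, \sum_(k < n) modc (a k) * (x + rho) ^+ k <= B) ->
  (forall w, modc w <= x + rho -> sums (fun k => a k * w ^+ k) (f w)) ->
  sums (fun k => a k * (k%:R * z ^+ k.-1)) d ->
  cderiv f z d.
Proof.
move=> rho0 zx hB hf hd; have B0 : 0 <= B by have := hB 0%N; rewrite big_ord0.
apply: (@cderivP _ _ _ _ (B / rho ^+ 2)) => e e0.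
exists (Num.min rho e); first by rewrite lt_min rho0.
move=> h; rewrite le_min => /andP[h1 h2]; have h0 := modc_ge0 h.
(* The increment is measured in units of [rho], so the remainder t^2 B is B / rho^2 times |h|^2. *)
pose t := modc h / rho.
have t01 : 0 <= t <= 1.
  by rewrite divr_ge0 ?(ltW rho0) //= ler_pdivrMr // mul1r.
have ht : modc h <= t * rho by rewrite divfK // gt_eqF.
have s1 : sums (fun k => a k * (z + h) ^+ k) (f (z + h)).
  by apply: hf; apply: (le_trans (modcD _ _)); rewrite lerD.
have s2 : sums (fun k => a k * z ^+ k) (f z).
  by apply: hf; rewrite (le_trans zx) // lerDl ltW.
have := sumsB (sumsB s1 s2) (sumsZ h hd); rewrite [h * d]mulrC => S.
have : modc (f (z + h) - f z - d * h) <= t ^+ 2 * B.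
  apply: (sums_modc_le (x := fun k => t ^+ 2 * (modc (a k) * (x + rho) ^+ k)) S).
    move=> k; have [_ _] := taylor_bound_X k t01 (ltW rho0) zx ht.
    move=> H; have -> : a k * (z + h) ^+ k - a k * z ^+ k - h * (a k * (k%:R * z ^+ k.-1)) =
      a k * ((z + h) ^+ k - z ^+ k - k%:R * z ^+ k.-1 * h) by ring.
    by rewrite modcM mulrCA; apply: ler_wpM2l.
  by move=> n; rewrite -mulr_sumr ler_wpM2l // exprn_ge0 //; case/andP: t01.
move/le_trans; apply.
have -> : t ^+ 2 * B = B / rho ^+ 2 * modc h * modc h.
  by rewrite /t; field; rewrite gt_eqF.
by apply: ler_wpM2r => //; apply: ler_wpM2l => //; rewrite divr_ge0 // exprn_ge0 // ltW.
Qed.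

Definition sumC a : R[i] := xget 0 [set l | sums a l].

Lemma sumCP a l : sums a l -> sums a (sumC a).
Proof. by move=> h; rewrite /sumC; apply: (@xgetPex _ _ [set l | sums a l]); exists l. Qed.

Lemma sumCE a l : sums a l -> sumC a = l.
Proof. by move=> h; apply: sums_uniq (sumCP h) h. Qed.

Lemma ratio_bounded (c : nat -> R) (q : R) N : (forall n, 0 <= c n) ->
  0 <= q < 1 -> (forall n, (N <= n)%N -> c n.+1 <= q * c n) ->
  exists B : R, forall n, \sum_(k < n) c k <= B.
Proof.
move=> c0 /andP[q0 q1] hc.
have q1' : 0 < 1 - q by lra.
exists (\sum_(k < N) c k + c N / (1 - q)) => n.
have key k : \sum_(N <= j < N + k) c j + c (N + k)%N / (1 - q) <= c N / (1 - q).
  elim: k => [|k IH]; first by rewrite addn0 big_geq // add0r.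
  rewrite addnS big_nat_recr ?leq_addr //=; apply: le_trans IH.
  rewrite -addrA lerD2l -(ler_pM2r q1') mulrDl !divfK ?gt_eqF //.
  by have := hc (N + k)%N (leq_addr _ _); lra.
have [nN|Nn] := leqP n N.
  rewrite -!(big_mkord xpredT) [X in _ <= X + _](big_cat_nat (n := n)) //= -addrA lerDl.
  by rewrite addr_ge0 ?sumr_ge0 // divr_ge0 // ltW.
rewrite -!(big_mkord xpredT) (big_cat_nat (n := N)) ?(ltnW Nn) //= lerD2l.
have := key (n - N)%N; rewrite subnKC ?(ltnW Nn) //.
by apply: le_trans; rewrite lerDl divr_ge0 // ltW.
Qed.

(** The coefficients of (1 - rho x)^(-kappa), the exponential of the sum over k >= 1 of kappa rho^k
    x^k / k. [risingS] is the recursion E' = L E for it; this makes it the universal majorant in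
    [graded_exp]. *)
Fixpoint rising (kappa rho : R) n : R :=
  if n is m.+1 then rho * (kappa + m%:R) / m.+1%:R * rising kappa rho m else 1.

Lemma rising_ge0 kappa rho n : 0 <= kappa -> 0 <= rho -> 0 <= rising kappa rho n.
Proof.
move=> k0 r0; elim: n => //= n IH.
by rewrite mulr_ge0 // divr_ge0 // mulr_ge0 // addr_ge0.
Qed.

Lemma risingS kappa rho n : n.+1%:R * rising kappa rho n.+1 =
  \sum_(k < n.+1) kappa * rho ^+ k.+1 * rising kappa rho (n - k)%N.
Proof.
have eqS m : m.+1%:R * rising kappa rho m.+1 = rho * (kappa + m%:R) * rising kappa rho m.
  by rewrite /= mulrA mulrCA divff ?mulr1 // pnatr_eq0.
elim: n => [|n IH]; first by rewrite big_ord1 eqS expr1 /=; ring.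
rewrite eqS big_ord_recl subn0 expr1.
under eq_bigr => k _ do rewrite lift0 subSS exprS [kappa * _]mulrCA -[rho * _ * _]mulrA.
rewrite -mulr_sumr -IH; move: (rising _ _ n.+1) => r; ring.
Qed.

Lemma rising_bounded (kappa rho y : R) : 0 <= kappa -> 0 <= rho -> 0 <= y -> rho * y < 1 ->
  exists B : R, forall n, \sum_(k < n) rising kappa rho k * y ^+ k <= B.
Proof.
move=> k0 r0 y0 ry.
pose q := (1 + rho * y) / 2.
have ry0 : 0 <= rho * y by rewrite mulr_ge0.
(* From [N] on, the ratio rho y (kappa + n) / (n + 1) of consecutive terms is at most [q], the
   midpoint of rho y and 1. *)
pose N := Num.bound (rho * y * kappa / (q - rho * y)).
have qp : 0 < q - rho * y by rewrite /q; lra.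
apply: (@ratio_bounded (fun k => rising kappa rho k * y ^+ k) q N); first by move=> n; rewrite mulr_ge0 ?rising_ge0 ?exprn_ge0.
  by rewrite /q; lra.
move=> n Nn; rewrite /= exprS.
have -> : rho * (kappa + n%:R) / n.+1%:R * rising kappa rho n * (y * y ^+ n) =
  rho * y * (kappa + n%:R) / n.+1%:R * (rising kappa rho n * y ^+ n).
  by ring.
apply: ler_wpM2r; first by rewrite mulr_ge0 ?rising_ge0 ?exprn_ge0.
rewrite ler_pdivrMr ?ltr0n // -natr1.
have : rho * y * kappa / (q - rho * y) <= n%:R.
  apply: ltW; apply: lt_le_trans (archi_boundP _) _; first by rewrite divr_ge0 ?mulr_ge0 // ltW.
  by rewrite ler_nat.
rewrite ler_pdivrMr // /q => h; lra.
Qed.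

(* [E] is the coefficient sequence of the exponential of the power series with
   derivative [L]; its sum is found by solving E' = L E along the unit interval. *)
Lemma graded_exp (L E : nat -> R[i]) kappa rho : 0 <= kappa -> 0 <= rho < 1 ->
  (forall k, modc (L k) <= kappa * rho ^+ k.+1) ->
  E 0%N = 1 -> (forall n, n.+1%:R * E n.+1 = \sum_(k < n.+1) L k * E (n - k)%N) ->
  exists2 l, sums (fun k => L k / k.+1%:R) l & sums E (expC l).
Proof.
move=> k0 /andP[r0 r1] hL E0 hE.
have bE n : modc (E n) <= rising kappa rho n.
  elim/ltn_ind: n => -[|n] IH; first by rewrite E0 modc1.
  rewrite -(ler_pM2l (x := n.+1%:R)) ?ltr0n // -{1}(modc_nat R n.+1) -modcM hE risingS.
  apply: (le_trans (modc_sum _ _ _)); apply: ler_sum => k _; rewrite modcM.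
  by apply: ler_pM => //; apply: IH; rewrite ltnS leq_subr.
(* Chosen so that [1 < y] while [rho * y < 1]: both series converge on a disc with [0, 1] in its
   interior. *)
pose y : R := 2 / (1 + rho).
have rho1 : 0 < 1 + rho by lra.
have y1 : 1 < y by rewrite /y ltr_pdivlMr // mul1r; lra.
have ry : rho * y < 1 by rewrite /y mulrA ltr_pdivrMr // mul1r; lra.
have y0 : 0 < y by lra.
have [B hB] := rising_bounded k0 r0 (ltW y0) ry.
have geoB : exists B' : R, forall n, \sum_(k < n) kappa * rho ^+ k.+1 * y ^+ k.+1 <= B'.
  apply: (@ratio_bounded (fun k => kappa * rho ^+ k.+1 * y ^+ k.+1) (rho * y) 0).
  - by move=> n; rewrite !mulr_ge0 ?exprn_ge0 // ltW.
  - by rewrite ry mulr_ge0 // ltW.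
  - move=> n _; rewrite le_eqVlt; apply/orP; left; apply/eqP.
    by rewrite !exprS; ring.
have [B' hB'] := geoB.
pose Ef w := sumC (fun k => E k * w ^+ k).
pose a k := if k is m.+1 then L m / m.+1%:R else 0.
pose Lf w := sumC (fun k => a k * w ^+ k).
have aB n : \sum_(k < n) modc (a k) * y ^+ k <= B'.
  case: n => [|n].
    by rewrite big_ord0; have := hB' 0%N; rewrite big_ord0.
  rewrite big_ord_recl /= modc0 mul0r add0r; apply: le_trans (hB' n).
  apply: ler_sum => k _; rewrite /bump /= add1n modcM modcV modc_nat.
  apply: ler_wpM2r; first by rewrite exprn_ge0 // ltW.
  apply: le_trans (hL k); rewrite ler_pdivrMr ?ltr0n // -[leLHS]mulr1.
  by apply: ler_wpM2l => //; rewrite ler1n.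
have EB n : \sum_(k < n) modc (E k) * y ^+ k <= B.
  apply: le_trans (hB n); apply: ler_sum => k _.
  by apply: ler_wpM2r => //; rewrite exprn_ge0 // ltW.
have conv (c : nat -> R[i]) (C : R) : (forall n, \sum_(k < n) modc (c k) * y ^+ k <= C) ->
    forall w, modc w <= y -> sums (fun k => c k * w ^+ k) (sumC (fun k => c k * w ^+ k)).
  move=> hc w hw; have [|l hl _] := @abs_sums R (fun k => c k * w ^+ k)
    (fun k => modc (c k) * y ^+ k) C _ hc; last exact: sumCP hl.
  by move=> k; rewrite modcM modcX ler_wpM2l // lerXn2r // nnegrE // ltW.
have cE := conv _ _ EB; have cL := conv _ _ aB.
have y1' : 0 < y - 1 by lra.
have yy : 1 + (y - 1) = y by lra.
(* E' = L E, read off from the Cauchy product of the two series, says that E exp(-Lf) has derivative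
   zero, where [Lf] is the primitive of L vanishing at 0. *)
have derF (s : R) : 0 <= s <= 1 -> cderiv (fun w => Ef w * expC (- Lf w)) (s%:C * 1) 0.
  move=> s01; rewrite mulr1; set w := s%:C.
  have hw : modc w <= 1 by rewrite modcR ger0_norm; case/andP: s01.
  have EB1 : forall n, \sum_(k < n) modc (E k) * (1 + (y - 1)) ^+ k <= B by rewrite yy.
  have aB1 : forall n, \sum_(k < n) modc (a k) * (1 + (y - 1)) ^+ k <= B' by rewrite yy.
  have [dE hdE] := pseries_derivative y1' hw EB1.
  have [dL hdL] := pseries_derivative y1' hw aB1.
  have cE1 : forall v, modc v <= 1 + (y - 1) -> sums (fun k => E k * v ^+ k) (Ef v).
    by rewrite yy.
  have cL1 : forall v, modc v <= 1 + (y - 1) -> sums (fun k => a k * v ^+ k) (Lf v).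
    by rewrite yy.
  have DE := cderiv_pseries y1' hw EB1 cE1 hdE.
  have DL := cderiv_pseries y1' hw aB1 cL1 hdL.
  have hw' : modc w <= y by lra.
  have sL : sums (fun k => L k * w ^+ k) dL.
    have := cvs_sub (p := S) (fun n => leqnSn n) hdL; apply: cvs_ext => n.
    rewrite big_ord_recl /= mul0r add0r; apply: eq_bigr => k _.
    by rewrite /bump /= add1n mulrA divfK // pnatr_eq0.
  have prod : sums (fun n => \sum_(k < n.+1) (L k * w ^+ k) * (E (n - k)%N * w ^+ (n - k)))
      (dL * Ef w).
    apply: (sums_cauchy_product (x := fun k => kappa * rho ^+ k.+1 * y ^+ k.+1)
      (y := fun k => modc (E k) * y ^+ k) _ hB' _ EB sL (cE _ hw')).
    - move=> k; rewrite modcM; apply: ler_pM => //.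
      rewrite modcX; apply: (@le_trans _ _ 1); first exact: exprn_ile1.
      by apply: exprn_ege1; exact: ltW.
    - by move=> k; rewrite modcM modcX ler_wpM2l // lerXn2r // nnegrE // ltW.
  have dEE : dE = dL * Ef w.
    apply: (sums_uniq _ prod).
    have := cvs_sub (p := S) (fun n => leqnSn n) hdE; apply: cvs_ext => n.
    rewrite big_ord_recl /= mul0r mulr0 add0r; apply: eq_bigr => k _.
    rewrite /bump /= add1n mulrA [E k.+1 * _]mulrC hE mulr_suml.
    apply: eq_bigr => j _; rewrite mulrACA -exprD subnKC //.
    by rewrite -ltnS ltn_ord.
  have := cderivM DE (cderiv_comp (cderivN DL) (cderiv_expC _)).
  by rewrite dEE; congr cderiv; ring.
have := cderiv0_segment derF => F1.
have at1 : modc (1 : R[i]) <= y by rewrite modc1 ltW.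
have at0 : modc (0 : R[i]) <= y by rewrite modc0 ltW.
have zero (c : nat -> R[i]) : sumC (fun k => c k * 0 ^+ k) = c 0%N.
  apply: sumCE; rewrite -[c 0%N]mulr1 -[_ * 1]addr0 -[X in c 0%N * X](expr0 (0 : R[i])).
  apply: (sums_shift1 (u := fun k => c k * 0 ^+ k)).
  by apply: sums_ext (@sums0 R) => k; rewrite exprS mul0r mulr0.
exists (Lf 1).
  have := cvs_sub (p := S) (fun n => leqnSn n) (cL _ at1); apply: cvs_ext => n.
  rewrite big_ord_recl /= mul0r add0r; apply: eq_bigr => k _.
  by rewrite expr1n mulr1.
have <- : Ef 1 = expC (Lf 1).
  move: F1; rewrite /Ef /Lf !zero /= oppr0 expC0 mulr1 E0 => F1.
  by rewrite -[LHS]mulr1 -[X in _ * X](expC0 R) -(addNr (Lf 1)) expCD mulrA F1 mul1r.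
by apply: sums_ext (cE _ at1) => k; rewrite expr1n mulr1.
Qed.

End PowerSeries.

(** * The logarithmic and binomial series *)

Section LogarithmSeries.
Variable R : realType.
Implicit Types (x z w : R[i]) (y lam : R).

Lemma geometric_le y n : 0 <= y < 1 -> \sum_(k < n) y ^+ k <= (1 - y)^-1.
Proof.
move=> /andP[y0 y1]; have y1' : 0 < 1 - y by lra.
have : (1 - y) * \sum_(k < n) y ^+ k = 1 - y ^+ n by rewrite -opprB mulNr -subrX1 opprB.
move=> H; rewrite -(ler_pM2l y1') H divff ?gt_eqF //.
by rewrite gerBl exprn_ge0.
Qed.

Lemma geometric_sums x : modc x < 1 -> sums (fun k => x ^+ k) (1 - x)^-1.
Proof.
move=> x1; have m01 : 0 <= modc x < 1 by rewrite modc_ge0.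
have [||l hl _] := @abs_sums R (fun k => x ^+ k) (fun k => modc x ^+ k) (1 - modc x)^-1.
- by move=> k; rewrite modcX.
- by move=> n; exact: geometric_le.
have : sums (fun k => x ^+ k.+1) (x * l).
  by apply: sums_ext (sumsZ x hl) => k; rewrite exprS.
move=> /(sums_shift1 (u := fun k => x ^+ k)) h.
have E := sums_uniq hl h; have n0 : 1 - x != 0.
  by rewrite -modc_gt0; have := modc_subadd 1 x; rewrite modc1; lra.
suff <- : l = (1 - x)^-1 by [].
apply: (mulfI n0); rewrite divff // mulrBl mul1r {1}E expr0; ring.
Qed.

(** [graded_exp] shows that the sum l satisfies exp l(w) = (1 - w)^-1; it remains to see that l is
    the principal branch. On the segment from 0 to x the real part of 1 - w is positive, so cos (Im
    l) is positive, and Im l, continuous and 0 at 0, cannot cross pi / 2 or - pi / 2. *)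
Lemma log_series x : modc x < 1 ->
  sums (fun k => x ^+ k.+1 / k.+1%:R) (- LogC (1 - x)).
Proof.
have explog w : modc w < 1 ->
    exists2 l, sums (fun k => w ^+ k.+1 / k.+1%:R) l & expC l = (1 - w)^-1.
  move=> w1; have [|||||l hl he] := @graded_exp R (fun k => w ^+ k.+1) (fun k => w ^+ k) 1 (modc w).
  - exact: ler01.
  - by rewrite modc_ge0.
  - by move=> k; rewrite mul1r modcX.
  - by rewrite expr0.
  - move=> n; rewrite (eq_bigr (fun=> w ^+ n.+1)); last first.
      by move=> k _; rewrite -exprD addSn subnKC // -ltnS.
    by rewrite sumr_const card_ord mulr_natl.
  by exists l => //; apply: sums_uniq he (geometric_sums w1).
move=> x1; pose a k : R[i] := if k is m.+1 then m.+1%:R^-1 else 0.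
pose l w := sumC (fun k => a k * w ^+ k).
have lE w : modc w < 1 -> sums (fun k => w ^+ k.+1 / k.+1%:R) (l w) /\ expC (l w) = (1 - w)^-1.
  move=> /explog [m hm <-]; suff -> : l w = m by split.
  apply: sumCE; rewrite -[m]add0r -(mul0r (w ^+ 0)).
  apply: (sums_shift1 (u := fun k => a k * w ^+ k)).
  by apply: sums_ext hm => k; rewrite /= mulrC.
have lS w : modc w < 1 -> sums (fun k => a k * w ^+ k) (l w).
  move=> /explog [m hm _]; apply: (sumCP (l := 0 * w ^+ 0 + m)).
  apply: (sums_shift1 (u := fun k => a k * w ^+ k)).
  by apply: sums_ext hm => k; rewrite /= mulrC.
have posc w : modc w < 1 -> 0 < cos (complex.Im (l w)).
  move=> w1; have [_ e] := lE _ w1; have := Re_1sub w1.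
  rewrite -[1 - w]invrK -e -expCN expCE /= ImN cosN ReN.
  by rewrite pmulr_rgt0 // expR_gt0.
(* Two values within half the gap between [p3] and [P] lie on the same side of [P] as [p3]. *)
have same_side (p1 p2 p3 P : R) : p1 < P -> `|p1 - p3| <= `|p3 - P| / 2 ->
    `|p2 - p3| <= `|p3 - P| / 2 -> 0 < `|p3 - P| / 2 -> p2 < P.
  rewrite !ler_norml; have [h|h] := leP P p3.
    by rewrite ger0_norm ?subr_ge0 // => h1 /andP[h2 h3] /andP[h4 h5] h6; lra.
  by rewrite ltr0_norm ?subr_lt0 // => h1 /andP[h2 h3] /andP[h4 h5] h6; lra.
have Imx : `|complex.Im (l x)| < pi / 2.
  (* The bisected property is an implication from the left endpoint to the right one, hence it
     composes across the two halves. *)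
  have := @dyadic_cousin1 R (fun s n => `|complex.Im (l (s%:C * x))| < pi / 2 ->
    `|complex.Im (l ((s + dy R n)%:C * x))| < pi / 2).
  have dy0 : dy R 0 = 1 by rewrite /dy expr0.
  rewrite add0r dy0 mul1r mul0r; apply.
  - by move=> s n h1 h2 hs; rewrite (dyS R n) addrA; exact: h2 (h1 hs).
  - move=> s s01; set w := s%:C * x.
    have hw : modc w <= modc x.
      rewrite modcM modcR ger0_norm; last by case/andP: s01.
      by rewrite -[leRHS]mul1r ler_wpM2r //; case/andP: s01.
    pose rho := (1 - modc x) / 2.
    have rho0 : 0 < rho by rewrite divr_gt0 // subr_gt0.
    have xr1 : modc x + rho < 1 by rewrite /rho; lra.
    have xr0 : 0 <= modc x + rho by rewrite addr_ge0 // ltW.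
    have hB n : \sum_(k < n) modc (a k) * (modc x + rho) ^+ k <= (1 - (modc x + rho))^-1.
      apply: le_trans (geometric_le n _); last by rewrite xr0.
      apply: ler_sum => k _; rewrite -[leRHS]mul1r; apply: ler_wpM2r; first exact: exprn_ge0.
      case: (k : nat) => [|m]; first by rewrite modc0.
      by rewrite /= modcV modc_nat invf_le1 ?ltr0n // ler1n.
    have [d hd] := pseries_derivative rho0 hw hB.
    have hf v : modc v <= modc x + rho -> sums (fun k => a k * v ^+ k) (l v).
      by move=> hv; apply: lS; apply: le_lt_trans hv xr1.
    have D := cderiv_pseries rho0 hw hB hf hd.
    have w1 : modc w < 1 by apply: le_lt_trans hw x1.
    have ne : `|complex.Im (l w)| != pi / 2.
      apply/eqP => e; have := posc _ w1; rewrite -cos_norm e cos_pihalf; lra.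
    pose del := `| `|complex.Im (l w)| - pi / 2| / 2.
    have del0 : 0 < del by rewrite divr_gt0 // normr_gt0 subr_eq0.
    have [r r0 hr] := cderiv_cont D del0.
    have [N hN] := dy_small (R := R) r0.
    exists N => n Nn s' _ _ /andP[hs1 hs2] H.
    have near c : `|c - s| <= dy R n ->
        `|complex.Im (l (c%:C * x)) - complex.Im (l w)| <= del.
      move=> hc; rewrite -ImB; apply: (le_trans (modc_Im _)).
      have := hr ((c - s)%:C * x).
      have -> : w + (c - s)%:C * x = c%:C * x by rewrite realcB /w; ring.
      apply; rewrite modcM modcR -[leRHS]mulr1; apply: ler_pM => //.
        exact: le_trans hc (hN _ Nn).
      exact: ltW.
    have d0 := dy_ge0 R n.
    have [n1 n2] := ler_dist_both hs1 hs2.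
    have {}n1 := near _ n1; have {}n2 := near _ n2.
    have t1 := ler_dist_dist (complex.Im (l (s'%:C * x))) (complex.Im (l w)).
    have t2 := ler_dist_dist (complex.Im (l ((s' + dy R n)%:C * x))) (complex.Im (l w)).
    exact: same_side H (le_trans t1 n1) (le_trans t2 n2) del0.
  - have -> : l 0 = 0.
      apply: sumCE; apply: sums_ext (@sums0 R) => -[|k]; first by rewrite mul0r.
      by rewrite exprS mul0r mulr0.
    by rewrite /= normr0 divr_gt0 // pi_gt0.
have [hl he] := lE _ x1.
suff -> : - LogC (1 - x) = l x by [].
have -> : 1 - x = expC (- l x) by rewrite expCN he invrK.
by rewrite LogC_expC ?opprK // ImN normrN.
Qed.

Lemma cderiv_log1B x : modc x < 1 ->
  cderiv (fun w => LogC (1 - w)) x (- (1 - x)^-1).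
Proof.
move=> x1; pose a k : R[i] := if k is m.+1 then m.+1%:R^-1 else 0.
pose rho := (1 - modc x) / 2.
have rho0 : 0 < rho by rewrite divr_gt0 // subr_gt0.
have xr1 : modc x + rho < 1 by rewrite /rho; lra.
have xr0 : 0 <= modc x + rho by rewrite addr_ge0 // ltW.
have hB n : \sum_(k < n) modc (a k) * (modc x + rho) ^+ k <= (1 - (modc x + rho))^-1.
  apply: le_trans (geometric_le n _); last by rewrite xr0.
  apply: ler_sum => k _; rewrite -[leRHS]mul1r; apply: ler_wpM2r; first exact: exprn_ge0.
  case: (k : nat) => [|m]; first by rewrite modc0.
  by rewrite /= modcV modc_nat invf_le1 ?ltr0n // ler1n.
have hf v : modc v <= modc x + rho -> sums (fun k => a k * v ^+ k) (- LogC (1 - v)).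
  move=> hv; rewrite -[- _]add0r -(mul0r (v ^+ 0)).
  apply: (sums_shift1 (u := fun k => a k * v ^+ k)).
  apply: sums_ext (log_series (le_lt_trans hv xr1)) => k.
  by rewrite /= mulrC.
have hd : sums (fun k => a k * (k%:R * x ^+ k.-1)) (1 - x)^-1.
  rewrite -[_^-1]add0r -(mul0r (0%:R * x ^+ 0.-1)).
  apply: (sums_shift1 (u := fun k => a k * (k%:R * x ^+ k.-1))).
  apply: sums_ext (geometric_sums x1) => k.
  by rewrite /= mulKf // pnatr_eq0.
have := cderivN (cderiv_pseries rho0 (lexx _) hB hf hd).
by apply: cderiv_ext => w; rewrite opprK.
Qed.

Lemma binomial_series lam x : 0 <= lam -> modc x < 1 ->
  sums (fun k => (rising lam 1 k)%:C * x ^+ k) (powC (1 - x) (- lam)).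
Proof.
move=> l0 x1.
have [|||||l hl he] := @graded_exp R (fun k => lam%:C * x ^+ k.+1)
    (fun k => (rising lam 1 k)%:C * x ^+ k) lam (modc x) => //.
- by rewrite modc_ge0.
- by move=> k; rewrite modcM modcX modcR ger0_norm.
- by rewrite expr0 mulr1.
- move=> n; rewrite mulrA -realc_nat -realcM risingS realc_sum mulr_suml.
  apply: eq_bigr => k _; rewrite expr1n mulr1 realcM.
  have -> : x ^+ n.+1 = x ^+ k.+1 * x ^+ (n - k) by rewrite -exprD addSn subnKC // -ltnS.
  by ring.
have -> : powC (1 - x) (- lam) = expC l; last by [].
rewrite /powC; congr expC; rewrite realcN mulNr -mulrN.
by apply: (sums_uniq _ hl); apply: sums_ext (sumsZ lam%:C (log_series x1)) => k; rewrite mulrA.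
Qed.

End LogarithmSeries.

(** * A discrete Goursat theorem and the bound on the derivative at the centre *)

Section Goursat.
Variable R : realType.
Implicit Types (F G : R[i] -> R[i]) (a v p h k z : R[i]) (n : nat).

(* Trapezoid sums on a mesh of 2^n pieces, along a segment and around a
   parallelogram. Linear functions have zero sums around parallelograms, so that
   Goursat's argument needs no integral. *)
Fixpoint tseg F n a v : R[i] :=
  if n is m.+1 then tseg F m a (v / 2) + tseg F m (a + v / 2) (v / 2)
  else v * ((F a + F (a + v)) / 2).

Fixpoint tpar F n p h k : R[i] :=
  if n is m.+1 then
    tpar F m p (h / 2) (k / 2) + tpar F m (p + h / 2) (h / 2) (k / 2) +
    tpar F m (p + k / 2) (h / 2) (k / 2) + tpar F m (p + h / 2 + k / 2) (h / 2) (k / 2)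
  else tseg F 0 p h + tseg F 0 (p + h) k - tseg F 0 (p + k) h - tseg F 0 p k.

(** Edges shared by neighbouring quarters are run through in opposite directions and cancel. *)
Lemma tpar_boundary F n p h k :
  tpar F n p h k = tseg F n p h + tseg F n (p + h) k - tseg F n (p + k) h - tseg F n p k.
Proof.
elim: n p h k => [//|n IH] p h k.
rewrite [LHS]/= !IH.
have -> : p + h / 2 + h / 2 = p + h by field.
have -> : p + k / 2 + k / 2 = p + k by field.
have -> : p + h / 2 + k / 2 + h / 2 = p + h + k / 2 by field.
have -> : p + h / 2 + k / 2 + k / 2 = p + k + h / 2 by field.
have -> : p + k / 2 + h / 2 = p + h / 2 + k / 2 by ring.
by rewrite [RHS]/=; ring.
Qed.

Lemma tpar_affine A B c n p h k : tpar (fun z => A + B * (z - c)) n p h k = 0.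
Proof.
elim: n p h k => [|n IH] p h k /=; last by rewrite !IH !addr0.
by field.
Qed.

Lemma tparB F G n p h k :
  tpar (fun z => F z - G z) n p h k = tpar F n p h k - tpar G n p h k.
Proof.
elim: n p h k => [|n IH] p h k /=; last by rewrite !IH; ring.
by field.
Qed.

Lemma tseg_const c n a v : tseg (fun=> c) n a v = v * c.
Proof.
by elim: n a v => [|n IH] a v /=; [field | rewrite !IH; field].
Qed.

Lemma tsegB F G n a v : tseg (fun z => F z - G z) n a v = tseg F n a v - tseg G n a v.
Proof.
elim: n a v => [|n IH] a v /=; last by rewrite !IH; ring.
by field.
Qed.

Lemma tseg_le F n a v (M : R) :
  (forall s : R, 0 <= s <= 1 -> modc (F (a + s%:C * v)) <= M) ->
  modc (tseg F n a v) <= modc v * M.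
Proof.
elim: n a v => [|n IH] a v hM.
  rewrite /= modcM ler_wpM2l // modcM modcV modc_nat.
  have h0 := hM 0; have h1 := hM 1; rewrite mul0r addr0 mul1r in h0 h1.
  have := modcD (F a) (F (a + v)).
  have := h0 ltac:(lra); have := h1 ltac:(lra); lra.
rewrite /=; apply: (le_trans (modcD _ _)).
have v2 : modc v = modc (v / 2) + modc (v / 2).
  by rewrite modcM modcV modc_nat; field.
rewrite v2 mulrDl; apply: lerD; apply: IH => s s01.
  have := hM (s / 2); rewrite realcM realcV realc_nat.
  by rewrite -mulrA [2^-1 * v]mulrC; apply; lra.
have := hM (s / 2 + 2^-1); rewrite realcD realcM realcV realc_nat.
have -> : a + (s%:C / 2 + 2^-1) * v = a + v / 2 + s%:C * (v / 2) by ring.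
by apply; lra.
Qed.

Lemma tseg_eq F n a a' v : (forall z, F (z + (a' - a)) = F z) ->
  tseg F n a' v = tseg F n a v.
Proof.
elim: n a a' v => [|n IH] a a' v hF /=.
  have -> : F a' = F a by rewrite -[RHS]hF; congr F; ring.
  by have -> : F (a' + v) = F (a + v) by rewrite -[RHS]hF; congr F; ring.
by rewrite (IH a a') // (IH (a + v / 2) (a' + v / 2)) // => z;
   rewrite -(hF z); congr (F (_ + _)); ring.
Qed.

(** The bound [e] times the square of the scale adds up exactly over four quarters. On a small
    parallelogram G differs from its affine part, whose sum vanishes, by e' times the diameter, and
    the perimeter is of the order of the diameter too. *)
Lemma goursat_tpar G p h k :
  (forall s t : R, 0 <= s <= 1 -> 0 <= t <= 1 ->
     exists d, cderiv G (p + s%:C * h + t%:C * k) d) ->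
  forall e : R, 0 < e -> exists N, forall n, (N <= n)%N -> modc (tpar G n p h k) <= e.
Proof.
move=> hG e e0.
have := @dyadic_cousin R (fun (a b : R) (m : nat) => exists N, forall n, (N <= n)%N ->
  modc (tpar G n (p + a%:C * h + b%:C * k) ((dy R m)%:C * h) ((dy R m)%:C * k)) <=
  e * dy R m ^+ 2).
have dy0 : dy R 0 = 1 by rewrite /dy expr0.
rewrite !mul0r !addr0 dy0 !mul1r expr1n mulr1; apply.
  move=> a b m [N1 h1] [N2 h2] [N3 h3] [N4 h4].
  (* Mesh [n.+1] on the whole parallelogram is mesh [n] on each quarter, hence the successor. *)
  exists (maxn (maxn N1 N2) (maxn N3 N4)).+1 => -[//|n].
  rewrite ltnS !geq_max => /andP[/andP[/h1 {}h1 /h2 {}h2] /andP[/h3 {}h3 /h4 {}h4]].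
  have half : (dy R m)%:C / 2 = (dy R m.+1)%:C :> R[i].
    by rewrite (dyS R m) realcD; field.
  rewrite /= ![_ * h / 2]mulrAC ![_ * k / 2]mulrAC half.
  have e1 : p + a%:C * h + b%:C * k + (dy R m.+1)%:C * h =
    p + (a + dy R m.+1)%:C * h + b%:C * k by rewrite realcD; ring.
  have e2 : p + a%:C * h + b%:C * k + (dy R m.+1)%:C * k =
    p + a%:C * h + (b + dy R m.+1)%:C * k by rewrite realcD; ring.
  have e3 : p + (a + dy R m.+1)%:C * h + b%:C * k + (dy R m.+1)%:C * k =
    p + (a + dy R m.+1)%:C * h + (b + dy R m.+1)%:C * k.
    by rewrite [in RHS](realcD b); ring.
  rewrite e1 e2 e3.
  have -> : e * dy R m ^+ 2 = e * dy R m.+1 ^+ 2 + e * dy R m.+1 ^+ 2 +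
    e * dy R m.+1 ^+ 2 + e * dy R m.+1 ^+ 2 by rewrite (dyS R m); ring.
  apply: (le_trans (modcD _ _)); apply: lerD => //.
  apply: (le_trans (modcD _ _)); apply: lerD => //.
  by apply: (le_trans (modcD _ _)); apply: lerD.
move=> s t s01 t01; have [d hd] := hG s t s01 t01.
pose L := modc h + modc k; have L0 : 0 <= L by rewrite addr_ge0.
have L1 : 0 < 2 * L ^+ 2 + 1 by rewrite ltr_wpDl // mulr_ge0 // exprn_ge0.
(* The sides have total length 2 dy L and the deviation there is at most e' dy L, which gives 2 L^2
   e' dy^2; the added 1 keeps the denominator positive when L = 0. *)
have e'0 : 0 < e / (2 * L ^+ 2 + 1) by rewrite divr_gt0.
set e' := e / _ in e'0.
have [r r0 hr] := hd _ e'0.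
have r1 : 0 < r / (L + 1) by rewrite divr_gt0 // ltr_wpDl.
have [M hM] := dy_small r1.
exists M => m Mm a b _ _ _ _ /andP[as1 as2] /andP[bt1 bt2]; exists 0%N => n _.
set z0 := p + s%:C * h + t%:C * k in hd hr.
have d0 := dy_ge0 R m.
have dyL : dy R m * L <= r.
  have := hM _ Mm; rewrite ler_pdivlMr ?ltr_wpDl //; lra.
pose lin z := G z0 + d * (z - z0).
have near (x y : R) : `|x - s| <= dy R m -> `|y - t| <= dy R m ->
    modc (G (p + x%:C * h + y%:C * k) - lin (p + x%:C * h + y%:C * k)) <= e' * (dy R m * L).
  move=> hx hy; set w := p + _ + _.
  have wz : modc (w - z0) <= dy R m * L.
    have -> : w - z0 = (x - s)%:C * h + (y - t)%:C * k.
      by rewrite /w /z0 !realcB; ring.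
    apply: (le_trans (modcD _ _)); rewrite !modcM !modcR mulrDr.
    by apply: lerD; apply: ler_wpM2r.
  have := hr (w - z0) (le_trans wz dyL).
  have -> : z0 + (w - z0) = w by ring.
  have -> : G w - lin w = G w - G z0 - d * (w - z0) by rewrite /lin; ring.
  move=> /le_trans; apply.
  by apply: ler_wpM2l => //; exact: ltW.
set P := p + _ + _; set H := _ * h; set K := _ * k.
have -> : tpar G n P H K = tpar (fun z => G z - lin z) n P H K.
  by rewrite tparB tpar_affine subr0.
have bound := @tseg_le (fun z => G z - lin z) n _ _ (e' * (dy R m * L)).
have bH (a' : R) : 0 <= a' <= 1 -> forall y : R, `|y - t| <= dy R m ->
    modc (G (p + (a + a' * dy R m)%:C * h + y%:C * k) - lin (p + (a + a' * dy R m)%:C * h + y%:C * k)) <= e' * (dy R m * L).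
  move=> a01 y hy; apply: near => //; rewrite ler_norml; apply/andP; split; nra.
have bK (b' : R) : 0 <= b' <= 1 -> forall x : R, `|x - s| <= dy R m ->
    modc (G (p + x%:C * h + (b + b' * dy R m)%:C * k) - lin (p + x%:C * h + (b + b' * dy R m)%:C * k)) <= e' * (dy R m * L).
  move=> b01 x hx; apply: near => //; rewrite ler_norml; apply/andP; split; nra.
have [a1 a2] := ler_dist_both as1 as2; have [b1 b2] := ler_dist_both bt1 bt2.
have q1 : modc (tseg (fun z => G z - lin z) n P H) <= modc H * (e' * (dy R m * L)).
  apply: bound => x x01; have := bH x x01 b b1.
  suff -> : P + x%:C * H = p + (a + x * dy R m)%:C * h + b%:C * k by [].
  by rewrite /P /H realcD realcM; ring.
have q2 : modc (tseg (fun z => G z - lin z) n (P + K) H) <= modc H * (e' * (dy R m * L)).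
  apply: bound => x x01; have := bH x x01 _ b2.
  suff -> : P + K + x%:C * H = p + (a + x * dy R m)%:C * h + (b + dy R m)%:C * k by [].
  by rewrite /P /H /K [in RHS]realcD realcM (realcD b); ring.
have q3 : modc (tseg (fun z => G z - lin z) n P K) <= modc K * (e' * (dy R m * L)).
  apply: bound => x x01; have := bK x x01 a a1.
  suff -> : P + x%:C * K = p + a%:C * h + (b + x * dy R m)%:C * k by [].
  by rewrite /P /K realcD realcM; ring.
have q4 : modc (tseg (fun z => G z - lin z) n (P + H) K) <= modc K * (e' * (dy R m * L)).
  apply: bound => x x01; have := bK x x01 _ a2.
  suff -> : P + H + x%:C * K = p + (a + dy R m)%:C * h + (b + x * dy R m)%:C * k by [].
  by rewrite /P /H /K [in RHS]realcD (realcD b) realcM; ring.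
rewrite tpar_boundary.
have tri (x y z w : R[i]) : modc (x + y - z - w) <= modc x + modc y + modc z + modc w.
  apply: (le_trans (modcB _ _)); rewrite lerD2r; apply: (le_trans (modcB _ _)).
  by rewrite lerD2r modcD.
apply: (le_trans (tri _ _ _ _)); apply: (le_trans (lerD (lerD (lerD q1 q4) q2) q3)).
have -> : modc H = dy R m * modc h by rewrite modcM modcR ger0_norm.
have -> : modc K = dy R m * modc k by rewrite modcM modcR ger0_norm.
have -> : dy R m * modc h * (e' * (dy R m * L)) + dy R m * modc k * (e' * (dy R m * L)) +
  dy R m * modc h * (e' * (dy R m * L)) + dy R m * modc k * (e' * (dy R m * L)) =
  e' * (2 * L ^+ 2) * dy R m ^+ 2 by rewrite /L; ring.
apply: ler_wpM2r; first exact: exprn_ge0.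
by rewrite /e' mulrAC ler_pdivrMr //; nra.
Qed.

Lemma expC_2pi z : expC (z + 0 +i* (pi *+ 2)) = expC z.
Proof.
rewrite expCD -[RHS]mulr1; congr (_ * _).
by rewrite expCE /= cos2pi sin2pi expR0 mulr0 mulr1.
Qed.

(* The function G(s) = f(e^s) e^-s has period 2 pi i and tends to f'(0) as
   Re s tends to -oo; by Goursat its mean over a period does not depend on Re s. *)
Lemma disc_derivative_le1 F d : (forall z, modc z < 1 -> exists d', cderiv F z d') ->
  (forall z, modc z < 1 -> modc (F z) < 1) -> F 0 = 0 -> cderiv F 0 d -> modc d <= 1.
Proof.
move=> hF F1 F0 hd; rewrite leNgt; apply/negP => d1.
(* 1 / r = (1 + |d|) / 2 is halfway between 1 and |d|; the two errors [e] sum to (|d| - 1) / 4 and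
   so do not fill the remaining gap. *)
pose r := 2 / (1 + modc d).
have dp : 0 < 1 + modc d by lra.
have r0 : 0 < r by rewrite divr_gt0.
have r1 : r < 1 by rewrite /r ltr_pdivrMr // mul1r; lra.
pose e := (modc d - 1) / 8; have e0 : 0 < e by rewrite divr_gt0 // subr_gt0.
have [r' r'0 hr'] := hd _ e0.
pose r2 := Num.min r r'; have r20 : 0 < r2 by rewrite lt_min r0.
pose G z := F (expC z) * expC (- z).
pose T : R[i] := 0 +i* (pi *+ 2).
pose p := (ln r2)%:C : R[i]; pose h := (ln r - ln r2)%:C : R[i].
have lnr2 : ln r2 <= ln r by rewrite ler_ln ?posrE // ge_min lexx.
have ReT x : complex.Re (p + x%:C * T) = ln r2 by rewrite ReD ReZ /= mulr0 addr0.
have mT : modc T = 2 * pi.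
  apply/eqP; rewrite -(@eqrXn2 _ 2) // ?mulr_ge0 ?pi_ge0 //.
  by rewrite sqr_modc /= -mulr_natl; apply/eqP; ring.
have GT z : G (z + T) = G z.
  by rewrite /G !expCN /T !expC_2pi.
have [| |N hN] := @goursat_tpar G p h T _ (e * (2 * pi)).
- move=> s t s01 t01; set z := _ + _ + _.
  have z1 : modc (expC z) < 1.
    rewrite modc_expC expR_lt1 /z !ReD !ReZ /= mulr0 addr0.
    have : ln r < 0 by rewrite ln_lt0 // r0.
    by case/andP: s01 => s0 s1; nra.
  have [d' hd'] := hF _ z1.
  exists (d' * expC z * expC (- z) + F (expC z) * (expC (- z) * - 1)).
  apply: cderivM; first exact: cderiv_comp (cderiv_expC z) hd'.
  exact: cderiv_comp (cderivN (cderiv_id z)) (cderiv_expC _).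
- by rewrite mulr_gt0 // mulr_gt0 // pi_gt0.
have := hN N (leqnn _); rewrite tpar_boundary.
(* Periodicity makes the two sides parallel to the real axis equal, so they cancel. *)
rewrite (@tseg_eq G N p (p + T) h); last first.
  by move=> z; rewrite -[RHS]GT; congr G; ring.
have -> : p + h = (ln r)%:C by rewrite /p /h realcB; ring.
set A := tseg G N p h; set B := tseg G N _ T; set C := tseg G N p T.
have -> : A + B - A - C = B - C by ring.
move=> BC.
have hB : modc B <= 2 * pi * r^-1.
  rewrite -mT; apply: tseg_le => s s01.
  have m : modc (expC ((ln r)%:C + s%:C * T)) = r.
    by rewrite modc_expC ReD ReZ /= mulr0 addr0 lnK.
  rewrite /G modcM expCN modcV m -[leRHS]mul1r; apply: ler_wpM2r.
    by rewrite invr_ge0 ltW.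
  by apply: ltW; apply: F1; rewrite m.
have hC : modc (C - T * d) <= 2 * pi * e.
  rewrite -mT /C -(tseg_const d N p T) -tsegB; apply: tseg_le => s s01.
  set z := p + _; have m : modc (expC z) = r2 by rewrite modc_expC ReT lnK.
  have := hr' (expC z); rewrite add0r F0 subr0 m ge_min lexx orbT => /(_ isT) H.
  have -> : G z - d = (F (expC z) - d * expC z) * expC (- z).
    by rewrite /G mulrBl -mulrA -expCD subrr expC0 mulr1.
  rewrite modcM expCN modcV m -(ler_pM2r r20) divfK //.
  by rewrite gt_eqF.
have : 2 * pi * modc d <= 2 * pi * (r^-1 + e + e).
  rewrite -mT -modcM.
  have -> : T * d = B - (B - C) - (C - T * d) by ring.
  have -> : modc T * (r^-1 + e + e) = 2 * pi * r^-1 + e * (2 * pi) + 2 * pi * e.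
    by rewrite mT; ring.
  apply: (le_trans (modcB _ _)); apply: lerD; last exact: hC.
  by apply: (le_trans (modcB _ _)); apply: lerD.
rewrite ler_pM2l ?mulr_gt0 ?pi_gt0 // /r invf_div /e; lra.
Qed.

End Goursat.

(** * Schwarz-Pick inequalities and the automorphisms of the disc *)

Section DiscAutomorphisms.
Variable R : realType.
Implicit Types (F G : R[i] -> R[i]) (a b c z w x y : R[i]).

Definition blaschke a z : R[i] := (z - a) / (1 - Num.conj a * z).

Lemma blaschke_denom a z : modc a < 1 -> modc z < 1 -> 1 - Num.conj a * z != 0.
Proof.
move=> ha hz; rewrite -modc_gt0.
have := modc_subadd 1 (Num.conj a * z); rewrite modc1 modcM modcJ.
have : modc a * modc z <= 1 * modc z by rewrite ler_wpM2r // ltW.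
lra.
Qed.

Lemma one_sub_blaschke a x y : modc a < 1 -> modc x < 1 -> modc y < 1 ->
  1 - blaschke a x * Num.conj (blaschke a y) =
  (1 - a * Num.conj a) * (1 - x * Num.conj y) /
  ((1 - Num.conj a * x) * Num.conj (1 - Num.conj a * y)).
Proof.
move=> ha hx hy; have dx := blaschke_denom ha hx; have dy := blaschke_denom ha hy.
have dy' : Num.conj (1 - Num.conj a * y) != 0 by rewrite conjC_eq0.
rewrite /blaschke; move: dx dy'; rewrite !(rmorphM, rmorphB, fmorphV, rmorph1) /= conjCK.
by move: (Num.conj a) (Num.conj y) => a' y' dx dy'; field; rewrite dx dy'.
Qed.

Lemma sqr_modc_blaschke a z : modc a < 1 -> modc z < 1 ->
  (1 - modc (blaschke a z) ^+ 2) * modc (1 - Num.conj a * z) ^+ 2 =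
  (1 - modc a ^+ 2) * (1 - modc z ^+ 2).
Proof.
move=> ha hz; have dz := blaschke_denom ha hz.
apply/real_complexP; rewrite [LHS]realcM [RHS]realcM !realcB -!mulJc.
rewrite (one_sub_blaschke ha hz hz) divfK //.
by rewrite mulf_neq0 // conjC_eq0.
Qed.

Lemma sqr_lt1 (r : R) : 0 <= r -> (r ^+ 2 < 1) = (r < 1).
Proof. by move=> r0; rewrite -{1}(expr1n R 2) ltr_pXn2r ?nnegrE. Qed.

Lemma blaschke_lt1 a z : modc a < 1 -> modc z < 1 -> modc (blaschke a z) < 1.
Proof.
move=> ha hz; have := sqr_modc_blaschke ha hz.
have dz := blaschke_denom ha hz; rewrite -modc_gt0 in dz.
have h1 : 0 < 1 - modc a ^+ 2 by rewrite subr_gt0 sqr_lt1.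
have h2 : 0 < 1 - modc z ^+ 2 by rewrite subr_gt0 sqr_lt1.
move=> H; rewrite -sqr_lt1 // -subr_gt0.
by rewrite -(pmulr_lgt0 _ (exprn_gt0 2 dz)) H mulr_gt0.
Qed.

Lemma blaschkeK a z : modc a < 1 -> modc z < 1 -> blaschke (- a) (blaschke a z) = z.
Proof.
move=> ha hz; have dz := blaschke_denom ha hz.
have : 1 - a * Num.conj a != 0.
  by rewrite mulJc -realc1 -realcB realc_eq0 gt_eqF // subr_gt0 sqr_lt1.
have := blaschke_denom (a := - a) (z := blaschke a z); rewrite modcN => /(_ ha (blaschke_lt1 ha hz)).
rewrite /blaschke rmorphN /=; move: (Num.conj a) dz => a' dz d2 d1.
have e : 1 - - a' * ((z - a) / (1 - a' * z)) = (1 - a * a') / (1 - a' * z) by field.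
by rewrite e in d2 *; field; rewrite dz d1.
Qed.

Lemma blaschkeNK a z : modc a < 1 -> modc z < 1 -> blaschke a (blaschke (- a) z) = z.
Proof. by move=> ha hz; rewrite -{1}[a]opprK blaschkeK // modcN. Qed.

Lemma cderiv_blaschke a z : modc a < 1 -> modc z < 1 ->
  cderiv (blaschke a) z ((1 - modc a ^+ 2)%:C / (1 - Num.conj a * z) ^+ 2).
Proof.
move=> ha hz; have dz := blaschke_denom ha hz.
have h1 := cderivB (cderiv_cst 1 z) (cderivZ (Num.conj a) (cderiv_id z)).
have h2 := cderiv_comp h1 (cderivV dz).
have := cderivM (cderivB (cderiv_id z) (cderiv_cst a z)) h2.
congr cderiv; rewrite realcB -mulJc; move: (Num.conj a) dz => a' dz /=.
by field.
Qed.

Definition holo_disc F := forall z, modc z < 1 -> exists d, cderiv F z d.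
Definition self_disc F := forall z, modc z < 1 -> modc (F z) < 1.

(** Composing F on both sides with Blaschke factors moves a and F a to 0, where
    [disc_derivative_le1] applies. *)
Lemma infinitesimal_schwarz_pick F a d : holo_disc F -> self_disc F ->
  modc a < 1 -> cderiv F a d -> modc d * (1 - modc a ^+ 2) <= 1 - modc (F a) ^+ 2.
Proof.
move=> hF sF a1 hd; have Fa1 := sF _ a1.
pose g z := blaschke (F a) (F (blaschke (- a) z)).
have Na1 : modc (- a) < 1 by rewrite modcN.
have s0 : modc (0 : R[i]) < 1 by rewrite modc0.
have b0 : blaschke (- a) 0 = a by rewrite /blaschke mulr0 subr0 divr1 sub0r opprK.
have gP z : modc z < 1 -> forall d', cderiv F (blaschke (- a) z) d' ->
    cderiv g z ((1 - modc (F a) ^+ 2)%:C / (1 - Num.conj (F a) * F (blaschke (- a) z)) ^+ 2 *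
      (d' * ((1 - modc (- a) ^+ 2)%:C / (1 - Num.conj (- a) * z) ^+ 2))).
  move=> z1 d' hd'; have b1 := blaschke_lt1 Na1 z1.
  by have := cderiv_comp (cderiv_comp (cderiv_blaschke Na1 z1) hd')
    (cderiv_blaschke Fa1 (sF _ b1)).
have := @disc_derivative_le1 R g _ _ _ _ (gP 0 s0 d _).
rewrite b0; have -> : 1 - Num.conj (F a) * F a = (1 - modc (F a) ^+ 2)%:C.
  by rewrite mulrC mulJc realcB.
have p1 : 0 < 1 - modc (F a) ^+ 2 by rewrite subr_gt0 sqr_lt1.
have p2 : 0 < 1 - modc a ^+ 2 by rewrite subr_gt0 sqr_lt1.
rewrite modcN mulr0 subr0 expr1n divr1 !modcM modcV modcX !modcR !gtr0_norm //.
have -> : (1 - modc (F a) ^+ 2) / (1 - modc (F a) ^+ 2) ^+ 2 * (modc d * (1 - modc a ^+ 2)) =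
  modc d * (1 - modc a ^+ 2) / (1 - modc (F a) ^+ 2) by field; rewrite gt_eqF.
rewrite ler_pdivrMr // mul1r; apply => //.
- move=> z z1; have b1 := blaschke_lt1 Na1 z1; have [d' hd'] := hF _ b1.
  by eexists; exact: gP hd'.
- by move=> z z1; apply: blaschke_lt1 => //; apply: sF; exact: blaschke_lt1.
- by rewrite /g b0 /blaschke subrr mul0r.
Qed.

Lemma LogC_quotient (r : R) : 0 <= r < 1 ->
  LogC (1 - - r%:C) - LogC (1 - r%:C) = (ln ((1 + r) / (1 - r)))%:C.
Proof.
move=> /andP[r0 r1]; have p1 : 0 < 1 + r by lra.
have p2 : 0 < 1 - r by lra.
by rewrite opprK -realc1 -realcD -realcB !LogC_real // -realcB ln_div.
Qed.

(* Along the segment from 0 to z the hyperbolic length of the image does not exceed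
   that of the segment. *)
Lemma schwarz_lemma F z : holo_disc F -> self_disc F -> F 0 = 0 -> modc z < 1 ->
  modc (F z) <= modc z.
Proof.
move=> hF sF F0 z1; have [->|Fz0] := eqVneq (F z) 0; first by rewrite modc0.
pose rho := modc z; pose c := Num.conj (F z) / (modc (F z))%:C.
have mFz : modc (F z) != 0 by rewrite modc_eq0.
have mc : modc c = 1 by rewrite modcM modcV modcJ modcR ger0_norm // divff.
have cF : c * F z = (modc (F z))%:C.
  by rewrite /c mulrAC [_ * F z]mulrC mulJc expr2 realcM mulfK // realc_eq0.
clearbody c.
(* Primitives of 2 q' / (1 - q^2), the hyperbolic length element: [f] along the image of the
   segment, rotated by [c] so that it ends at |F z|, and [g] along the segment [0, |z|]. *)
pose f w := LogC (1 - - (c * F (w * z))) - LogC (1 - c * F (w * z)).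
pose g w := LogC (1 - - (rho%:C * w)) - LogC (1 - rho%:C * w).
have rho0 : 0 <= rho by apply: modc_ge0.
have := @cderiv_mean_value R f g.
rewrite /f /g mul1r mul0r F0 !mulr0 cF mulr1 !oppr0 !addr0 LogC1 subrr !subr0.
rewrite !LogC_quotient; [|by rewrite rho0 z1|by rewrite modc_ge0 sF].
rewrite modcR /= => H.
have {}H : ln ((1 + modc (F z)) / (1 - modc (F z))) <= ln ((1 + rho) / (1 - rho)).
  apply: le_trans (ler_norm _) _; apply: H => s s01.
  have sz1 : modc (s%:C * z) < 1.
    rewrite modcM modcR; apply: le_lt_trans z1; rewrite -[leRHS]mul1r ler_wpM2r //.
    by case/andP: s01 => s0 s1; rewrite ger0_norm.
  have [d hd] := hF _ sz1; have pick := infinitesimal_schwarz_pick hF sF sz1 hd.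
  set q := c * F (s%:C * z).
  have mq : modc q = modc (F (s%:C * z)) by rewrite modcM mc mul1r.
  have q1 : modc q < 1 by rewrite mq sF.
  have Nq1 : modc (- q) < 1 by rewrite modcN.
  have dq : cderiv (fun w => c * F (w * z)) s%:C (c * (d * z)).
    apply: cderivZ; apply: (cderiv_comp (f := fun w => w * z) _ hd).
    have := cderivM (cderiv_id s%:C) (cderiv_cst z s%:C).
    by rewrite mul1r mulr0 addr0.
  have D1 := cderiv_comp (cderivN dq) (cderiv_log1B Nq1).
  have D2 := cderiv_comp dq (cderiv_log1B q1).
  have rs : rho * s < 1.
    by move: z1; rewrite -/rho; case/andP: s01 => s0 s1; nra.
  have rs0 : 0 <= rho * s by case/andP: s01 => s0 s1; rewrite mulr_ge0.
  have m1 : modc (rho%:C * s%:C : R[i]) < 1 by rewrite -realcM modcR ger0_norm.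
  have m2 : modc (- (rho%:C * s%:C) : R[i]) < 1 by rewrite modcN.
  have dg := cderivZ rho%:C (cderiv_id (s%:C : R[i])).
  have E1 := cderiv_comp (cderivN dg) (cderiv_log1B m2).
  have E2 := cderiv_comp dg (cderiv_log1B m1).
  exists (2 * (c * (d * z)) / (1 - q ^+ 2)), (2 * rho / (1 - (rho * s) ^+ 2))%:C; split.
  - have := cderivB D1 D2; congr cderiv.
    have n1 : 1 - q != 0.
      by rewrite -modc_gt0; have := modc_subadd 1 q; rewrite modc1; lra.
    have n2 : 1 + q != 0.
      by rewrite -modc_gt0; have := modc_subadd 1 (- q); rewrite modc1 opprK modcN; lra.
    rewrite opprK; have n3 : 1 - q ^+ 2 != 0.
      by have -> : 1 - q ^+ 2 = (1 - q) * (1 + q) by [ring]; rewrite mulf_neq0.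
    by field; rewrite n1 n2 n3.
  - have := cderivB E1 E2; congr cderiv; rewrite mulr1 opprK -!realcE.
    apply/real_complexP.
    have n1 : 1 - rho * s != 0 by rewrite gt_eqF //; lra.
    have n2 : 1 + rho * s != 0 by rewrite gt_eqF //; lra.
    have n3 : 1 - (rho * s) ^+ 2 != 0.
      by have -> : 1 - (rho * s) ^+ 2 = (1 - rho * s) * (1 + rho * s) by [ring]; rewrite mulf_neq0.
    by field; rewrite n1 n2 n3.
  - rewrite /= !modcM modcV modc_nat mc mul1r -/rho.
    have t1 : 0 < 1 - modc q ^+ 2 by rewrite subr_gt0 sqr_lt1.
    have t2 : 1 - modc q ^+ 2 <= modc (1 - q ^+ 2).
      by have := modc_subadd 1 (q ^+ 2); rewrite modc1 modcX.
    have t3 : 0 < 1 - (rho * s) ^+ 2 by rewrite subr_gt0 sqr_lt1.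
    have e3 : modc (s%:C * z) = rho * s.
      by rewrite modcM modcR mulrC ger0_norm //; case/andP: s01.
    rewrite e3 -mq in pick.
    have t4 : modc d <= (1 - modc q ^+ 2) / (1 - (rho * s) ^+ 2) by rewrite ler_pdivlMr.
    rewrite ler_pdivrMr; last by lra.
    have t5 : modc d * rho <= (1 - modc q ^+ 2) / (1 - (rho * s) ^+ 2) * rho.
      by rewrite ler_wpM2r.
    have t6 : 2 * rho / (1 - (rho * s) ^+ 2) * (1 - modc q ^+ 2) <=
        2 * rho / (1 - (rho * s) ^+ 2) * modc (1 - q ^+ 2).
      by rewrite ler_wpM2l // divr_ge0 ?mulr_ge0 // ltW.
    apply: le_trans t6; move: t5; move: (modc d * rho) => m t5.
    have -> : 2 * rho / (1 - (rho * s) ^+ 2) * (1 - modc q ^+ 2) =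
      2 * ((1 - modc q ^+ 2) / (1 - (rho * s) ^+ 2) * rho) by ring.
    by rewrite ler_pM2l.
have sFz := sF _ z1.
have p1 : 0 < 1 - modc (F z) by lra.
have p2 : 0 < 1 - rho by rewrite subr_gt0.
have p3 : 0 <= modc (F z) by [].
move: H; rewrite ler_ln ?posrE ?divr_gt0 //; try lra.
rewrite ler_pdivrMr // mulrAC ler_pdivlMr //.
by rewrite -/rho; move: (modc (F z)) => u; lra.
Qed.

Definition disc_auto F G := [/\ holo_disc F /\ holo_disc G,
  self_disc F /\ self_disc G, forall z, modc z < 1 -> G (F z) = z &
  forall z, modc z < 1 -> F (G z) = z].

Lemma disc_auto_blaschke a : modc a < 1 -> disc_auto (blaschke a) (blaschke (- a)).
Proof.
move=> ha; have hNa : modc (- a) < 1 by rewrite modcN.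
split; [split|split| |].
- by move=> z hz; eexists; exact: cderiv_blaschke.
- by move=> z hz; eexists; exact: cderiv_blaschke.
- by move=> z hz; exact: blaschke_lt1.
- by move=> z hz; exact: blaschke_lt1.
- by move=> z hz; exact: blaschkeK.
- by move=> z hz; exact: blaschkeNK.
Qed.

Lemma disc_auto_comp F G F' G' : disc_auto F G -> disc_auto F' G' ->
  disc_auto (fun z => F' (F z)) (fun z => G (G' z)).
Proof.
move=> [[h1 h2] [h3 h4] h5 h6] [[k1 k2] [k3 k4] k5 k6]; split; [split|split| |].
- move=> z hz; have [d hd] := h1 _ hz; have [d' hd'] := k1 _ (h3 _ hz).
  by exists (d' * d); exact: cderiv_comp hd hd'.
- move=> z hz; have [d hd] := k2 _ hz; have [d' hd'] := h2 _ (k4 _ hz).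
  by exists (d' * d); exact: cderiv_comp hd hd'.
- by move=> z hz; apply: k3; apply: h3.
- by move=> z hz; apply: h4; apply: k4.
- by move=> z hz; rewrite k5 ?h5 //; apply: h3.
- by move=> z hz; rewrite h6 ?k6 //; apply: k4.
Qed.

Lemma disc_auto_fix0_modc F G z : disc_auto F G -> F 0 = 0 -> modc z < 1 ->
  modc (F z) = modc z.
Proof.
move=> [[h1 h2] [h3 h4] h5 h6] F0 hz; apply/eqP; rewrite eq_le.
rewrite schwarz_lemma //= -{1}(h5 z hz); apply: schwarz_lemma => //; last exact: h3.
by rewrite -F0 h5 // modc0.
Qed.

Lemma disc_auto_pick F G a z : disc_auto F G -> modc a < 1 -> modc z < 1 ->
  modc (blaschke (F a) (F z)) = modc (blaschke a z).
Proof.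
move=> hFG a1 z1; have [_ [h3 _] _ _] := hFG; have Fa1 := h3 _ a1.
have Na1 : modc (- a) < 1 by rewrite modcN.
have hA := disc_auto_comp (disc_auto_comp (disc_auto_blaschke Na1) hFG) (disc_auto_blaschke Fa1).
have b1 := blaschke_lt1 a1 z1.
have := disc_auto_fix0_modc hA _ b1; rewrite blaschkeK //; apply.
by rewrite {2}/blaschke mulr0 subr0 divr1 sub0r opprK /blaschke subrr mul0r.
Qed.

Lemma not_cderiv_conj z d : ~ cderiv (@Num.conj R[i]) z d.
Proof.
move=> /(_ (1 / 2)) []; first lra; move=> r r0 hr.
have := hr r%:C; have := hr (r *i).
rewrite !rmorphD /= ![Num.conj z + _]addrC !addrK conjR.
have -> : Num.conj (r *i : R[i]) = - (r *i) by apply: complex_ext; rewrite ?ReJ ?ImJ ?ReN ?ImN /= ?oppr0.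
have mi : modc (r *i : R[i]) = r.
  by apply/eqP; rewrite -(@eqrXn2 _ 2) ?(ltW r0) // sqr_modc /= expr0n add0r.
rewrite modcR mi (ger0_norm (ltW r0)) lexx => /(_ isT) h1 /(_ isT) h2.
have ri : r *i = 'i * r%:C :> R[i].
  by apply: complex_ext; rewrite ?ReM ?ImM /=; ring.
have mi1 : modc ('i : R[i]) = 1.
  by apply/eqP; rewrite -(@eqrXn2 _ 2) // sqr_modc /= expr0n add0r.
have h3 : modc (- 1 - d) * r <= 1 / 2 * r.
  have : - (r *i) - d * r *i = 'i * ((- 1 - d) * r%:C) by rewrite ri; ring.
  by move: h1 => /[swap] ->; rewrite !modcM mi1 mul1r modcR (ger0_norm (ltW r0)).
have h4 : modc (1 - d) * r <= 1 / 2 * r.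
  have : r%:C - d * r%:C = (1 - d) * r%:C by ring.
  by move: h2 => /[swap] ->; rewrite !modcM modcR (ger0_norm (ltW r0)).
rewrite !ler_pM2r // in h3 h4.
have := modcB (1 - d) (- 1 - d).
have -> : 1 - d - (- 1 - d) = 2%:R by ring.
rewrite modc_nat; lra.
Qed.

(** In place of the equality case of the Schwarz lemma: F preserves the modulus and the
    pseudo-hyperbolic distance, hence the real inner product Re (conj a z). Up to a rotation it is
    therefore the identity or complex conjugation, and conjugation is nowhere complex
    differentiable. *)
Lemma disc_auto_fix0 F G : disc_auto F G -> F 0 = 0 ->
  exists2 c, modc c = 1 & forall z, modc z < 1 -> F z = c * z.
Proof.
move=> hFG F0; have [[hol _] [sF _] _ _] := hFG.
have hm z : modc z < 1 -> modc (F z) = modc z by move=> /(disc_auto_fix0_modc hFG F0).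
have inn a z : modc a < 1 -> modc z < 1 ->
    complex.Re (Num.conj (F a) * F z) = complex.Re (Num.conj a * z).
  move=> a1 z1; have Fa1 := sF _ a1; have Fz1 := sF _ z1.
  have := sqr_modc_blaschke Fa1 Fz1; rewrite (disc_auto_pick hFG a1 z1) !hm //.
  rewrite -(sqr_modc_blaschke a1 z1) => /mulfI H.
  have {}H : modc (1 - Num.conj (F a) * F z) ^+ 2 = modc (1 - Num.conj a * z) ^+ 2.
    by apply: H; rewrite gt_eqF // subr_gt0 sqr_lt1 // blaschke_lt1.
  have ex (u : R[i]) : modc (1 - u) ^+ 2 = 1 - 2 * complex.Re u + modc u ^+ 2.
    by rewrite !sqr_modc ReB ImB /=; ring.
  move: H; rewrite !ex !modcM !modcJ !hm //; lra.
(* The rotation is read off at 1/2; after removing it the real part is preserved. *)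
pose p : R[i] := (2^-1)%:C; pose c := 2 * F p.
have p1 : modc p < 1 by rewrite modcR ger0_norm; lra.
have pE : modc p = 2^-1 by rewrite modcR ger0_norm //; lra.
have mc : modc c = 1 by rewrite modcM modc_nat hm // pE divff.
have cc : c * Num.conj c = 1 by rewrite mulJc mc expr1n.
pose g z := Num.conj c * F z.
have gF z : F z = c * g z by rewrite mulrA cc mul1r.
have gre z : modc z < 1 -> complex.Re (g z) = complex.Re z.
  move=> z1; have := inn p z p1 z1.
  have -> : Num.conj (F p) = (2^-1)%:C * Num.conj c.
    by rewrite rmorphM /= rmorph_nat realcV realc_nat mulrA mulVf ?mul1r // pnatr_eq0.
  rewrite -mulrA -/(g z) conjR !ReZ => H.
  by apply: (mulfI (x := 2^-1)) H; rewrite invr_eq0 pnatr_eq0.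
have gm z : modc z < 1 -> modc (g z) = modc z.
  by move=> z1; rewrite modcM modcJ mc mul1r hm.
have gim z : modc z < 1 -> complex.Im (g z) ^+ 2 = complex.Im z ^+ 2.
  by move=> z1; have := sqr_modc (g z); rewrite gm // gre // sqr_modc => /addrI.
(* The image of i/2 decides between the identity and conjugation. *)
pose q : R[i] := (2^-1) *i.
have q1 : modc q < 1.
  by rewrite -sqr_lt1 // sqr_modc /= expr0n add0r sqr_lt1 //; lra.
have im z : modc z < 1 -> complex.Im (g q) * complex.Im (g z) = 2^-1 * complex.Im z.
  move=> z1; have := inn q z q1 z1.
  have -> : Num.conj (F q) * F z = Num.conj (g q) * g z.
    rewrite /g rmorphM /= conjCK.
    have -> : c * Num.conj (F q) * (Num.conj c * F z) = (c * Num.conj c) * (Num.conj (F q) * F z).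
      by ring.
    by rewrite cc mul1r.
  rewrite (ReM (Num.conj (g q))) (ReM (Num.conj q)) !ReJ !ImJ (gre q) // (gre z) //=; lra.
exists c => // z z1; rewrite gF; congr (_ * _).
have : (complex.Im (g q) - 2^-1) * (complex.Im (g q) + 2^-1) = 0.
  by rewrite -subr_sqr gim //= subrr.
move/eqP; rewrite mulf_eq0 => /orP[] /eqP gq.
  apply: complex_ext; first exact: gre.
  have := im z z1; have -> : complex.Im (g q) = 2^-1 by lra.
  by apply: mulfI; rewrite invr_eq0 pnatr_eq0.
have gconj w : modc w < 1 -> g w = Num.conj w.
  move=> w1; apply: complex_ext; first by rewrite ReJ gre.
  rewrite ImJ; have := im w w1; have -> : complex.Im (g q) = - 2^-1 by lra.
  lra.
have s0 : modc (0 : R[i]) < 1 by rewrite modc0.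
have [d hd] := hol 0 s0.
case: (@not_cderiv_conj 0 (Num.conj c * d)).
have h12 : (0 : R) < 1 / 2 by lra.
apply: (cderiv_near h12 _ (cderivZ (Num.conj c) hd)) => h hh.
rewrite add0r; apply: gconj; lra.
Qed.

Lemma disc_auto_form F G : disc_auto F G -> exists c a,
  [/\ modc c = 1, modc a < 1 & forall z, modc z < 1 -> F z = c * blaschke a z].
Proof.
move=> hFG; have [_ [sF _] _ _] := hFG.
have s0 : modc (0 : R[i]) < 1 by rewrite modc0.
have b1 := sF _ s0; set b := F 0 in b1.
have hA := disc_auto_comp hFG (disc_auto_blaschke b1).
have [|c mc hc] := disc_auto_fix0 hA; first by rewrite /blaschke subrr mul0r.
have cc : c * Num.conj c = 1 by rewrite mulJc mc expr1n.
exists c, (- (Num.conj c * b)); split => //.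
  by rewrite modcN modcM modcJ mc mul1r.
move=> z z1; rewrite -[LHS](blaschkeK b1 (sF _ z1)) hc // /blaschke.
rewrite !rmorphN rmorphM /= conjCK !opprK [RHS]mulrA.
have -> : c * (z + Num.conj c * b) = c * z + b by rewrite mulrDr mulrA cc mul1r.
by congr (_ / _); ring.
Qed.

End DiscAutomorphisms.

(** * Hilbert space geometry and the Riesz representation of a graph *)

Section HilbertSpace.
Variables (R : realType) (H : hilbertSpace R).
Implicit Types (x y z g h : H) (a b l : R[i]).

Local Notation ip := (inner H).

Definition nr x : R := complex.Re `|x|.

Lemma normHE x : `|x| = (nr x)%:C.
Proof. exact: realc_ge0 (normr_ge0 x). Qed.

Lemma nr_ge0 x : 0 <= nr x.
Proof. by rewrite -lecR -normHE normr_ge0. Qed.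

Lemma nrD x y : nr (x + y) <= nr x + nr y.
Proof. by rewrite -lecR realcD -!normHE ler_normD. Qed.

Lemma nrZ a x : nr (a *: x) = modc a * nr x.
Proof. by apply/real_complexP; rewrite realcM -normHE normrZ normE normHE. Qed.

Lemma nrN x : nr (- x) = nr x.
Proof. by rewrite /nr normrN. Qed.

Lemma nrBC x y : nr (x - y) = nr (y - x).
Proof. by rewrite /nr distrC. Qed.

Lemma nrB x y : nr (x - y) <= nr x + nr y.
Proof. by rewrite -(nrN y) nrD. Qed.

Lemma nr0 : nr 0 = 0.
Proof. by rewrite /nr normr0. Qed.

Lemma nr_eq0 x : (nr x == 0) = (x == 0).
Proof. by rewrite -realc_eq0 -normHE normr_eq0. Qed.

Lemma inner_nr x : ip x x = (nr x ^+ 2)%:C.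
Proof. by rewrite -inner_norm normHE realcX. Qed.

Lemma innerC x y : ip x y = Num.conj (ip y x).
Proof. by rewrite (hermC (inner H) x y) expr0 mul1r. Qed.

Lemma innerDl x y z : ip (x + y) z = ip x z + ip y z.
Proof. exact: linearDl. Qed.

Lemma innerZl a x z : ip (a *: x) z = a * ip x z.
Proof. exact: linearZl_LR. Qed.

Lemma innerDr x y z : ip z (x + y) = ip z x + ip z y.
Proof. exact: linearDr. Qed.

Lemma innerZr a x z : ip z (a *: x) = Num.conj a * ip z x.
Proof. by rewrite innerC innerZl rmorphM /= -innerC. Qed.

Lemma innerBl x y z : ip (x - y) z = ip x z - ip y z.
Proof. by rewrite innerDl -scaleN1r innerZl mulN1r. Qed.

Lemma innerBr x y z : ip z (x - y) = ip z x - ip z y.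
Proof. by rewrite innerC innerBl rmorphB /= -!innerC. Qed.

Lemma inner0l x : ip 0 x = 0.
Proof. by rewrite -(scale0r 0) innerZl mul0r. Qed.

Lemma inner0r x : ip x 0 = 0.
Proof. by rewrite innerC inner0l rmorph0. Qed.

Lemma inner_suml (I : Type) (r : seq I) (F : I -> H) x :
  ip (\sum_(i <- r) F i) x = \sum_(i <- r) ip (F i) x.
Proof.
elim: r => [|i r IH]; first by rewrite !big_nil inner0l.
by rewrite !big_cons innerDl IH.
Qed.

Lemma inner_sumr (I : Type) (r : seq I) (F : I -> H) x :
  ip x (\sum_(i <- r) F i) = \sum_(i <- r) ip x (F i).
Proof.
elim: r => [|i r IH]; first by rewrite !big_nil inner0r.
by rewrite !big_cons innerDr IH.
Qed.

Lemma sqr_nrD x y : nr (x + y) ^+ 2 = nr x ^+ 2 + nr y ^+ 2 + 2 * complex.Re (ip x y).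
Proof.
have -> : nr (x + y) ^+ 2 = complex.Re (ip (x + y) (x + y)) by rewrite inner_nr.
rewrite innerDl !innerDr !ReD !inner_nr /= (innerC y x) ReJ; ring.
Qed.

Lemma parallelogram x y :
  nr (x + y) ^+ 2 + nr (x - y) ^+ 2 = 2 * nr x ^+ 2 + 2 * nr y ^+ 2.
Proof.
by rewrite !sqr_nrD nrN -[- y]scaleN1r innerZr rmorphN1 mulN1r ReN; ring.
Qed.

Lemma cauchy_schwarz x y : modc (ip x y) <= nr x * nr y.
Proof.
have [->|y0] := eqVneq y 0; first by rewrite inner0r modc0 nr0 mulr0.
have ny : 0 < nr y by rewrite lt_def nr_eq0 y0 nr_ge0.
rewrite -(@ler_sqr R) ?nnegrE ?mulr_ge0 ?nr_ge0 //.
pose a := ip x y / (nr y ^+ 2)%:C.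
have := sqr_ge0 (nr (x - a *: y)).
rewrite sqr_nrD nrN -scaleNr innerZr nrZ rmorphN mulNr ReN.
have -> : Num.conj a * ip x y = (modc (ip x y) ^+ 2 / nr y ^+ 2)%:C.
  rewrite /a rmorphM /= fmorphV /= conjR mulrAC [Num.conj _ * _]mulrC mulJc.
  by rewrite -realcV -realcM.
rewrite /a modcM modcV modcR (ger0_norm (sqr_ge0 _)) /= => h.
have e : (modc (ip x y) / nr y ^+ 2 * nr y) ^+ 2 = modc (ip x y) ^+ 2 / nr y ^+ 2.
  by field; rewrite gt_eqF.
rewrite e in h; rewrite exprMn -ler_pdivrMr ?exprn_gt0 //; lra.
Qed.

Definition cvh (u : nat -> H) x := forall e : R, 0 < e ->
  exists N, forall n, (N <= n)%N -> nr (u n - x) <= e.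

Lemma cauchy_cvh (u : nat -> H) : (forall e : R, 0 < e -> exists N, forall m n,
  (N <= m)%N -> (N <= n)%N -> nr (u m - u n) <= e) -> exists x, cvh u x.
Proof.
move=> hu; have : cvg (u @ \oo).
  apply: cauchy_cvg; apply/cauchy_exP => e e0.
  have eE := realc_ge0 (ltW e0); set r := complex.Re e in eE.
  have r0 : 0 < r by rewrite -ltcR -eE.
  have [N hN] := hu (r / 2) (divr_gt0 r0 (ltr0Sn _ _)).
  exists (u N); exists N => // n /= Nn; rewrite -ball_normE /ball_ /=.
  rewrite normHE eE ltcR; have := hN N n (leqnn _) Nn; lra.
move=> /cvg_ex [x ux]; exists x => e e0.
have e0' : 0 < e%:C :> R[i] by rewrite ltcR.
have [N _ hN] := (cvgrPdist_le _ _).1 ux _ e0'.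
exists N => n /hN; rewrite -lecR -normHE distrC; exact.
Qed.

Lemma cvh_inner (u : nat -> H) x y : cvh u x -> cvs (fun n => ip y (u n)) (ip y x).
Proof.
move=> ux; apply: (@cvsP _ _ _ (nr y)) => e /ux [N hN]; exists N => n /hN h.
by rewrite -innerBr (le_trans (cauchy_schwarz _ _)) // ler_wpM2l // nr_ge0.
Qed.

Lemma cvh_innerl (u : nat -> H) x y : cvh u x -> cvs (fun n => ip (u n) y) (ip x y).
Proof.
move=> /(cvh_inner y) /cvsJ; rewrite -innerC.
by apply: cvs_ext => n; rewrite -innerC.
Qed.

(* [G] is the graph of a bounded functional on a subspace; the representing vector
   minimizes |g|^2 - 2 Re l over the graph. *)
Lemma riesz_graph (G : H -> R[i] -> Prop) (C : R) : 0 <= C -> G 0 0 ->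
  (forall a g l g' l', G g l -> G g' l' -> G (a *: g + g') (a * l + l')) ->
  (forall g l, G g l -> modc l <= C * nr g) ->
  exists2 h, nr h <= C & forall g l, G g l -> ip g h = l.
Proof.
move=> C0 G0 GL GC.
pose J (p : H * R[i]) := nr p.1 ^+ 2 - 2 * complex.Re p.2.
pose A : set R := [set J p | p in [set p | G p.1 p.2]].
have lbA : lbound A (- C ^+ 2).
  move=> _ [[g l] /= Ggl <-]; rewrite /J /=.
  have := le_trans (ler_norm _) (le_trans (modc_Re l) (GC _ _ Ggl)).
  by have := sqr_ge0 (nr g - C); nra.
have hA : has_inf A.
  by split; [exists (J (0, 0)); exists (0, 0) | exists (- C ^+ 2)].
set m := inf A in hA.
have mJ g l : G g l -> m <= J (g, l).
  by move=> Ggl; apply: ge_inf; [case: hA | exists (g, l)].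
have [|p hp] := @choice nat (H * R[i])%type
    (fun n q => G q.1 q.2 /\ J q < m + n.+1%:R^-1).
  move=> n.
  have n0 : 0 < n.+1%:R^-1 :> R by rewrite invr_gt0.
  by have [_ [q Gq <-] hq] := inf_adherent n0 hA; exists q.
have inv_small (e : R) : 0 < e -> exists N, forall n, (N <= n)%N -> n.+1%:R^-1 <= e.
  move=> e0; exists (Num.bound e^-1) => n Nn; rewrite invf_ple ?posrE //.
  apply: ltW; apply: lt_le_trans (archi_boundP _) _; first by rewrite invr_ge0 ltW.
  by rewrite ler_nat ltnW.
(* The midpoint of two nearly minimal pairs is again in the graph, so by the parallelogram law a
   minimizing sequence is Cauchy. *)
have close i j : nr ((p i).1 - (p j).1) ^+ 2 <= 2 * (i.+1%:R^-1 + j.+1%:R^-1).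
  have [Gi Ji] := hp i; have [Gj Jj] := hp j.
  have := GL (2^-1) _ _ _ _ (GL 1 _ _ _ _ Gi Gj) G0.
  rewrite scale1r mul1r !addr0 => /mJ; rewrite /J /= nrZ modcV modc_nat.
  have := parallelogram (p i).1 (p j).1; move: Ji Jj; rewrite /J.
  rewrite -realc_nat -realcV ReZ ReD exprMn.
  have -> : (2^-1 : R) ^+ 2 = 1 / 4 by field.
  move: (i.+1%:R^-1) (j.+1%:R^-1) (nr (p i).1 ^+ 2) (nr (p j).1 ^+ 2)
    (nr ((p i).1 + (p j).1) ^+ 2) (nr ((p i).1 - (p j).1) ^+ 2)
    (complex.Re (p i).2) (complex.Re (p j).2).
  by clear; move: m => m a1 a2 a3 a4 a5 a6 a7 a8; lra.
have [|h hh] := @cauchy_cvh (fun n => (p n).1).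
  move=> e e0; have e2 : 0 < e ^+ 2 / 4 by rewrite divr_gt0 // exprn_gt0.
  have [N hN] := inv_small _ e2; exists N => i j Ni Nj.
  rewrite -(@ler_sqr R) ?nnegrE ?nr_ge0 ?(ltW e0) //.
  apply: (le_trans (close i j)); have := hN _ Ni; have := hN _ Nj.
  by move: (i.+1%:R^-1) (j.+1%:R^-1) => s t; lra.
have inn g l : G g l -> ip g h = l.
  move=> Ggl; apply/eqP; rewrite -subr_eq0; apply/eqP.
  set D := ip g h - l.
  (* Minimality of the limit under the variation by a g, obtained from the approximating pairs since
     the limit itself need not carry a value in [G]. *)
  have key a : 0 <= 2 * complex.Re (a * D) + modc a ^+ 2 * nr g ^+ 2.
    apply/ler_addgt0Pr => e e0.
    have e2 : 0 < e / 2 by rewrite divr_gt0.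
    have e3 : 0 < e / 2 / (2 * modc a + 1) by rewrite divr_gt0 // ltr_wpDl // mulr_ge0.
    have [N hN] := inv_small _ e2; have [M hM] := cvh_inner g hh e3.
    pose k := maxn N M; have [Gk Jk] := hp k.
    have h1 := hN k (leq_maxl _ _); have h2 := hM k (leq_maxr _ _).
    have := mJ _ _ (GL a _ _ _ _ Ggl Gk); rewrite /J /= [a *: g + _]addrC sqr_nrD nrZ.
    rewrite innerC innerZl ReJ exprMn ReD.
    have h3 : `|complex.Re (a * (ip g (p k).1 - ip g h))| <= modc a * (e / 2 / (2 * modc a + 1)).
      by apply: (le_trans (modc_Re _)); rewrite modcM ler_wpM2l.
    have h4 : 2 * (modc a * (e / 2 / (2 * modc a + 1))) <= e / 2.
      have -> : 2 * (modc a * (e / 2 / (2 * modc a + 1))) = (e / 2) * (2 * modc a / (2 * modc a + 1)).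
        by ring.
      rewrite -[leRHS]mulr1; apply: ler_wpM2l; first exact: ltW.
      by rewrite ler_pdivrMr ?mul1r ?lerDl // ltr_wpDl // mulr_ge0.
    have := le_trans (ler_norm _) h3.
    have -> : a * (ip g (p k).1 - ip g h) = a * ip g (p k).1 - a * D - a * l.
      by rewrite /D; ring.
    rewrite !ReB; move: Jk h1 h4; rewrite /J.
    by move: (k.+1%:R^-1) (modc a * (e / 2 / _)) => s t; lra.
  (* With t = 1 / (1 + |g|^2) the linear term is - 2 t |D|^2 and the quadratic one at most t |D|^2,
     as t |g|^2 <= 1; this forces D = 0. *)
  have := key (- (1 + nr g ^+ 2)^-1%:C * Num.conj D).
  have g0 := sqr_ge0 (nr g); have g1 : 0 < 1 + nr g ^+ 2 by lra.
  have -> : - (1 + nr g ^+ 2)^-1%:C * Num.conj D * D = (- (1 + nr g ^+ 2)^-1 * modc D ^+ 2)%:C.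
    by rewrite -mulrA [_ * D]mulrC mulJc [RHS]realcM [(- _)%:C]realcN.
  rewrite modcM modcN modcJ modcR ger0_norm ?invr_ge0 ?(ltW g1) //= => k1.
  apply/eqP; rewrite -modc_eq0 -[_ == 0]/(modc D == 0) -(sqrf_eq0 (modc D)) eq_le sqr_ge0 andbT.
  move: k1; set t := (1 + _)^-1; set d := modc D ^+ 2.
  have t0 : 0 < t by rewrite invr_gt0.
  have tg : t * nr g ^+ 2 <= 1 by rewrite /t mulrC ler_pdivrMr // mul1r; lra.
  have d0 : 0 <= d by rewrite /d sqr_ge0.
  have -> : 2 * (- t * d) + (t * modc D) ^+ 2 * nr g ^+ 2 = t * d * (t * nr g ^+ 2 - 2).
    by rewrite /d; ring.
  move=> k1; rewrite leNgt; apply/negP => dp.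
  have tg2 : t * nr g ^+ 2 - 2 < 0 by move: tg; move: (t * _) => q; lra.
  have : t * d * (t * nr g ^+ 2 - 2) < 0 by rewrite pmulr_rlt0 // mulr_gt0.
  by rewrite ltNge k1.
exists h => //.
have [->|h0] := eqVneq h 0; first by rewrite nr0.
have nh : 0 < nr h by rewrite lt_def nr_eq0 h0 nr_ge0.
rewrite -(ler_pM2r nh).
(* [h] is a limit of vectors of the graph, on which [C] bounds the functional that [h]
   represents. *)
have nn : modc (ip h h) <= C * nr h.
  apply/ler_addgt0Pr => e e0.
  have e1 : 0 < e / (nr h + C) by rewrite divr_gt0 // ltr_wpDr.
  have [N /(_ N (leqnn _)) hN] := hh _ e1; have [GN _] := hp N.
  have -> : ip h h = ip (p N).1 h - ip ((p N).1 - h) h by rewrite innerBl opprB addrC subrK.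
  apply: (le_trans (modcB _ _)); rewrite (inn _ _ GN).
  have a1 := GC _ _ GN; have a2 := cauchy_schwarz ((p N).1 - h) h.
  have a3 : nr (p N).1 <= nr h + e / (nr h + C).
    by rewrite -{1}(subrK h (p N).1) addrC (le_trans (nrD _ _)) // lerD2l.
  have a4 : C * nr (p N).1 <= C * (nr h + e / (nr h + C)) by rewrite ler_wpM2l.
  have a5 : nr ((p N).1 - h) * nr h <= e / (nr h + C) * nr h by rewrite ler_wpM2r // ltW.
  have a6 : e / (nr h + C) * nr h + C * (e / (nr h + C)) = e.
    by field; rewrite gt_eqF // ltr_wpDr.
  lra.
by move: nn; rewrite inner_nr modcR ger0_norm ?sqr_ge0 // expr2.
Qed.

Lemma linear_of_fun (W : H -> H) :
  (forall a f g, W (a *: f + g) = a *: W f + W g) ->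
  exists L : {linear H -> H}, forall f, L f = W f.
Proof.
move=> hW; pose A := GRing.isLinear.Build R[i] H H *:%R W hW.
by pose L : {linear H -> H} := HB.pack W A; exists L.
Qed.

End HilbertSpace.

(** * Nonnegative definite kernels *)

Section NonnegDefinite.
Variables (R : realType) (T : choiceType) (D : set T).
Implicit Types (K : T -> T -> R[i]) (s : seq (R[i] * T)) (g m : T -> R[i]).

(** Weights and nodes form one list, so that families can be mapped, as in [kform_twist], and
    concatenated, as for linear combinations of kernel elements. *)
Definition kform K s : R[i] :=
  \sum_(q <- s) \sum_(q' <- s) K q.2 q'.2 * q'.1 * Num.conj q.1.

Definition nodes_in s := forall q, q \in s -> D q.2.

Lemma nonneg_definite_kform K :
  nonneg_definite D K <-> forall s, nodes_in s -> 0 <= kform K s.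
Proof.
split=> [h s hs|h p w zeta hw].
  case: s hs => [|q0 s'] hs; first by rewrite /kform big_nil.
  set s := q0 :: s' in hs *.
  have := h (size s) (fun i => (nth q0 s i).2) (fun i => (nth q0 s i).1).
  rewrite /kform (big_nth q0) big_mkord.
  under [X in _ -> 0 <= X]eq_bigr => i _ do rewrite (big_nth q0) big_mkord.
  by apply => i; apply: hs; apply: mem_nth.
have := h [seq (zeta i, w i) | i <- enum 'I_p].
have -> : kform K [seq (zeta i, w i) | i <- enum 'I_p] =
    \sum_(i < p) \sum_(j < p) K (w i) (w j) * zeta j * Num.conj (zeta i).
  rewrite /kform big_map big_enum; apply: eq_big => // i _.
  by rewrite big_map big_enum; apply: eq_big.
by apply => q /mapP[i _ ->]; exact: hw.
Qed.

Lemma eq_kform K K' s : nodes_in s ->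
  (forall z w, D z -> D w -> K z w = K' z w) -> kform K s = kform K' s.
Proof.
move=> hs KK'; rewrite /kform big_seq [RHS]big_seq; apply: eq_bigr => q qs.
rewrite big_seq [RHS]big_seq; apply: eq_bigr => q' q's.
by rewrite KK' //; apply: hs.
Qed.

Lemma kform_lincomb (a b : R[i]) K K' s :
  kform (fun z w => a * K z w + b * K' z w) s = a * kform K s + b * kform K' s.
Proof.
rewrite /kform !mulr_sumr -big_split /=; apply: eq_bigr => q _.
rewrite !mulr_sumr -big_split /=; apply: eq_bigr => q' _; ring.
Qed.

Lemma kform_rank1 g s : kform (fun z w => g z * Num.conj (g w)) s =
  (modc (\sum_(q <- s) Num.conj q.1 * g q.2) ^+ 2)%:C.
Proof.
rewrite -mulJc rmorph_sum /= mulr_suml; apply: eq_bigr => q _.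
rewrite mulr_sumr; apply: eq_bigr => q' _; rewrite rmorphM /= conjCK; ring.
Qed.

Lemma kform_twist K m (sg : T -> T) s :
  kform (fun z w => m z * K (sg z) (sg w) * Num.conj (m w)) s =
  kform K [seq (Num.conj (m q.2) * q.1, sg q.2) | q <- s].
Proof.
rewrite /kform big_map; apply: eq_bigr => q _; rewrite big_map.
by apply: eq_bigr => q' _; rewrite rmorphM /= conjCK; ring.
Qed.

Lemma cvs_sum_in (I : eqType) (r : seq I) (F : I -> nat -> R[i]) (L : I -> R[i]) :
  (forall i, i \in r -> cvs (F i) (L i)) ->
  cvs (fun n => \sum_(i <- r) F i n) (\sum_(i <- r) L i).
Proof.
elim: r => [|i r IH] h.
  by rewrite big_nil; apply: cvs_ext (cvs_cst _) => n; rewrite big_nil.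
rewrite big_cons; have h1 := h i (mem_head _ _).
have h2 : forall j, j \in r -> cvs (F j) (L j).
  by move=> j jr; apply: h; rewrite inE jr orbT.
by apply: cvs_ext (cvsD h1 (IH h2)) => n; rewrite big_cons.
Qed.

Lemma kform_lim (Kn : nat -> T -> T -> R[i]) K s : nodes_in s ->
  (forall z w, D z -> D w -> cvs (fun n => Kn n z w) (K z w)) ->
  cvs (fun n => kform (Kn n) s) (kform K s).
Proof.
move=> hs hK; apply: cvs_sum_in => q qs; apply: cvs_sum_in => q' q's.
by do 2! (apply: cvsM; last exact: cvs_cst); apply: hK; exact: hs.
Qed.

Lemma nnd_ext K K' : (forall z w, D z -> D w -> K z w = K' z w) ->
  nonneg_definite D K -> nonneg_definite D K'.
Proof.
move=> KK' /nonneg_definite_kform h; apply/nonneg_definite_kform => s hs.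
by rewrite -(eq_kform hs KK') h.
Qed.

Lemma nnd_lincomb (a b : R) K K' : 0 <= a -> 0 <= b ->
  nonneg_definite D K -> nonneg_definite D K' ->
  nonneg_definite D (fun z w => a%:C * K z w + b%:C * K' z w).
Proof.
move=> a0 b0 /nonneg_definite_kform h /nonneg_definite_kform h'.
apply/nonneg_definite_kform => s hs; rewrite kform_lincomb.
by rewrite addr_ge0 // mulr_ge0 ?ler0c ?h ?h'.
Qed.

Lemma nnd_lim (Kn : nat -> T -> T -> R[i]) K :
  (forall n, nonneg_definite D (Kn n)) ->
  (forall z w, D z -> D w -> cvs (fun n => Kn n z w) (K z w)) ->
  nonneg_definite D K.
Proof.
move=> hn hK; apply/nonneg_definite_kform => s hs.
apply: (cvs_ge0 (kform_lim hs hK)) => n.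
by have /nonneg_definite_kform := hn n; apply.
Qed.

Lemma nnd_twist K m (sg : T -> T) : (forall z, D z -> D (sg z)) ->
  nonneg_definite D K ->
  nonneg_definite D (fun z w => m z * K (sg z) (sg w) * Num.conj (m w)).
Proof.
move=> hsg /nonneg_definite_kform h; apply/nonneg_definite_kform => s hs.
by rewrite kform_twist; apply: h => _ /mapP[q qs ->]; apply: hsg; exact: hs.
Qed.

Lemma nnd0 : nonneg_definite D (fun _ _ => 0 : R[i]).
Proof.
by move=> p w zeta _; rewrite big1 // => i _; rewrite big1 // => j _; rewrite !mul0r.
Qed.

Lemma nnd_sum (Kn : nat -> T -> T -> R[i]) n : (forall k, nonneg_definite D (Kn k)) ->
  nonneg_definite D (fun z w => \sum_(k < n) Kn k z w).
Proof.
move=> h; elim: n => [|n IH]; first by apply: nnd_ext nnd0 => z w _ _; rewrite big_ord0.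
apply: nnd_ext (nnd_lincomb ler01 ler01 IH (h n)) => z w _ _.
by rewrite big_ord_recr /= realc1 !mul1r.
Qed.

(** A special case of the Schur product theorem in which each term is visibly nonnegative definite:
    it is [K] twisted by the multiplier g^k. *)
Lemma nnd_mul_series K (c : nat -> R) g (S : T -> T -> R[i]) :
  (forall k, 0 <= c k) -> nonneg_definite D K ->
  (forall z w, D z -> D w -> sums (fun k => (c k)%:C * (g z * Num.conj (g w)) ^+ k) (S z w)) ->
  nonneg_definite D (fun z w => S z w * K z w).
Proof.
move=> c0 hK hS.
apply: (@nnd_lim (fun n z w => \sum_(k < n) (c k)%:C * (g z ^+ k * K z w * Num.conj (g w ^+ k)))).
  move=> n; apply: (nnd_sum (Kn := fun k z w => (c k)%:C * (g z ^+ k * K z w * Num.conj (g w ^+ k)))) => k.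
  have h := @nnd_twist K (fun z => g z ^+ k) id (fun z hz => hz) hK.
  apply: nnd_ext (nnd_lincomb (c0 k) (lexx 0) h h) => z w _ _.
  by rewrite realc0 mul0r addr0.
move=> z w hz hw; apply: cvs_ext (cvsM (hS z w hz hw) (cvs_cst (K z w))) => n.
rewrite mulr_suml; apply: eq_bigr => k _.
by rewrite rmorphXn /= exprMn; ring.
Qed.

End NonnegDefinite.

(** * The Cauchy-Schwarz inequality for finite sums *)

Section FiniteCauchySchwarz.
Variable R : realType.

Lemma sum_cauchy_schwarz (x y : nat -> R) n :
  (forall k, 0 <= x k) -> (forall k, 0 <= y k) ->
  (\sum_(k < n) x k * y k) ^+ 2 <= (\sum_(k < n) x k ^+ 2) * (\sum_(k < n) y k ^+ 2).
Proof.
move=> x0 y0; elim: n => [|n IH]; first by rewrite !big_ord0 expr0n mul0r.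
rewrite !big_ord_recr /=; move: IH.
have : 0 <= \sum_(k < n) x k * y k by apply: sumr_ge0 => k _; apply: mulr_ge0.
have : 0 <= \sum_(k < n) x k ^+ 2 by apply: sumr_ge0 => k _; apply: sqr_ge0.
have : 0 <= \sum_(k < n) y k ^+ 2 by apply: sumr_ge0 => k _; apply: sqr_ge0.
move: (\sum_(k < n) x k * y k) (\sum_(k < n) x k ^+ 2) (\sum_(k < n) y k ^+ 2).
move: (x n) (y n) (x0 n) (y0 n) => a b a0 b0 S A B B0 A0 S0 SAB.
have key : 2 * (S * (a * b)) <= A * b ^+ 2 + B * a ^+ 2.
  rewrite -(@ler_sqr R) ?nnegrE ?addr_ge0 ?mulr_ge0 ?sqr_ge0 //.
  have h1 : (2 * (S * (a * b))) ^+ 2 <= 4 * (A * B) * (a * b) ^+ 2.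
    have -> : (2 * (S * (a * b))) ^+ 2 = 4 * S ^+ 2 * (a * b) ^+ 2 by ring.
    by rewrite ler_wpM2r ?sqr_ge0 // ler_wpM2l.
  apply: (le_trans h1); rewrite -subr_ge0.
  have -> : (A * b ^+ 2 + B * a ^+ 2) ^+ 2 - 4 * (A * B) * (a * b) ^+ 2 =
    (A * b ^+ 2 - B * a ^+ 2) ^+ 2 by ring.
  exact: sqr_ge0.
have -> : (S + a * b) ^+ 2 = S ^+ 2 + 2 * (S * (a * b)) + (a * b) ^+ 2 by ring.
have -> : (A + a ^+ 2) * (B + b ^+ 2) = A * B + (A * b ^+ 2 + B * a ^+ 2) + (a * b) ^+ 2 by ring.
by rewrite lerD2r lerD.
Qed.

Lemma modc_sum_cauchy_schwarz (c a : nat -> R[i]) n :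
  modc (\sum_(k < n) c k * a k) ^+ 2 <=
  (\sum_(k < n) modc (c k) ^+ 2) * (\sum_(k < n) modc (a k) ^+ 2).
Proof.
apply: le_trans (sum_cauchy_schwarz (x := fun k => modc (c k)) (y := fun k => modc (a k)) n _ _) => //.
rewrite ler_sqr ?nnegrE ?sumr_ge0 //; last by move=> k _; rewrite mulr_ge0.
by apply: (le_trans (modc_sum _ _ _)); apply: ler_sum => k _; rewrite modcM.
Qed.

End FiniteCauchySchwarz.

(** * Reproducing kernel spaces: membership, multipliers, Parseval frames *)

Section ReproducingKernelSpace.
Variables (R : realType) (H : hilbertFunctionSpace (@bidisc R)).
Variable K : 'rV[R[i]]_2 -> 'rV[R[i]]_2 -> R[i].
Hypothesis hK : reproducing_kernel H K.
Implicit Types (x y : H) (z w : 'rV[R[i]]_2) (g m : 'rV[R[i]]_2 -> R[i]).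
Local Notation ip := (inner H).
Local Notation ev := (@Defs.eval R (@bidisc R) H).

Definition kelt w : H := xget 0 [set k : H |
  (forall z, bidisc z -> ev k z = K z w) /\ forall f : H, ev f w = ip f k].

Lemma keltP w : bidisc w ->
  (forall z, bidisc z -> ev (kelt w) z = K z w) /\ forall f : H, ev f w = ip f (kelt w).
Proof.
by move=> /hK [k h1 h2]; rewrite /kelt; apply: (@xgetPex _ _ [set k : H |
  (forall z, bidisc z -> ev k z = K z w) /\ forall f : H, ev f w = ip f k]); exists k.
Qed.

Lemma eval_kelt z w : bidisc z -> bidisc w -> ev (kelt w) z = K z w.
Proof. by move=> hz /keltP [h _]; exact: h. Qed.

Lemma eval_ip w x : bidisc w -> ev x w = ip x (kelt w).
Proof. by move=> /keltP [_ h]; exact: h. Qed.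

Lemma ip_kelt w x : bidisc w -> ip (kelt w) x = Num.conj (ev x w).
Proof. by move=> hw; rewrite eval_ip // -innerC. Qed.

Lemma kform_kelt (s : seq (R[i] * 'rV[R[i]]_2)) : nodes_in (@bidisc R) s ->
  kform K s = (nr (\sum_(q <- s) q.1 *: kelt q.2) ^+ 2)%:C.
Proof.
move=> hs; rewrite -inner_nr inner_sumr /kform big_seq [RHS]big_seq.
apply: eq_bigr => q qs; rewrite innerZr inner_suml mulr_sumr.
rewrite big_seq [RHS]big_seq; apply: eq_bigr => q' q's.
rewrite innerZl -eval_ip ?eval_kelt; try exact: hs.
by rewrite [RHS]mulrC; congr (_ * _); rewrite mulrC.
Qed.

Lemma ip_kelt_sum (s : seq (R[i] * 'rV[R[i]]_2)) x : nodes_in (@bidisc R) s ->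
  ip (\sum_(q <- s) q.1 *: kelt q.2) x = \sum_(q <- s) q.1 * Num.conj (ev x q.2).
Proof.
move=> hs; rewrite inner_suml big_seq [RHS]big_seq; apply: eq_bigr => q qs.
by rewrite innerZl ip_kelt //; exact: hs.
Qed.

Lemma conj_node_sum (s : seq (R[i] * 'rV[R[i]]_2)) g :
  modc (\sum_(q <- s) Num.conj q.1 * g q.2) = modc (\sum_(q <- s) q.1 * Num.conj (g q.2)).
Proof.
rewrite -modcJ rmorph_sum /=; congr modc; apply: eq_bigr => q _.
by rewrite rmorphM /= conjCK.
Qed.

(** Domination says exactly that sending a combination of kernel elements to the same combination of
    the values conj g is bounded by r; g is then the function of the Riesz vector. Kernel elements
    may be linearly dependent, so this assignment is handled as a graph and not as a map. *)
Lemma kernel_mem g (r : R) : 0 <= r ->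
  nonneg_definite (@bidisc R) (fun z w => (r ^+ 2)%:C * K z w - g z * Num.conj (g w)) ->
  exists2 h : H, forall z, bidisc z -> ev h z = g z & nr h <= r.
Proof.
move=> r0 /nonneg_definite_kform hnn.
pose G (x : H) (l : R[i]) := exists s : seq (R[i] * 'rV[R[i]]_2),
  [/\ nodes_in (@bidisc R) s, x = \sum_(q <- s) q.1 *: kelt q.2 &
      l = \sum_(q <- s) q.1 * Num.conj (g q.2)].
have [|||h hr hG] := @riesz_graph R H G r r0.
- by exists [::]; split => //; rewrite big_nil.
- move=> a x l x' l' [s [hs -> ->]] [s' [hs' -> ->]].
  exists ([seq (a * q.1, q.2) | q <- s] ++ s'); split.
  + move=> q; rewrite mem_cat => /orP[/mapP[q' q's ->] | q's]; last exact: hs'.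
    exact: (hs q' q's).
  + rewrite big_cat big_map /=; congr (_ + _); rewrite scaler_sumr.
    by apply: eq_bigr => q _; rewrite scalerA.
  + rewrite big_cat big_map /=; congr (_ + _); rewrite mulr_sumr.
    by apply: eq_bigr => q _; rewrite mulrA.
- move=> x l [s [hs -> ->]]; have := hnn s hs.
  have -> : kform (fun z w => (r ^+ 2)%:C * K z w - g z * Num.conj (g w)) s =
    (r ^+ 2)%:C * kform K s + (-1) * kform (fun z w => g z * Num.conj (g w)) s.
    by rewrite -kform_lincomb; apply: eq_bigr => q _; apply: eq_bigr => q' _; ring.
  rewrite kform_rank1 kform_kelt // conj_node_sum mulN1r -realcM -realcB ler0c subr_ge0.
  by rewrite -exprMn ler_sqr // nnegrE ?mulr_ge0 ?nr_ge0.
exists h => // z hz; rewrite eval_ip // innerC.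
rewrite (hG (kelt z) (Num.conj (g z))) ?conjCK //.
exists [:: (1, z)]; split; rewrite ?big_seq1 ?scale1r ?mul1r //.
by move=> q; rewrite inE => /eqP ->.
Qed.

Lemma kernel_bound x : nonneg_definite (@bidisc R)
  (fun z w => (nr x ^+ 2)%:C * K z w - ev x z * Num.conj (ev x w)).
Proof.
apply/nonneg_definite_kform => s hs.
have -> : kform (fun z w => (nr x ^+ 2)%:C * K z w - ev x z * Num.conj (ev x w)) s =
    (nr x ^+ 2)%:C * kform K s + (-1) * kform (fun z w => ev x z * Num.conj (ev x w)) s.
  by rewrite -kform_lincomb; apply: eq_bigr => q _; apply: eq_bigr => q' _; ring.
rewrite (kform_rank1 (ev x)) kform_kelt // conj_node_sum -(ip_kelt_sum x hs).
rewrite mulN1r -realcM -realcB ler0c subr_ge0 -exprMn ler_sqr ?nnegrE ?mulr_ge0 ?nr_ge0 //.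
by rewrite mulrC cauchy_schwarz.
Qed.

(** For y = m (x o sg), the kernel r^2 |x|^2 K - y conj y is the sum of |x|^2 (r^2 K - m (K o sg)
    conj m) and of [kernel_bound x] twisted by m and sg, so [kernel_mem] provides y. Linearity comes
    from the values. *)
Lemma weighted_composition m (sg : 'rV[R[i]]_2 -> 'rV[R[i]]_2) (r : R) : 0 <= r ->
  (forall z, bidisc z -> bidisc (sg z)) ->
  nonneg_definite (@bidisc R)
    (fun z w => (r ^+ 2)%:C * K z w - m z * K (sg z) (sg w) * Num.conj (m w)) ->
  exists2 W : {linear H -> H},
    forall x z, bidisc z -> ev (W x) z = m z * ev x (sg z) &
    forall x, nr (W x) <= r * nr x.
Proof.
move=> r0 hsg hnn.
have key x : exists y : H, (forall z, bidisc z -> ev y z = m z * ev x (sg z)) /\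
    nr y <= r * nr x.
  have [|y h1 h2] := @kernel_mem (fun z => m z * ev x (sg z)) (r * nr x)
    (mulr_ge0 r0 (nr_ge0 x)); last by exists y.
  have h1 := @nnd_twist _ _ _ _ m sg hsg (kernel_bound x).
  apply: nnd_ext (nnd_lincomb (sqr_ge0 (nr x)) ler01 hnn h1) => z w _ _.
  by rewrite exprMn realcM realc1 rmorphM /=; ring.
have [W hW] := choice key.
have [|L hL] := @linear_of_fun R H W; last first.
  by exists L => x; rewrite hL; have [] := hW x.
move=> a f g; apply: Defs.eval_inj => z hz.
rewrite Defs.eval_linear // !(proj1 (hW _)) // Defs.eval_linear; last exact: hsg.
by ring.
Qed.

Variable f : nat -> 'rV[R[i]]_2 -> R[i].
Hypothesis hf : forall z w, bidisc z -> bidisc w ->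
  sums (fun k => f k z * Num.conj (f k w)) (K z w).

(** With a_k the sum of conj q f_k over the nodes, the form of K is the sum of all |a_k|^2, and
    Cauchy-Schwarz bounds |sum c_k a_k|^2 by the sum of |c_k|^2 times a partial sum of it. *)
Lemma frame_dominated (c : nat -> R[i]) n : nonneg_definite (@bidisc R)
  (fun z w => (\sum_(k < n) modc (c k) ^+ 2)%:C * K z w -
     (\sum_(k < n) c k * f k z) * Num.conj (\sum_(k < n) c k * f k w)).
Proof.
apply/nonneg_definite_kform => s hs.
pose a k := \sum_(q <- s) Num.conj q.1 * f k q.2.
have Klim : cvs (fun N => (\sum_(k < N) modc (a k) ^+ 2)%:C) (kform K s).
  have := kform_lim hs hf; apply: cvs_ext => N.
  rewrite realc_sum /kform.
  under [RHS]eq_bigr => k _ do rewrite -kform_rank1 /kform.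
  rewrite [RHS]exchange_big /=; apply: eq_bigr => q _.
  rewrite [RHS]exchange_big /=; apply: eq_bigr => q' _.
  by rewrite mulr_suml mulr_suml.
set C := \sum_(k < n) modc (c k) ^+ 2.
have C0 : 0 <= C by apply: sumr_ge0 => k _; apply: sqr_ge0.
have -> : kform (fun z w => C%:C * K z w -
     (\sum_(k < n) c k * f k z) * Num.conj (\sum_(k < n) c k * f k w)) s =
  C%:C * kform K s + (-1) * kform (fun z w => (\sum_(k < n) c k * f k z) * Num.conj (\sum_(k < n) c k * f k w)) s.
  by rewrite -kform_lincomb; apply: eq_bigr => q _; apply: eq_bigr => q' _; ring.
rewrite (kform_rank1 (fun z => \sum_(k < n) c k * f k z)).
have -> : \sum_(q <- s) Num.conj q.1 * (\sum_(k < n) c k * f k q.2) = \sum_(k < n) c k * a k.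
  under eq_bigr => q _ do rewrite mulr_sumr.
  rewrite exchange_big /=; apply: eq_bigr => k _; rewrite mulr_sumr.
  by apply: eq_bigr => q _; rewrite mulrCA.
(* [N + n] terms, so that every partial sum contains the first [n]. *)
apply: (cvs_ge0 (u := fun N => C%:C * (\sum_(k < N + n) modc (a k) ^+ 2)%:C +
   -1 * (modc (\sum_(k < n) c k * a k) ^+ 2)%:C)).
  apply: cvsD; last exact: cvs_cst; apply: cvsZ.
  by have := cvs_sub (p := fun N => (N + n)%N) (fun N => leq_addr _ _) Klim.
move=> N; rewrite mulN1r -realcM -realcB ler0c subr_ge0.
apply: (le_trans (modc_sum_cauchy_schwarz _ _ _)); apply: ler_wpM2l => //.
rewrite addnC big_split_ord /= lerDl sumr_ge0 // => k _; exact: sqr_ge0.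
Qed.

(** The synthesis map from square-summable sequences is a contraction. The f_k may repeat, vanish or
    be linearly dependent, so orthonormality is replaced by this inequality. *)
Lemma frame_elements : exists e : nat -> H,
  (forall k z, bidisc z -> ev (e k) z = f k z) /\
  forall (c : nat -> R[i]) n, nr (\sum_(k < n) c k *: e k) ^+ 2 <= \sum_(k < n) modc (c k) ^+ 2.
Proof.
have key (c : nat -> R[i]) n : exists2 h : H,
    forall z, bidisc z -> ev h z = \sum_(k < n) c k * f k z &
    nr h ^+ 2 <= \sum_(k < n) modc (c k) ^+ 2.
  have C0 : 0 <= \sum_(k < n) modc (c k) ^+ 2 by apply: sumr_ge0 => k _; apply: sqr_ge0.
  have [|h h1 h2] := @kernel_mem (fun z => \sum_(k < n) c k * f k z)
    (Num.sqrt (\sum_(k < n) modc (c k) ^+ 2)) (sqrtr_ge0 _).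
    by rewrite sqr_sqrtr //; exact: frame_dominated.
  exists h => //; rewrite -[leRHS]sqr_sqrtr // ler_sqr ?nnegrE ?nr_ge0 ?sqrtr_ge0 //.
have [|e he] := @choice nat H (fun k h => forall z, bidisc z -> ev h z = f k z).
  move=> k; have [h h1 _] := key (fun j => (j == k)%:R) k.+1; exists h => z hz.
  rewrite h1 // big_ord_recr /= eqxx mul1r big1 ?add0r // => j _.
  by rewrite ltn_eqF ?ltn_ord // mul0r.
exists e; split => // c n; have [h h1 h2] := key c n.
suff -> : \sum_(k < n) c k *: e k = h by [].
apply: Defs.eval_inj => z hz; rewrite h1 //.
elim: n {h h1 h2} => [|n IH].
  by rewrite !big_ord0 eval_ip // inner0l.
rewrite !big_ord_recr /= addrC Defs.eval_linear // IH he //.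
by rewrite addrC.
Qed.

Lemma eval_sum (c : nat -> R[i]) (e : nat -> H) n z : bidisc z ->
  ev (\sum_(k < n) c k *: e k) z = \sum_(k < n) c k * ev (e k) z.
Proof.
move=> hz; rewrite eval_ip // inner_suml; apply: eq_bigr => k _.
by rewrite innerZl -eval_ip.
Qed.

Lemma cvh_eval (u : nat -> H) x z : bidisc z -> cvh u x ->
  cvs (fun n => ev (u n) z) (ev x z).
Proof.
move=> hz /(cvh_innerl (kelt z)); rewrite eval_ip //.
by apply: cvs_ext => n; rewrite eval_ip.
Qed.

Section Frame.
Variable e : nat -> H.
Hypothesis he : forall k z, bidisc z -> ev (e k) z = f k z.
Hypothesis hn : forall (c : nat -> R[i]) n,
  nr (\sum_(k < n) c k *: e k) ^+ 2 <= \sum_(k < n) modc (c k) ^+ 2.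

(** For y the sum of <x, e_k> e_k, the sum S of |<x, e_k>|^2 equals <x, y>, hence S <= |x| |y| <=
    |x| S^(1/2). *)
Lemma bessel x n : \sum_(k < n) modc (ip x (e k)) ^+ 2 <= nr x ^+ 2.
Proof.
pose c k := ip x (e k); set S := \sum_(k < n) _.
have S0 : 0 <= S by apply: sumr_ge0 => k _; apply: sqr_ge0.
have eS : ip x (\sum_(k < n) c k *: e k) = S%:C.
  rewrite inner_sumr realc_sum; apply: eq_bigr => k _.
  by rewrite innerZr mulrC mulJc.
have := cauchy_schwarz x (\sum_(k < n) c k *: e k); rewrite eS modcR ger0_norm // => h.
have h2 : S ^+ 2 <= nr x ^+ 2 * S.
  apply: (@le_trans _ _ (nr x ^+ 2 * nr (\sum_(k < n) c k *: e k) ^+ 2)).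
    by rewrite -exprMn ler_sqr ?nnegrE // mulr_ge0 ?nr_ge0.
  by rewrite ler_wpM2l ?sqr_ge0 // hn.
have [S00|Sn0] := eqVneq S 0; first by rewrite S00 sqr_ge0.
by rewrite -(ler_pM2r (x := S)) ?lt_def ?Sn0 // -expr2.
Qed.

Lemma frame_cvh (c : nat -> R[i]) (B : R) : (forall n, \sum_(k < n) modc (c k) ^+ 2 <= B) ->
  exists x, cvh (fun n => \sum_(k < n) c k *: e k) x.
Proof.
move=> hB; apply: cauchy_cvh => d d0.
have d2 : 0 < d ^+ 2 by rewrite exprn_gt0.
have [N hN] := tail_small (fun k => sqr_ge0 (modc (c k))) hB d2.
exists N.
have key (m n : nat) : (N <= n)%N -> (n <= m)%N ->
    nr (\sum_(k < m) c k *: e k - \sum_(k < n) c k *: e k) <= d.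
  move=> Nn nm; rewrite -(@ler_sqr R) ?nnegrE ?nr_ge0 ?(ltW d0) //.
  apply: le_trans (hN n m Nn).
  pose c' k := if (n <= k)%N then c k else 0.
  have -> : \sum_(k < m) c k *: e k - \sum_(k < n) c k *: e k = \sum_(k < m) c' k *: e k.
    rewrite -!(big_mkord xpredT (fun k => c k *: e k)) -(big_mkord xpredT (fun k => c' k *: e k)).
    rewrite [in LHS](big_cat_nat (n := n)) //=.
    rewrite [RHS](big_cat_nat (n := n)) //= addrAC subrr add0r.
    have -> : \sum_(0 <= k < n) c' k *: e k = 0.
      rewrite big_nat; apply: big1 => k /andP[_ kn].
      by rewrite /c' leqNgt kn scale0r.
    by rewrite add0r; apply: eq_big_nat => k /andP[nk _]; rewrite /c' nk.
  apply: (le_trans (hn c' m)).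
  rewrite -(big_mkord xpredT (fun k => modc (c' k) ^+ 2)) (big_cat_nat (n := n)) //=.
  have -> : \sum_(0 <= k < n) modc (c' k) ^+ 2 = 0.
    rewrite big_nat; apply: big1 => k /andP[_ kn].
    by rewrite /c' leqNgt kn modc0 expr0n.
  by rewrite add0r; apply: ler_sum_nat => k /andP[nk _]; rewrite /c' nk.
move=> m n Nm Nn; have [nm|/ltnW nm] := leqP n m; first exact: key.
by rewrite nrBC key.
Qed.

Lemma frame_kelt w : bidisc w -> cvh (fun n => \sum_(k < n) Num.conj (f k w) *: e k) (kelt w).
Proof.
move=> hw; have [|x hx] := @frame_cvh (fun k => Num.conj (f k w)) (nr (kelt w) ^+ 2).
  move=> n; apply: le_trans (bessel (kelt w) n); apply: ler_sum => k _.
  by rewrite ip_kelt // he.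
suff -> : kelt w = x by [].
apply: Defs.eval_inj => z hz; rewrite eval_kelt //.
apply: (cvs_uniq (hf hz hw)); apply: cvs_ext (cvh_eval hz hx) => n.
by rewrite (eval_sum (fun k => Num.conj (f k w))) //; apply: eq_bigr => k _; rewrite he // mulrC.
Qed.

Lemma frame_eval x w : bidisc w -> sums (fun k => ip x (e k) * f k w) (ev x w).
Proof.
move=> hw; rewrite eval_ip //; apply: cvs_ext (cvh_inner x (frame_kelt hw)) => n.
by rewrite inner_sumr; apply: eq_bigr => k _; rewrite innerZr conjCK mulrC.
Qed.

(** The series converges by Bessel's inequality, and its limit has the same values as [x] by
    [frame_eval]. *)
Lemma frame_expansion x : cvh (fun n => \sum_(k < n) ip x (e k) *: e k) x.
Proof.
have [y hy] := @frame_cvh (fun k => ip x (e k)) _ (bessel x).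
suff E : x = y by rewrite [X in cvh _ X]E.
apply: Defs.eval_inj => z hz; apply: (cvs_uniq (frame_eval x hz)).
apply: cvs_ext (cvh_eval hz hy) => n; rewrite (eval_sum (fun k => ip x (e k))) //.
by apply: eq_bigr => k _; rewrite he.
Qed.

End Frame.

End ReproducingKernelSpace.

(** * Polynomials in two variables and kernels that are sums of squares of polynomials *)

Section MonomialSums.
Variable R : realType.
Local Notation V := 'rV[R[i]]_2.
Implicit Types (z w h : V) (x y t rho : R).

(* The monomial (c, (j, k)) is c z_1^j z_2^k. Polynomials are lists, without
   collecting terms, so that majorants of products are products of majorants. *)
Definition mono := (R[i] * (nat * nat))%type.
Definition mpol := seq mono.
Implicit Types (p q : mpol) (F G : seq mpol).

Definition mev p z : R[i] :=
  \sum_(a <- p) a.1 * (z 0 0 ^+ a.2.1 * z 0 1 ^+ a.2.2).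
Definition mmaj p x : R := \sum_(a <- p) modc a.1 * x ^+ (a.2.1 + a.2.2).
Definition mmul p q : mpol :=
  [seq (a.1 * b.1, ((a.2.1 + b.2.1)%N, (a.2.2 + b.2.2)%N)) | a <- p, b <- q].
Definition mscale (c : R[i]) p : mpol := [seq (c * a.1, a.2) | a <- p].

Lemma bidiscP z : bidisc z <-> forall i, modc (z 0 i) < 1.
Proof. by split=> h i; have := h i; rewrite normE -realc1 ltcR. Qed.

Lemma mev_mul p q z : mev (mmul p q) z = mev p z * mev q z.
Proof.
rewrite /mev /mmul big_allpairs_dep big_distrlr /=; apply: eq_bigr => a _.
by apply: eq_bigr => b _; rewrite !exprD; ring.
Qed.

Lemma mmaj_mul p q x : mmaj (mmul p q) x = mmaj p x * mmaj q x.
Proof.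
rewrite /mmaj /mmul big_allpairs_dep big_distrlr /=; apply: eq_bigr => a _.
by apply: eq_bigr => b _; rewrite modcM addnACA exprD; ring.
Qed.

Lemma mev_scale c p z : mev (mscale c p) z = c * mev p z.
Proof. by rewrite /mev big_map mulr_sumr; apply: eq_bigr => a _ /=; rewrite -mulrA. Qed.

Lemma mmaj_scale c p x : mmaj (mscale c p) x = modc c * mmaj p x.
Proof.
by rewrite /mmaj big_map mulr_sumr; apply: eq_bigr => a _; rewrite modcM mulrA.
Qed.

Lemma mmaj_ge0 p x : 0 <= x -> 0 <= mmaj p x.
Proof. by move=> x0; apply: sumr_ge0 => a _; rewrite mulr_ge0 ?exprn_ge0. Qed.

Lemma mev_le p z x : (forall i, modc (z 0 i) <= x) -> modc (mev p z) <= mmaj p x.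
Proof.
move=> hz; have x0 : 0 <= x by apply: le_trans (hz 0).
apply: (le_trans (modc_sum _ _ _)); apply: ler_sum => a _.
rewrite !modcM !modcX exprD ler_wpM2l //.
by apply: ler_pM; rewrite ?exprn_ge0 // lerXn2r // nnegrE.
Qed.

Lemma mev_taylor p z x rho : (forall i, modc (z 0 i) <= x) -> 0 <= rho ->
  exists d1 d2 : R[i], forall (h1 h2 : R[i]) t, 0 <= t <= 1 ->
    modc h1 <= t * rho -> modc h2 <= t * rho -> forall w,
    w 0 0 = z 0 0 + h1 -> w 0 1 = z 0 1 + h2 ->
    taylor_bound (mmaj p (x + rho)) t (mev p z) (mev p w) (d1 * h1 + d2 * h2).
Proof.
move=> hz rho0; have x0 : 0 <= x by apply: le_trans (hz 0).
have mon j k : exists d1 d2 : R[i], forall (h1 h2 : R[i]) t, 0 <= t <= 1 ->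
    modc h1 <= t * rho -> modc h2 <= t * rho ->
    taylor_bound ((x + rho) ^+ (j + k)) t (z 0 0 ^+ j * z 0 1 ^+ k)
      ((z 0 0 + h1) ^+ j * (z 0 1 + h2) ^+ k) (d1 * h1 + d2 * h2).
  elim: j => [|j [d1 [d2 IH]]].
    exists 0, (k%:R * z 0 1 ^+ k.-1) => h1 h2 t t01 _ ht.
    rewrite !expr0 !mul1r mul0r add0r add0n.
    exact: taylor_bound_X.
  exists (z 0 0 * d1 + z 0 0 ^+ j * z 0 1 ^+ k), (z 0 0 * d2) => h1 h2 t t01 k1 k2.
  have := taylor_bound_mul t01 rho0 (hz 0) k1 (IH h1 h2 t t01 k1 k2).
  rewrite addSn !exprS !mulrA; congr taylor_bound; ring.
elim: p => [|[c [j k]] p [d1 [d2 IH]]].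
  exists 0, 0 => h1 h2 t /andP[t0 t1] _ _ w _ _.
  rewrite /mmaj /mev !big_nil !mul0r addr0; split; rewrite ?subrr ?subr0 ?modc0 ?mulr0 //.
have [e1 [e2 M]] := mon j k.
exists (c * e1 + d1), (c * e2 + d2) => h1 h2 t t01 k1 k2 w w1 w2.
have [M1 M2 M3] := M h1 h2 t t01 k1 k2; have [I1 I2 I3] := IH h1 h2 t t01 k1 k2 w w1 w2.
rewrite /mmaj /mev !big_cons /= -/(mmaj p _) -/(mev p z) -/(mev p w) w1 w2.
split.
- apply: (le_trans (modcD _ _)); apply: lerD => //.
  by rewrite modcM ler_wpM2l.
- set A := _ * (_ ^+ j * _) in M1 M2 M3 *; rewrite opprD addrACA.
  apply: (le_trans (modcD _ _)); rewrite [leRHS]mulrDr; apply: lerD => //.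
  by rewrite -mulrBr modcM mulrCA ler_wpM2l.
- have -> : forall a b a' b' : R[i], c * a + b - (c * a' + b') - ((c * e1 + d1) * h1 + (c * e2 + d2) * h2) =
      c * (a - a' - (e1 * h1 + e2 * h2)) + (b - b' - (d1 * h1 + d2 * h2)) by move=> *; ring.
  apply: (le_trans (modcD _ _)); rewrite [leRHS]mulrDr; apply: lerD => //.
  by rewrite modcM mulrCA ler_wpM2l.
Qed.

(** A list of polynomials stands for the kernel sum of p(z) conj p(w). Concatenation, [bmul] and
    [bscale] realize sums, products and nonnegative multiples, with the majorants [bmaj] following
    the same rules. *)
Definition bker F z w : R[i] := \sum_(p <- F) mev p z * Num.conj (mev p w).
Definition bmaj F x : R := \sum_(p <- F) mmaj p x ^+ 2.
Definition bmul F G : seq mpol := [seq mmul p q | p <- F, q <- G].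
Definition bscale (c : R) F : seq mpol := [seq mscale (Num.sqrt c)%:C p | p <- F].

Lemma bker_mul F G z w : bker (bmul F G) z w = bker F z w * bker G z w.
Proof.
rewrite /bker /bmul big_allpairs_dep big_distrlr /=; apply: eq_bigr => p _.
by apply: eq_bigr => q _; rewrite !mev_mul rmorphM /=; ring.
Qed.

Lemma bmaj_mul F G x : bmaj (bmul F G) x = bmaj F x * bmaj G x.
Proof.
rewrite /bmaj /bmul big_allpairs_dep big_distrlr /=; apply: eq_bigr => p _.
by apply: eq_bigr => q _; rewrite mmaj_mul exprMn.
Qed.

Lemma bker_scale c F z w : 0 <= c -> bker (bscale c F) z w = c%:C * bker F z w.
Proof.
move=> c0; rewrite /bker big_map mulr_sumr; apply: eq_bigr => p _.
rewrite !mev_scale rmorphM /= conjR mulrACA -realcM -expr2 sqr_sqrtr //.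
Qed.

Lemma bmaj_scale c F x : 0 <= c -> bmaj (bscale c F) x = c * bmaj F x.
Proof.
move=> c0; rewrite /bmaj big_map mulr_sumr; apply: eq_bigr => p _.
by rewrite mmaj_scale exprMn modcR ger0_norm ?sqrtr_ge0 // sqr_sqrtr.
Qed.

Lemma bmaj_ge0 F x : 0 <= bmaj F x.
Proof. by apply: sumr_ge0 => p _; apply: sqr_ge0. Qed.

Lemma bker_flatten (Fs : seq (seq mpol)) z w :
  bker (flatten Fs) z w = \sum_(F <- Fs) bker F z w.
Proof. by rewrite /bker big_flatten. Qed.

Lemma bmaj_flatten (Fs : seq (seq mpol)) x :
  bmaj (flatten Fs) x = \sum_(F <- Fs) bmaj F x.
Proof. by rewrite /bmaj big_flatten. Qed.

Lemma bker_le F z w x : (forall i, modc (z 0 i) <= x) -> (forall i, modc (w 0 i) <= x) ->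
  modc (bker F z w) <= bmaj F x.
Proof.
move=> hz hw; apply: (le_trans (modc_sum _ _ _)); apply: ler_sum => p _.
by rewrite modcM modcJ expr2; apply: ler_pM => //; apply: mev_le.
Qed.

Definition gmul (F G : nat -> seq mpol) n : seq mpol :=
  flatten [seq bmul (F k) (G (n - k)%N) | k <- iota 0 n.+1].

Lemma bker_gmul (F G : nat -> seq mpol) n z w :
  bker (gmul F G n) z w = \sum_(k < n.+1) bker (F k) z w * bker (G (n - k)%N) z w.
Proof.
rewrite bker_flatten big_map -(big_mkord xpredT (fun k => bker (F k) z w * bker (G (n - k)%N) z w)).
rewrite /index_iota subn0; by apply: eq_bigr => k _; rewrite bker_mul.
Qed.

Lemma bmaj_gmul (F G : nat -> seq mpol) n x :
  bmaj (gmul F G n) x = \sum_(k < n.+1) bmaj (F k) x * bmaj (G (n - k)%N) x.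
Proof.
rewrite bmaj_flatten big_map -(big_mkord xpredT (fun k => bmaj (F k) x * bmaj (G (n - k)%N) x)).
rewrite /index_iota subn0; by apply: eq_bigr => k _; rewrite bmaj_mul.
Qed.

Definition mone : mpol := [:: (1, (0%N, 0%N))].

Lemma mev_one z : mev mone z = 1.
Proof. by rewrite /mev big_seq1 /= !expr0 !mulr1. Qed.

(** One step of (n+1) E_(n+1) = sum of L_k E_(n-k). It involves only sums, products and a positive
    factor, so the exponential of a sum of squares stays a sum of squares. *)
Definition gstep (L : nat -> seq mpol) (E : nat -> seq mpol) n : seq mpol :=
  bscale n.+1%:R^-1 (gmul L E n).

Lemma gexp_exists (L : nat -> seq mpol) : exists E : nat -> seq mpol,
  E 0%N = [:: mone] /\ forall n, E n.+1 = gstep L E n.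
Proof.
(* Course-of-values recursion, through the list of the terms already built. *)
pose l := fix l n : seq (seq mpol) := if n is m.+1 then
  rcons (l m) (gstep L (fun k => nth [::] (l m) k) m) else [:: [:: mone]].
have lS n : l n.+1 = rcons (l n) (gstep L (fun k => nth [::] (l n) k) n) by [].
have sl n : size (l n) = n.+1 by elim: n => // n IH; rewrite lS size_rcons IH.
pose E n := nth [::] (l n) n.
have lE n k : (k <= n)%N -> nth [::] (l n) k = E k.
  elim: n => [|n IH]; first by rewrite leqn0 => /eqP ->.
  rewrite leq_eqVlt => /orP[/eqP -> //|kn].
  by rewrite lS nth_rcons sl kn IH.
exists E; split => // n; rewrite /E lS nth_rcons sl ltnn eqxx.
rewrite /gstep /gmul; congr bscale; congr flatten; apply/eq_in_map => k.
by rewrite mem_iota => /andP[_ kn]; rewrite lE // leq_subr.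
Qed.

Lemma gstep_bker L E n z w :
  n.+1%:R * bker (gstep L E n) z w = \sum_(k < n.+1) bker (L k) z w * bker (E (n - k)%N) z w.
Proof.
rewrite bker_scale ?invr_ge0 // realcV realc_nat mulrA divff ?pnatr_eq0 // mul1r.
exact: bker_gmul.
Qed.

Lemma gexp_bmaj (L E : nat -> seq mpol) kappa rho x : 0 <= kappa -> 0 <= rho ->
  E 0%N = [:: mone] -> (forall n, E n.+1 = gstep L E n) ->
  (forall k, bmaj (L k) x <= kappa * rho ^+ k.+1) ->
  forall n, bmaj (E n) x <= rising kappa rho n.
Proof.
move=> k0 r0 E0 ES hL; elim/ltn_ind => -[|n] IH.
  by rewrite E0 /bmaj big_seq1 /mmaj big_seq1 /= modc1 expr0 mulr1 expr1n.
rewrite -(ler_pM2l (x := n.+1%:R)) ?ltr0n // risingS ES bmaj_scale ?invr_ge0 //.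
rewrite mulrA divff ?pnatr_eq0 // mul1r bmaj_gmul; apply: ler_sum => k _.
by apply: ler_pM => //; rewrite ?bmaj_ge0 //; apply: IH; rewrite ltnS leq_subr.
Qed.

(** The blocks give convergence only along the block ends; the majorants make the flattened series
    absolutely convergent, which identifies its sum. *)
Lemma flatten_blocks (F : nat -> seq mpol) : exists f : nat -> mpol,
  [/\ forall x B, (forall n, \sum_(k < n) bmaj (F k) x <= B) ->
        forall n, \sum_(k < n) mmaj (f k) x ^+ 2 <= B,
      forall z w x B l, (forall i, modc (z 0 i) <= x) -> (forall i, modc (w 0 i) <= x) ->
        (forall n, \sum_(k < n) bmaj (F k) x <= B) -> sums (fun n => bker (F n) z w) l ->
        sums (fun k => mev (f k) z * Num.conj (mev (f k) w)) l &
      forall n p, p \in F n -> exists k, f k = p].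
Proof.
(* Each block is preceded by the empty polynomial, whose value is 0: [N] blocks then have at least
   [N] entries even if blocks are empty. *)
pose pre N := flatten [seq [::] :: F n | n <- iota 0 N].
have preD N M : pre (N + M)%N = pre N ++ flatten [seq [::] :: F n | n <- iota N M].
  by rewrite /pre iotaD map_cat flatten_cat.
have preS N : pre N.+1 = pre N ++ ([::] :: F N).
  by rewrite -addn1 preD /= cats0.
have sz N : (N <= size (pre N))%N.
  by elim: N => // N IH; rewrite preS size_cat /= addnS ltnS (leq_trans IH) // leq_addr.
pose f k := nth [::] (pre k.+1) k.
have fE N k : (k < size (pre N))%N -> f k = nth [::] (pre N) k.
  move=> kN; rewrite /f; have [h|/ltnW h] := leqP N k.+1.
    by rewrite -(subnKC h) preD nth_cat kN.
  by rewrite -(subnKC h) preD nth_cat (leq_trans _ (sz _)).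
have sumE (A : zmodType) (phi : mpol -> A) N : phi [::] = 0 ->
    \sum_(k < size (pre N)) phi (f k) = \sum_(n < N) \sum_(p <- F n) phi p.
  move=> phi0; have -> : \sum_(k < size (pre N)) phi (f k) = \sum_(p <- pre N) phi p.
    by rewrite (big_nth [::]) big_mkord; apply: eq_bigr => k _; rewrite (fE N).
  elim: N => [|N IH]; first by rewrite big_nil big_ord0.
  by rewrite preS big_cat /= IH big_cons phi0 add0r big_ord_recr.
have nil0 z : mev [::] z = 0 by rewrite /mev big_nil.
have majB x B : (forall n, \sum_(k < n) bmaj (F k) x <= B) ->
    forall n, \sum_(k < n) mmaj (f k) x ^+ 2 <= B.
  move=> hB n; apply: le_trans (hB n).
  rewrite /bmaj -(sumE _ (fun p => mmaj p x ^+ 2)); last by rewrite /mmaj big_nil expr0n.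
  rewrite -(subnKC (sz n)) big_split_ord /= lerDl sumr_ge0 // => k _; exact: sqr_ge0.
exists f; split => //.
- move=> z w x B l hz hw hB hl.
  have [||l' hl' _] := @abs_sums R (fun k => mev (f k) z * Num.conj (mev (f k) w))
    (fun k => mmaj (f k) x ^+ 2) B; first last.
  + suff -> : l = l' by [].
    apply: (cvs_uniq hl); apply: cvs_ext (cvs_sub sz hl') => N.
    by rewrite (sumE _ (fun p => mev p z * Num.conj (mev p w))) ?nil0 ?mul0r.
  + exact: majB.
  + by move=> k; rewrite modcM modcJ expr2; apply: ler_pM => //; apply: mev_le.
- move=> n p pF; have pp : p \in pre n.+1 by rewrite preS mem_cat inE pF !orbT.
  by exists (index p (pre n.+1)); rewrite (fE n.+1) ?index_mem // nth_index.
Qed.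

Lemma cauchy_product_le (a b : nat -> R) n : (forall k, 0 <= a k) -> (forall k, 0 <= b k) ->
  \sum_(m < n) \sum_(k < m.+1) a k * b (m - k)%N <= (\sum_(k < n) a k) * (\sum_(k < n) b k).
Proof.
move=> a0 b0.
have -> : \sum_(m < n) \sum_(k < m.+1) a k * b (m - k)%N =
    \sum_(k < n) \sum_(j < n - k) a k * b j.
  elim: n => [|n IH]; first by rewrite !big_ord0.
  rewrite big_ord_recr /= IH [in RHS]big_ord_recr /= subSnn big_ord1.
  rewrite [X in _ = X + _](eq_bigr (fun k : 'I_n => \sum_(j < n - k) a k * b j + a k * b (n - k)%N)).
    by rewrite big_split /= big_ord_recr /= subnn addrA.
  by move=> k _; rewrite subSn ?(ltnW (ltn_ord _)) // big_ord_recr.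
rewrite mulr_suml; apply: ler_sum => k _; rewrite -mulr_sumr ler_wpM2l //.
rewrite -[in leRHS](subnK (ltnW (ltn_ord k))) big_split_ord /= lerDl.
exact: sumr_ge0.
Qed.

End MonomialSums.

(** * The determinant kernel as a sum of squares of polynomials *)

Section Kernel.
Variable R : realType.
Local Notation V := 'rV[R[i]]_2.
Implicit Types (z w : V) (x lam mu c del g : R).

Definition logA z w : R[i] := LogC (one_sub z w 0 0).
Definition logB z w : R[i] := LogC (one_sub z w 1 1).
Definition logCD z w : R[i] := LogC (one_sub z w 0 1) + LogC (one_sub z w 1 0).
Definition inv2 z w i j : R[i] := (one_sub z w i j) ^- 2.

(* With A, B, C, D = 1 - z_1 \bar w_1, 1 - z_2 \bar w_2, 1 - z_1 \bar w_2,
   1 - z_2 \bar w_1 this is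
     A^(-lam) B^(-mu) (CD/AB)^c (del (AB)^(-2) + g ((AB)^(-2) - (CD)^(-2))),
   and the determinant of the paper is the case lam = 2 eta (alpha - gamma),
   mu = 2 eta (beta - gamma), c = 2 eta gamma, del = alpha beta - gamma^2,
   g = gamma^2. *)
Definition detker lam mu c del g z w : R[i] :=
  expC (- (lam%:C * logA z w) - mu%:C * logB z w -
        c%:C * (logA z w + logB z w - logCD z w)) *
  (del%:C * (inv2 z w 0 0 * inv2 z w 1 1) +
   g%:C * (inv2 z w 0 0 * inv2 z w 1 1 - inv2 z w 0 1 * inv2 z w 1 0)).

Lemma modc_node z w i j : bidisc z -> bidisc w -> modc (z 0 i * Num.conj (w 0 j)) < 1.
Proof.
move=> /bidiscP hz /bidiscP hw; rewrite modcM modcJ.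
by apply: le_lt_trans (hw j); rewrite -[leRHS]mul1r ler_wpM2r // ltW.
Qed.

Lemma bidisc_radius z w : bidisc z -> bidisc w -> exists x : R,
  [/\ 0 <= x < 1, forall i, modc (z 0 i) <= x & forall i, modc (w 0 i) <= x].
Proof.
move=> /bidiscP hz /bidiscP hw.
exists (Num.max (Num.max (modc (z 0 0)) (modc (z 0 1))) (Num.max (modc (w 0 0)) (modc (w 0 1)))).
have two (i : 'I_2) : i = 0 \/ i = 1.
  by case: i => [[|[|//]] hi]; [left|right]; apply: val_inj.
split; first by rewrite !gt_max !hz !hw !le_max modc_ge0.
- by move=> i; case: (two i) => ->; rewrite !le_max lexx ?orbT.
- by move=> i; case: (two i) => ->; rewrite !le_max lexx ?orbT.
Qed.

Definition monom (a : R[i]) j k : mpol R := [:: (a, (j, k))].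

(** k + 1 times the part of the exponent - lam log A - mu log B + c log (CD / AB) of degree k + 1 in
    z; [graded_exp] expects the coefficients of the derivative, without the denominators. *)
Definition logblock lam mu c k : seq (mpol R) :=
  bscale lam [:: monom 1 k.+1 0] ++ bscale mu [:: monom 1 0 k.+1] ++
  bscale c [:: monom 1 k.+1 0 ++ monom (-1) 0 k.+1].

Lemma bker_cat (F G : seq (mpol R)) z w : bker (F ++ G) z w = bker F z w + bker G z w.
Proof. by rewrite /bker big_cat. Qed.

Lemma bmaj_cat (F G : seq (mpol R)) x : bmaj (F ++ G) x = bmaj F x + bmaj G x.
Proof. by rewrite /bmaj big_cat. Qed.

Lemma bker1 (p : mpol R) z w : bker [:: p] z w = mev p z * Num.conj (mev p w).
Proof. by rewrite /bker big_seq1. Qed.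

Lemma bmaj1 (p : mpol R) x : bmaj [:: p] x = mmaj p x ^+ 2.
Proof. by rewrite /bmaj big_seq1. Qed.

Lemma bker_logblock lam mu c k z w : 0 <= lam -> 0 <= mu -> 0 <= c ->
  bker (logblock lam mu c k) z w =
  lam%:C * (z 0 0 * Num.conj (w 0 0)) ^+ k.+1 + mu%:C * (z 0 1 * Num.conj (w 0 1)) ^+ k.+1 +
  c%:C * ((z 0 0 * Num.conj (w 0 0)) ^+ k.+1 + (z 0 1 * Num.conj (w 0 1)) ^+ k.+1 -
    (z 0 0 * Num.conj (w 0 1)) ^+ k.+1 - (z 0 1 * Num.conj (w 0 0)) ^+ k.+1).
Proof.
move=> l0 m0 c0; rewrite !bker_cat !bker_scale // !bker1 /mev /monom /=.
rewrite !big_cons !big_nil /= !expr0 !rmorphD /= !rmorphM /= !rmorphXn /= ?rmorphN /= !rmorph1 !rmorph0.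
by rewrite !exprMn; ring.
Qed.

Lemma bmaj_logblock lam mu c k x : 0 <= lam -> 0 <= mu -> 0 <= c -> 0 <= x ->
  bmaj (logblock lam mu c k) x = (lam + mu + 4 * c) * (x ^+ 2) ^+ k.+1.
Proof.
move=> l0 m0 c0 x0; rewrite !bmaj_cat !bmaj_scale // !bmaj1 /mmaj /monom /=.
rewrite !big_cons !big_nil /= modcN modc1 !addn0 !add0n -exprM mulnC exprM; ring.
Qed.

Lemma exp_frame lam mu c : 0 <= lam -> 0 <= mu -> 0 <= c ->
  exists E : nat -> seq (mpol R),
  [/\ E 0%N = [:: mone R],
     forall x, 0 <= x < 1 -> exists B : R, forall n, \sum_(k < n) bmaj (E k) x <= B &
     forall z w, bidisc z -> bidisc w -> sums (fun n => bker (E n) z w)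
       (expC (- (lam%:C * logA z w) - mu%:C * logB z w -
          c%:C * (logA z w + logB z w - logCD z w)))].
Proof.
move=> l0 m0 c0; have [E [E0 ES]] := gexp_exists (logblock lam mu c).
have kap0 : 0 <= lam + mu + 4 * c by rewrite !addr_ge0 // mulr_ge0.
exists E; split => //.
- move=> x /andP[x0 x1].
  have x2 : 0 <= x ^+ 2 by exact: sqr_ge0.
  have [|B hB] := @rising_bounded R (lam + mu + 4 * c) (x ^+ 2) 1 kap0 x2 ler01.
    by rewrite mulr1 expr_lt1.
  exists B => n; apply: le_trans (hB n); apply: ler_sum => k _.
  rewrite expr1n mulr1; apply: (gexp_bmaj kap0 x2 E0 ES) => j.
  by rewrite bmaj_logblock.
- move=> z w hz hw; have [x [/andP[x0 x1] zx wx]] := bidisc_radius hz hw.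
  have x2 : 0 <= x ^+ 2 < 1 by rewrite sqr_ge0 expr_lt1.
  have [|||l hl he] := @graded_exp R (fun k => bker (logblock lam mu c k) z w)
     (fun n => bker (E n) z w) _ _ kap0 x2.
  + by move=> k; rewrite -bmaj_logblock //; apply: bker_le.
  + by rewrite E0 bker1 !mev_one rmorph1 mulr1.
  + by move=> n; rewrite ES gstep_bker.
  congr (sums _ (expC _)) : he; apply: (sums_uniq hl).
  have ls i j := log_series (modc_node i j hz hw).
  have := sumsD (sumsD (sumsZ lam%:C (ls 0 0)) (sumsZ mu%:C (ls 1 1)))
    (sumsZ c%:C (sumsB (sumsB (sumsD (ls 0 0) (ls 1 1)) (ls 0 1)) (ls 1 0))).
  rewrite -!/(one_sub _ _ _ _) -/(logA z w) -/(logB z w) => h.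
  have -> : - (lam%:C * logA z w) - mu%:C * logB z w -
      c%:C * (logA z w + logB z w - logCD z w) =
    lam%:C * - logA z w + mu%:C * - logB z w +
     c%:C * (- logA z w + - logB z w - - LogC (one_sub z w 0 1) - - LogC (one_sub z w 1 0)).
    by rewrite /logCD; ring.
  apply: sums_ext h => k; rewrite bker_logblock //.
  by rewrite !mulrDl -!mulrA; congr (_ + _); congr (_ * _); rewrite !mulrBl !mulrDl.
Qed.

Lemma rising2 n : rising 2 1 n = n.+1%:R :> R.
Proof.
elim: n => [|n IH] //=; rewrite IH mul1r divfK ?pnatr_eq0 //.
by rewrite -natrD add2n.
Qed.

Lemma powC_inv2 (u : R[i]) : 0 < complex.Re u -> powC u (- 2) = u ^- 2.
Proof.
move=> u0; rewrite /powC realcN mulNr expCN; congr (_^-1).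
by rewrite -[X in expC (X * _)]/((2%:R : R)%:C) realc_nat expC_nat expC_LogC.
Qed.

Lemma inverse_square_series (u : R[i]) : modc u < 1 ->
  sums (fun k => k.+1%:R * u ^+ k) ((1 - u) ^- 2).
Proof.
move=> u1; have h := binomial_series (ler0n R 2) u1.
rewrite -powC_inv2 ?Re_1sub //; apply: sums_ext h => k.
by rewrite rising2 realc_nat.
Qed.

(** The weights (j + 1)(k + 1) come from (1 - u)^-2 (1 - v)^-2. The factor 1/2 on [g] compensates
    that (j, k) and (k, j) give the same antisymmetric polynomial up to sign. *)
Definition brpair del g j k : seq (mpol R) :=
  bscale (del * (j.+1%:R * k.+1%:R)) [:: monom 1 j k] ++
  bscale (g / 2 * (j.+1%:R * k.+1%:R)) [:: monom 1 j k ++ monom (-1) k j].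
Local Arguments brpair : simpl never.

Definition brblock del g n : seq (mpol R) :=
  flatten [seq brpair del g i (n - i) | i <- iota 0 n.+1].

Lemma sum_iota (A : zmodType) (F : nat -> A) n : \sum_(i <- iota 0 n) F i = \sum_(i < n) F i.
Proof. by rewrite -(big_mkord xpredT F) /index_iota subn0. Qed.

Lemma bker_brblock del g n z w : 0 <= del -> 0 <= g ->
  bker (brblock del g n) z w = let s i j k := k.+1%:R * (z 0 i * Num.conj (w 0 j)) ^+ k in
  del%:C * (\sum_(k < n.+1) s 0 0 k * s 1 1 (n - k)%N) +
  g%:C / 2 * (\sum_(k < n.+1) s 0 0 k * s 1 1 (n - k)%N +
    \sum_(k < n.+1) s 1 1 k * s 0 0 (n - k)%N -
    \sum_(k < n.+1) s 0 1 k * s 1 0 (n - k)%N - \sum_(k < n.+1) s 1 0 k * s 0 1 (n - k)%N).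
Proof.
move=> d0 g0 /=; rewrite bker_flatten big_map sum_iota.
rewrite -big_split -!sumrB /= !mulr_sumr -big_split /=; apply: eq_bigr => i _.
rewrite /brpair bker_cat !bker_scale ?mulr_ge0 ?invr_ge0 // !bker1 /mev /monom /=.
rewrite !big_cons !big_nil /= !rmorphD /= !rmorphM /= !rmorphXn /= ?rmorphN /= !rmorph1 !rmorph0.
rewrite !exprMn realcV !realc_nat; move: (i.+1%:R) ((n - i)%N.+1%:R) => a b; by field.
Qed.

Lemma bmaj_brblock del g n x : 0 <= del -> 0 <= g -> 0 <= x ->
  bmaj (brblock del g n) x = (del + 2 * g) *
    \sum_(k < n.+1) (k.+1%:R * (x ^+ 2) ^+ k) * ((n - k).+1%:R * (x ^+ 2) ^+ (n - k)).
Proof.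
move=> d0 g0 x0; rewrite bmaj_flatten big_map sum_iota mulr_sumr; apply: eq_bigr => i _.
rewrite /brpair bmaj_cat !bmaj_scale ?mulr_ge0 ?invr_ge0 // !bmaj1 /mmaj /monom /=.
rewrite !big_cons !big_nil /= modcN modc1 [(n - i + i)%N]addnC !exprD.
move: (i.+1%:R) ((n - i)%N.+1%:R) => a b; rewrite -!exprM ![(2 * _)%N]mulnC !exprM; by field.
Qed.

Lemma inverse_square_bounded x : 0 <= x < 1 ->
  exists B : R, forall n, \sum_(k < n) (k.+1%:R * (x ^+ 2) ^+ k) <= B.
Proof.
move=> /andP[x0 x1]; have [||B hB] := @rising_bounded R 2 1 (x ^+ 2) (ler0n _ 2) ler01.
- exact: sqr_ge0.
- by rewrite mul1r expr_lt1.
by exists B => n; apply: le_trans (hB n); apply: ler_sum => k _; rewrite rising2.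
Qed.

Lemma br_frame del g : 0 <= del -> 0 <= g ->
  (forall x, 0 <= x < 1 -> exists B : R, forall n, \sum_(k < n) bmaj (brblock del g k) x <= B) /\
  (forall z w, bidisc z -> bidisc w -> sums (fun n => bker (brblock del g n) z w)
     (del%:C * (inv2 z w 0 0 * inv2 z w 1 1) +
      g%:C * (inv2 z w 0 0 * inv2 z w 1 1 - inv2 z w 0 1 * inv2 z w 1 0))).
Proof.
move=> d0 g0; split.
- move=> x hx; have /andP[x0 x1] := hx; have [B hB] := inverse_square_bounded hx.
  exists ((del + 2 * g) * (B * B)) => n.
  under eq_bigr => k _ do rewrite bmaj_brblock //.
  rewrite -mulr_sumr; apply: ler_wpM2l; first by rewrite addr_ge0 // mulr_ge0.
  have p0 k : 0 <= k.+1%:R * (x ^+ 2) ^+ k by rewrite mulr_ge0 // exprn_ge0 // sqr_ge0.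
  apply: (le_trans (cauchy_product_le n p0 p0)).
  by apply: ler_pM; rewrite ?sumr_ge0.
- move=> z w hz hw; have [x [hx zx wx]] := bidisc_radius hz hw.
  have [B hB] := inverse_square_bounded hx.
  have ss i j := inverse_square_series (modc_node i j hz hw).
  have sb i j k : modc (k.+1%:R * (z 0 i * Num.conj (w 0 j)) ^+ k) <= k.+1%:R * (x ^+ 2) ^+ k.
    rewrite modcM modc_nat modcX ler_wpM2l // lerXn2r // ?nnegrE ?sqr_ge0 //.
    by rewrite modcM modcJ expr2; apply: ler_pM.
  have cp i j i' j' := sums_cauchy_product (sb i j) hB (sb i' j') hB (ss i j) (ss i' j').
  have := sumsD (sumsZ del%:C (cp 0 0 1 1)) (sumsZ (g%:C / 2)
    (sumsB (sumsB (sumsD (cp 0 0 1 1) (cp 1 1 0 0)) (cp 0 1 1 0)) (cp 1 0 0 1))).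
  rewrite -!/(one_sub _ _ _ _) -!/(inv2 _ _ _ _).
  set l := (X in sums _ X -> _) => h.
  have -> : del%:C * (inv2 z w 0 0 * inv2 z w 1 1) +
      g%:C * (inv2 z w 0 0 * inv2 z w 1 1 - inv2 z w 0 1 * inv2 z w 1 0) = l.
    by rewrite /l; field.
  by apply: sums_ext h => n; rewrite bker_brblock.
Qed.

(** The constant in the last clause is the term of degree 0, from E_0 = 1 and j = k = 0; when del is
    positive it is the seed from which multiplications produce all polynomials. *)
Theorem detker_frame lam mu c del g :
  0 <= lam -> 0 <= mu -> 0 <= c -> 0 <= del -> 0 <= g ->
  exists f : nat -> mpol R,
  [/\ forall x, 0 <= x < 1 -> exists B : R, forall n, \sum_(k < n) mmaj (f k) x ^+ 2 <= B,
     forall z w, bidisc z -> bidisc w ->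
       sums (fun k => mev (f k) z * Num.conj (mev (f k) w)) (detker lam mu c del g z w) &
     exists k, forall z, mev (f k) z = (Num.sqrt del)%:C].
Proof.
move=> l0 m0 c0 d0 g0; have [E [E0 EB ES]] := exp_frame l0 m0 c0.
have [BB BS] := br_frame d0 g0.
have [f [fB fS fin]] := flatten_blocks (gmul E (brblock del g)).
have KB x : 0 <= x < 1 -> exists B : R, forall n, \sum_(k < n) bmaj (gmul E (brblock del g) k) x <= B.
  move=> hx; have [B1 h1] := EB _ hx; have [B2 h2] := BB _ hx.
  exists (B1 * B2) => n; under eq_bigr => k _ do rewrite bmaj_gmul.
  apply: (le_trans (@cauchy_product_le _ (fun k => bmaj (E k) x) (fun k => bmaj (brblock del g k) x) n _ _)).
  - by move=> k; apply: bmaj_ge0.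
  - by move=> k; apply: bmaj_ge0.
  by apply: ler_pM => //; apply: sumr_ge0 => k _; apply: bmaj_ge0.
exists f; split.
- by move=> x hx; have [B hB] := KB x hx; exists B; apply: fB.
- move=> z w hz hw; have [x [hx zx wx]] := bidisc_radius hz hw.
  have [B hB] := KB x hx; apply: (fS z w x B) => //.
  have [B1 h1] := EB _ hx; have [B2 h2] := BB _ hx.
  have := sums_cauchy_product (fun n => bker_le (E n) zx wx) h1
    (fun n => bker_le (brblock del g n) zx wx) h2 (ES z w hz hw) (BS z w hz hw).
  by apply: sums_ext => n; rewrite bker_gmul.
- pose p := mmul (mone R) (mscale (Num.sqrt (del * (1%:R * 1%:R)))%:C (monom 1 0 0)).
  have [|k hk] := fin 0%N p.
    apply/flattenP; exists (bmul (E 0%N) (brblock del g 0)); first by rewrite inE.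
    apply/allpairsP; exists (mone R, mscale (Num.sqrt (del * (1%:R * 1%:R)))%:C (monom 1 0 0)).
    split => //=; first by rewrite E0 inE.
    by rewrite /brblock /brpair /= ?subnn !inE eqxx.
  exists k => z; rewrite hk /p mev_mul mev_one mul1r mev_scale /mev big_seq1 /= !expr0 !mulr1.
  by [].
Qed.

Lemma detker_nnd lam mu c del g :
  0 <= lam -> 0 <= mu -> 0 <= c -> 0 <= del -> 0 <= g ->
  nonneg_definite (@bidisc R) (detker lam mu c del g).
Proof.
move=> l0 m0 c0 d0 g0; have [f [_ fS _]] := detker_frame l0 m0 c0 d0 g0.
apply: (nnd_lim (Kn := fun n z w => \sum_(k < n) mev (f k) z * Num.conj (mev (f k) w))) fS.
move=> n; apply: (nnd_sum (Kn := fun k z w => mev (f k) z * Num.conj (mev (f k) w))) => k.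
apply/nonneg_definite_kform => s _; rewrite (kform_rank1 (mev (f k))).
by rewrite -realc0 lecR sqr_ge0.
Qed.

End Kernel.

(** * Computation of the determinant *)

Section Determinant.
Variable R : realType.
Local Notation V := 'rV[R[i]]_2.
Implicit Types (z w : V) (f : V -> R[i]^o).

Lemma cderiv_derive f z v (d : R[i]) :
  cderiv (fun h => f (h *: v + z)) 0 d -> 'D_v f z = d.
Proof.
move=> hd; apply: cvg_lim => //.
apply/(@cvgrPdist_le _ (R[i]^o)) => e e0.
have e0' : 0 < complex.Re e by move: e0; rewrite ltcE => /andP[_].
have [r r0 hr] := hd _ e0'.
exists r%:C => /=; first by rewrite ltcR.
move=> h /=; rewrite sub0r normrN normE ltcR => hh h0.
have := hr h; rewrite add0r scale0r add0r => /(_ (ltW hh)) H.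
have eR : e = (complex.Re e)%:C by apply: realc_ge0; exact: ltW.
rewrite eR normE lecR /shift /=.
have -> : d - h^-1 *: (f (h *: v + z) - f z) = - h^-1 * (f (h *: v + z) - f z - d * h).
  by rewrite /GRing.scale /=; field.
by rewrite modcM modcN modcV mulrC ler_pdivrMr ?modc_gt0.
Qed.

Lemma cderiv_log_line (a b e : R[i]) : modc (a * b) < 1 ->
  cderiv (fun h => LogC (1 - a * (h * e + b))) 0 (- (a * e / (1 - a * b))).
Proof.
move=> ab; have D : cderiv (fun h => a * (h * e + b)) 0 (a * e).
  have := cderivZ a (cderivD (cderivZ e (@cderiv_id R 0)) (@cderiv_cst R b 0)).
  by rewrite mulr1 addr0; apply: cderiv_ext => h; rewrite mulrC [e * _]mulrC mulrC.
have E : a * (0 * e + b) = a * b by rewrite mul0r add0r.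
have := cderiv_comp D (f := fun h => a * (h * e + b)).
rewrite E => /(_ _ _ (cderiv_log1B ab)).
by congr cderiv; rewrite mulNr mulrC.
Qed.

Lemma cderiv_quot_line (a b e c : R[i]) : modc (b * a) < 1 ->
  cderiv (fun h => (h * e + b) * c / (1 - (h * e + b) * a)) 0 (e * c / (1 - b * a) ^+ 2).
Proof.
move=> ab; have D : cderiv (fun h => h * e + b) 0 e.
  have := cderivD (cderivZ e (@cderiv_id R 0)) (@cderiv_cst R b 0).
  by rewrite mulr1 addr0; apply: cderiv_ext => h; rewrite mulrC.
have n0 : 1 - (0 * e + b) * a != 0.
  rewrite mul0r add0r subr_eq0; apply/eqP => h.
  by move: ab; rewrite -h modc1 ltxx.
have D2 : cderiv (fun h => 1 - (h * e + b) * a) 0 (- (e * a)).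
  have := cderivB (@cderiv_cst R 1 0) (cderivZ a D); rewrite sub0r [a * e]mulrC.
  by apply: cderiv_ext => h; rewrite [a * _]mulrC.
have := cderivZ c (cderivM D (cderiv_comp D2 (cderivV n0))).
rewrite mul0r add0r in n0 *.
set d := (X in cderiv _ _ X -> _) => h.
have -> : e * c / (1 - b * a) ^+ 2 = d by rewrite /d; field.
by apply: cderiv_ext h => h; ring.
Qed.

Lemma cderiv_sum (I : Type) (s : seq I) (F : I -> R[i] -> R[i]) (D : I -> R[i]) x :
  (forall i, cderiv (F i) x (D i)) ->
  cderiv (fun h => \sum_(i <- s) F i h) x (\sum_(i <- s) D i).
Proof.
move=> h; elim: s => [|i s IH].
  by rewrite big_nil; apply: cderiv_ext (cderiv_cst 0 x) => y; rewrite big_nil.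
by rewrite big_cons; apply: cderiv_ext (cderivD (h i) IH) => y; rewrite big_cons.
Qed.

Lemma line_coord (x : R[i]) i z j : (x *: delta_mx 0 i + z) 0 j = x * (j == i)%:R + z 0 j.
Proof. by rewrite !mxE eqxx. Qed.

(** A matrix of exponents treats the four logarithms of log B uniformly; the mixed derivative in z_i
    and conj w_j then selects the single entry [s i j]. *)
Definition log_potential (s : 'I_2 -> 'I_2 -> R[i]) z w : R[i]^o :=
  - \sum_k \sum_l s k l * LogC (one_sub z w k l).

Lemma d_wbar_log_potential s j z w : bidisc z -> bidisc w ->
  d_wbar j (log_potential s z) w =
  \sum_k \sum_l s k l * (z 0 k * (l == j)%:R / one_sub z w k l).
Proof.
move=> hz hw; apply: cderiv_derive; rewrite -[X in cderiv _ _ X]opprK; apply: cderivN.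
rewrite -sumrN; apply: cderiv_sum => k; rewrite -sumrN; apply: cderiv_sum => l.
rewrite -mulrN; apply: cderivZ.
have := @cderiv_log_line (z 0 k) (Num.conj (w 0 l)) (l == j)%:R (modc_node k l hz hw).
apply: cderiv_ext => h; rewrite /one_sub !mxE eqxx /= !rmorphD !rmorphM /=.
by rewrite !conjCK.
Qed.

Lemma bidisc_line z i : bidisc z ->
  exists2 r : R, 0 < r & forall x, modc x <= r -> bidisc (x *: delta_mx 0 i + z).
Proof.
move=> /bidiscP hz; exists ((1 - modc (z 0 i)) / 2); first by rewrite divr_gt0 // subr_gt0.
move=> x hx; apply/bidiscP => j; rewrite line_coord.
have [->|ji] := eqVneq j i; last by rewrite mulr0 add0r.
rewrite mulr1; apply: le_lt_trans (modcD _ _) _.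
by have := hz i; lra.
Qed.

Lemma mixed_derivative_log_potential s i j z w : bidisc z -> bidisc w ->
  d_z i (fun z' => d_wbar j (log_potential s z') w) z = s i j / one_sub z w i j ^+ 2.
Proof.
move=> hz hw; apply: cderiv_derive; have [r r0 hr] := bidisc_line i hz.
(* The formula for the inner derivative holds only inside the bidisc, which is enough for small
   increments. *)
apply: (@cderiv_near _ (fun h => \sum_k \sum_l s k l *
   ((h *: delta_mx 0 i + z) 0 k * (l == j)%:R / one_sub (h *: delta_mx 0 i + z) w k l)) _ _ _ r) => //.
  by move=> h hh; rewrite add0r d_wbar_log_potential //; apply: hr.
have -> : s i j / one_sub z w i j ^+ 2 = \sum_k \sum_l s k l *
    ((k == i)%:R * (l == j)%:R / one_sub z w k l ^+ 2).
  rewrite (bigD1 i) //= (bigD1 j) //= !eqxx !mul1r !big1 ?addr0 //.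
    by move=> k /negbTE ->; rewrite big1 // => l _; rewrite !mul0r mulr0.
  by move=> l /negbTE ->; rewrite mulr0 mul0r mulr0.
apply: cderiv_sum => k; apply: cderiv_sum => l; apply: cderivZ.
have := @cderiv_quot_line (Num.conj (w 0 l)) (z 0 k) (k == i)%:R (l == j)%:R (modc_node k l hz hw).
by apply: cderiv_ext => h; rewrite /one_sub line_coord.
Qed.

Lemma det2 (A : 'M[R[i]]_2) : \det A = A 0 0 * A 1 1 - A 0 1 * A 1 0.
Proof.
rewrite (expand_det_row _ 0) !big_ord_recl big_ord0 addr0 /cofactor !det_mx11 !mxE /=.
by rewrite expr0 expr1 mul1r mulN1r mulrN; congr (A 0 _ * A _ _ - A 0 _ * A _ _); apply: val_inj.
Qed.

(** The determinant of a multiple of a 2 by 2 matrix squares the factor, which doubles the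
    exponents: 2 e a = 2 e (a - c) + 2 e c splits off (CD / AB)^(2 e c). The bracket is rearranged
    as a b (AB)^-2 - c^2 (CD)^-2 = (a b - c^2) (AB)^-2 + c^2 ((AB)^-2 - (CD)^-2). *)
Lemma det_calB_detker (a b c e : R) z w : bidisc z -> bidisc w ->
  det_calB a b c e z w =
  detker (2 * e * (a - c)) (2 * e * (b - c)) (2 * e * c) (a * b - c ^+ 2) (c ^+ 2) z w.
Proof.
move=> hz hw; pose s (k l : 'I_2) : R[i] :=
  if k == 0 then if l == 0 then a%:C else - c%:C else if l == 0 then - c%:C else b%:C.
have E z' w' : log_kerB a b c z' w' = log_potential s z' w'.
  have l1 : lift ord0 ord0 = 1 :> 'I_2 by apply: val_inj.
  rewrite /log_potential !big_ord_recl !big_ord0 /= !l1 /log_kerB /s /=; ring.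
have M i j : d_z i (fun z' => d_wbar j (fun w' => log_kerB a b c z' w') w) z =
    s i j / one_sub z w i j ^+ 2.
  have -> : (fun z' => d_wbar j (fun w' => log_kerB a b c z' w') w) =
      (fun z' => d_wbar j (log_potential s z') w).
    apply/funext => z'; congr (d_wbar j _ w); apply/funext => w'; exact: E.
  exact: mixed_derivative_log_potential.
have n0 i j : one_sub z w i j != 0.
  rewrite subr_eq0; apply/eqP => h.
  by have := modc_node i j hz hw; rewrite -h modc1 ltxx.
have -> : det_calB a b c e z w = kerB (a * e) (b * e) (c * e) z w ^+ 2 *
    (s 0 0 / one_sub z w 0 0 ^+ 2 * (s 1 1 / one_sub z w 1 1 ^+ 2) -
     s 0 1 / one_sub z w 0 1 ^+ 2 * (s 1 0 / one_sub z w 1 0 ^+ 2)).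
  rewrite /det_calB /calB detZ det2; congr (_ * (_ * _ - _ * _)); rewrite mxE; exact: M.
rewrite /s /=.
rewrite /detker /kerB /powC -!expCD -expC_nat.
set u := expC _; set v := expC _; have -> : u = v.
  rewrite /u /v /logA /logB /logCD; congr expC; rewrite !realcE.
  move: (LogC _) (LogC _) (LogC _) (LogC _) => x1 x2 x3 x4; ring.
rewrite /inv2 !realcE; field; by rewrite !n0.
Qed.

End Determinant.

(** * Square-summable sequences *)

Section SquareSummable.
Variable R : realType.
Implicit Types (c d : nat -> R[i]) (B r : R).

Definition ell2 c := exists B : R, forall n, \sum_(k < n) modc (c k) ^+ 2 <= B.
Definition ipl c d : R[i] := sumC (fun k => c k * Num.conj (d k)).
Definition nl c : R := Num.sqrt (complex.Re (ipl c c)).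

Lemma ell2_sums c d : ell2 c -> ell2 d -> sums (fun k => c k * Num.conj (d k)) (ipl c d).
Proof.
move=> [B hB] [B' hB'].
have [||l hl _] := @abs_sums R (fun k => c k * Num.conj (d k))
  (fun k => modc (c k) ^+ 2 + modc (d k) ^+ 2) (B + B'); last exact: sumCP hl.
- move=> k; rewrite modcM modcJ; move: (modc_ge0 (c k)) (modc_ge0 (d k)).
  by move: (modc (c k)) (modc (d k)) => x y; nra.
- by move=> n; rewrite big_split lerD ?hB ?hB'.
Qed.

Lemma ell2Z a c : ell2 c -> ell2 (fun k => a * c k).
Proof.
move=> [B hB]; exists (modc a ^+ 2 * B) => n.
under eq_bigr => k _ do rewrite modcM exprMn.
by rewrite -mulr_sumr ler_wpM2l // sqr_ge0.
Qed.

Lemma ell2D c d : ell2 c -> ell2 d -> ell2 (fun k => c k + d k).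
Proof.
move=> [B hB] [B' hB']; exists (2 * B + 2 * B') => n.
apply: (@le_trans _ _ (\sum_(k < n) (2 * modc (c k) ^+ 2 + 2 * modc (d k) ^+ 2))).
  apply: ler_sum => k _; apply: (@le_trans _ _ ((modc (c k) + modc (d k)) ^+ 2)).
    by apply: lerXn2r; rewrite ?nnegrE ?addr_ge0 // modcD.
  move: (modc (c k)) (modc (d k)) => x y; have := sqr_ge0 (x - y); nra.
by rewrite big_split -!mulr_sumr lerD // ler_wpM2l ?hB ?hB'.
Qed.

Lemma ipl_nl c : ell2 c -> ipl c c = (nl c ^+ 2)%:C.
Proof.
move=> hc; have /cvs_ge0 h := ell2_sums hc hc.
have {}h : 0 <= ipl c c.
  by apply: h => n; apply: sumr_ge0 => k _; rewrite mulJc -realc0 lecR sqr_ge0.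
rewrite sqr_sqrtr; first exact: realc_ge0.
by move: h; rewrite lecE => /andP[_].
Qed.

Lemma nl_ge0 c : 0 <= nl c. Proof. exact: sqrtr_ge0. Qed.

Lemma nl_psum c n : ell2 c -> \sum_(k < n) modc (c k) ^+ 2 <= nl c ^+ 2.
Proof.
move=> hc; rewrite -subr_ge0 -lecR realcB -ipl_nl //.
have := cvsB (cvs_sub (fun m => leq_addr n m) (ell2_sums hc hc))
  (cvs_cst (\sum_(k < n) modc (c k) ^+ 2)%:C).
move/cvs_ge0; apply => m /=.
rewrite addnC big_split_ord /= realc_sum.
under eq_bigr => k _ do rewrite mulJc.
rewrite addrAC subrr add0r; apply: sumr_ge0 => k _.
by rewrite mulJc -realc0 lecR sqr_ge0.
Qed.

Lemma nl_le c (B : R) : 0 <= B -> (forall n, \sum_(k < n) modc (c k) ^+ 2 <= B ^+ 2) -> nl c <= B.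
Proof.
move=> B0 hB; have hc : ell2 c by exists (B ^+ 2).
rewrite -(@ler_sqr R) ?nnegrE ?nl_ge0 //.
have := cvs_modc_le (ell2_sums hc hc) (B := B ^+ 2).
rewrite ipl_nl // modcR ger0_norm ?sqr_ge0 //; apply => n.
rewrite (le_trans (modc_sum _ _ _)) //; apply: le_trans (hB n).
by apply: ler_sum => k _; rewrite modcM modcJ expr2.
Qed.

Lemma psum_mul_le c d n : ell2 c -> ell2 d ->
  \sum_(k < n) modc (c k) * modc (d k) <= nl c * nl d.
Proof.
move=> hc hd; rewrite -(@ler_sqr R) ?nnegrE ?mulr_ge0 ?nl_ge0 //; last first.
  by apply: sumr_ge0 => k _; rewrite mulr_ge0.
apply: (le_trans (sum_cauchy_schwarz n (fun k => modc_ge0 (c k)) (fun k => modc_ge0 (d k)))).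
rewrite exprMn; apply: ler_pM; rewrite ?nl_psum //; apply: sumr_ge0 => k _; exact: sqr_ge0.
Qed.

Lemma nlD c d : ell2 c -> ell2 d -> nl (fun k => c k + d k) <= nl c + nl d.
Proof.
move=> hc hd; apply: nl_le => [|n]; first by rewrite addr_ge0 ?nl_ge0.
apply: (@le_trans _ _ (\sum_(k < n) (modc (c k) ^+ 2 + modc (d k) ^+ 2 +
    (modc (c k) * modc (d k)) *+ 2))).
  apply: ler_sum => k _; rewrite -addrAC -sqrrD.
  by apply: lerXn2r; rewrite ?nnegrE ?addr_ge0 ?modc_ge0 // modcD.
rewrite 2!big_split /= sumrMnl.
have h1 := nl_psum n hc; have h2 := nl_psum n hd; have h3 := psum_mul_le n hc hd.
by rewrite sqrrD mulr2n -!mulr2n addrAC lerD // ?lerD // lerMn2r h3 orbT.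
Qed.

Lemma nlZ a c : ell2 c -> nl (fun k => a * c k) = modc a * nl c.
Proof.
move=> hc; apply/eqP; rewrite -(@eqrXn2 _ 2) ?mulr_ge0 ?nl_ge0 //; apply/eqP/real_complexP.
rewrite -ipl_nl; last exact: ell2Z.
rewrite exprMn realcM -mulJc -ipl_nl //; apply: sumCE.
apply: sums_ext (sumsZ (a * Num.conj a) (ell2_sums hc hc)) => k.
by rewrite rmorphM /= mulrACA.
Qed.

Lemma nl_coord c k : ell2 c -> modc (c k) <= nl c.
Proof.
move=> hc; rewrite -(@ler_sqr R) ?nnegrE ?nl_ge0 //.
apply: le_trans (nl_psum k.+1 hc); rewrite big_ord_recr /= lerDr.
by apply: sumr_ge0 => j _; exact: sqr_ge0.
Qed.

Lemma ipl_le c d : ell2 c -> ell2 d -> modc (ipl c d) <= nl c * nl d.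
Proof.
move=> hc hd; apply: (cvs_modc_le (ell2_sums hc hd)) => n.
apply: (le_trans (modc_sum _ _ _)); apply: le_trans (psum_mul_le n hc hd).
by apply: ler_sum => k _; rewrite modcM modcJ.
Qed.

(** The limit is coordinatewise; for each finite partial sum the Cauchy rate passes to the limit in
    [m], and [nl_le] then bounds the whole norm. *)
Lemma ell2_complete (x : nat -> nat -> R[i]) : (forall n, ell2 (x n)) ->
  (forall n m, (n <= m)%N -> nl (fun k => x n k - x m k) <= 2 * dy R n) ->
  exists c, ell2 c /\ forall n, nl (fun k => x n k - c k) <= 2 * dy R n.
Proof.
move=> hx hC.
have hB n m : ell2 (fun k => x n k - x m k).
  have := ell2D (hx n) (ell2Z (-1) (hx m)).
  by congr ell2; apply/funext => k; rewrite mulN1r.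
have lim k : exists l, cvs (fun n => x n k) l.
  apply: cauchys_cvs => e e0; have [N hN] := dy_small (divr_gt0 e0 (ltr0n R 4)).
  exists N => m n Nm Nn.
  have step p : (N <= p)%N -> modc (x N k - x p k) <= 2 * dy R N.
    by move=> Np; apply: le_trans (hC _ _ Np); apply: (nl_coord k (hB N p)).
  have -> : x m k - x n k = (x N k - x n k) - (x N k - x m k) by ring.
  apply: (le_trans (modcB _ _)); have := step _ Nm; have := step _ Nn; have := hN N (leqnn N).
  by move: (dy R N) => t; lra.
have [c hc] := @choice _ _ (fun k l => cvs (fun n => x n k) l) lim.
have fin n N : \sum_(k < N) modc (x n k - c k) ^+ 2 <= (2 * dy R n) ^+ 2.
  have : cvs (fun m => \sum_(k < N) (x n k - x (m + n)%N k) * Num.conj (x n k - x (m + n)%N k))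
      (\sum_(k < N) (x n k - c k) * Num.conj (x n k - c k)).
    apply: cvs_sum => k.
    have h : cvs (fun m => x n k - x (m + n)%N k) (x n k - c k).
      apply: cvsB; first exact: cvs_cst.
      exact: (cvs_sub (p := fun m => (m + n)%N) (fun m => leq_addr n m) (hc k)).
    exact: cvsM h (cvsJ h).
  move/(cvs_modc_le (B := (2 * dy R n) ^+ 2)).
  under eq_bigr => k _ do rewrite mulJc.
  rewrite -realc_sum modcR ger0_norm; last by apply: sumr_ge0 => k _; exact: sqr_ge0.
  apply => m; under eq_bigr => k _ do rewrite mulJc.
  rewrite -realc_sum modcR ger0_norm; last by apply: sumr_ge0 => k _; exact: sqr_ge0.
  apply: (le_trans (nl_psum N (hB n (m + n)%N))).
  have := hC n (m + n)%N (leq_addl _ _).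
  by move=> h; apply: lerXn2r h; rewrite nnegrE ?nl_ge0 // mulr_ge0 // dy_ge0.
exists c; split; last by move=> n; apply: nl_le (fin n); rewrite mulr_ge0 // dy_ge0.
have e0 : ell2 (fun k => x 0%N k - c k) by exists ((2 * dy R 0) ^+ 2).
have := ell2D (hx 0%N) (ell2Z (-1) e0).
by congr ell2; apply/funext => k; rewrite mulN1r opprB addrC subrK.
Qed.

End SquareSummable.

(** * Construction of a space with a given kernel *)

Section Existence.
Variables (R : realType) (f : nat -> 'rV[R[i]]_2 -> R[i]).
Implicit Types (c d : nat -> R[i]).

(* The space is realized inside the sequence space: the orthogonal complement of
   the sequences that sum to the zero function. *)
Definition rmem c := ell2 c /\ forall d, ell2 d ->
  (forall w, bidisc w -> sums (fun k => d k * f k w) 0) ->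
  sums (fun k => c k * Num.conj (d k)) 0.

Record rkhs := Rkhs { rseq :> nat -> R[i]; rseqP : rmem rseq }.

Lemma rkhs_ext (x y : rkhs) : rseq x =1 rseq y -> x = y.
Proof.
case: x y => [x hx] [y hy] /= /funext e; case: _ / e hy => hy.
by congr Rkhs; apply: Prop_irrelevance.
Qed.

Lemma rmem_ell2 (x : rkhs) : ell2 (rseq x). Proof. by case: (rseqP x). Qed.
Hint Resolve rmem_ell2 : core.

Lemma rmem_lincomb a c d : rmem c -> rmem d -> rmem (fun k => a * c k + d k).
Proof.
move=> [c2 hc] [d2 hd]; split; first exact: ell2D (ell2Z a c2) d2.
move=> b hb hb0; have := sumsD (sumsZ a (hc b hb hb0)) (hd b hb hb0).
by rewrite mulr0 addr0; apply: sums_ext => k; rewrite mulrDl mulrA.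
Qed.

Lemma rmem0 : rmem (fun=> 0).
Proof.
split; first by exists 0 => n; rewrite big1 // => k _; rewrite modc0 expr0n.
by move=> b _ _; apply: sums_ext (@sums0 R) => k; rewrite mul0r.
Qed.

Lemma rmemD c d : rmem c -> rmem d -> rmem (fun k => c k + d k).
Proof.
by move=> hc hd; have := rmem_lincomb 1 hc hd; congr rmem; apply/funext => k; rewrite mul1r.
Qed.

Lemma rmemZ a c : rmem c -> rmem (fun k => a * c k).
Proof.
by move=> hc; have := rmem_lincomb a hc rmem0; congr rmem; apply/funext => k; rewrite addr0.
Qed.

Definition radd (x y : rkhs) := Rkhs (rmemD (rseqP x) (rseqP y)).
Definition rscale a (x : rkhs) := Rkhs (rmemZ a (rseqP x)).
Definition rzero := Rkhs rmem0.

HB.instance Definition _ := gen_eqMixin rkhs.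
HB.instance Definition _ := gen_choiceMixin rkhs.

Lemma raddA : associative radd.
Proof. by move=> x y z; apply: rkhs_ext => k /=; rewrite addrA. Qed.
Lemma raddC : commutative radd.
Proof. by move=> x y; apply: rkhs_ext => k /=; rewrite addrC. Qed.
Lemma radd0 : left_id rzero radd.
Proof. by move=> x; apply: rkhs_ext => k /=; rewrite add0r. Qed.
Lemma raddN : left_inverse rzero (rscale (-1)) radd.
Proof. by move=> x; apply: rkhs_ext => k /=; rewrite mulN1r addNr. Qed.

HB.instance Definition _ := GRing.isZmodule.Build rkhs raddA raddC radd0 raddN.

Lemma rscaleA a b x : rscale a (rscale b x) = rscale (a * b) x.
Proof. by apply: rkhs_ext => k /=; rewrite mulrA. Qed.
Lemma rscale1 : left_id 1 rscale.
Proof. by move=> x; apply: rkhs_ext => k /=; rewrite mul1r. Qed.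
Lemma rscaleDr : right_distributive rscale +%R.
Proof. by move=> a x y; apply: rkhs_ext => k /=; rewrite mulrDr. Qed.
Lemma rscaleDl x : {morph rscale^~ x : a b / a + b}.
Proof. by move=> a b; apply: rkhs_ext => k /=; rewrite mulrDl. Qed.

HB.instance Definition _ :=
  GRing.Zmodule_isLmodule.Build R[i] rkhs rscaleA rscale1 rscaleDr rscaleDl.

Definition rnorm (x : rkhs) : R[i] := (nl x)%:C.

Lemma rnormD (x y : rkhs) : rnorm (x + y) <= rnorm x + rnorm y.
Proof. by rewrite -realcD lecR; apply: nlD. Qed.
Lemma rnormZ a (x : rkhs) : rnorm (a *: x) = `|a| * rnorm x.
Proof. by rewrite normE -realcM /rnorm -nlZ. Qed.
Lemma rnorm0_eq0 (x : rkhs) : rnorm x = 0 -> x = 0.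
Proof.
move=> /eqP; rewrite realc_eq0 => /eqP h; apply: rkhs_ext => k /=.
apply/eqP; rewrite -modc_eq0; apply/eqP/le_anti; rewrite modc_ge0 andbT -h.
exact: nl_coord.
Qed.

HB.instance Definition _ := Lmodule_isNormed.Build R[i] rkhs rnormD rnormZ rnorm0_eq0.

Lemma rkhs_normE (x : rkhs) : `|x| = (nl x)%:C. Proof. by []. Qed.

Lemma rkhs_nlB (x y : rkhs) : nl (fun k => x k - y k) = complex.Re `|x - y|.
Proof. by rewrite rkhs_normE /=; congr nl; apply/funext => k; rewrite mulN1r. Qed.

Lemma rmem_closed c : ell2 c -> (forall e : R, 0 < e -> exists x : rkhs, nl (fun k => x k - c k) <= e) ->
  rmem c.
Proof.
move=> hc hx; split => // d hd d0; have S := ell2_sums hc hd.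
suff <- : ipl c d = 0 by [].
apply: modc_small => e e0.
have nd : 0 < nl d + 1 by rewrite ltr_wpDl // nl_ge0.
have [x xe] := hx (e / (nl d + 1)) (divr_gt0 e0 nd).
have hxc : ell2 (fun k => x k - c k).
  have := ell2D (rmem_ell2 x) (ell2Z (-1) hc).
  by congr ell2; apply/funext => k; rewrite mulN1r.
have -> : ipl c d = - ipl (fun k => x k - c k) d.
  apply: sumCE; rewrite -[- _]add0r; case: (rseqP x) => _ /(_ d hd d0) xd.
  apply: sums_ext (sumsB xd (ell2_sums hxc hd)) => k; ring.
rewrite modcN (le_trans (ipl_le hxc hd)) // (le_trans (ler_wpM2r (nl_ge0 d) xe)) //.
rewrite -[leRHS](divfK (lt0r_neq0 nd)); apply: ler_wpM2l; last by rewrite lerDl.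
by rewrite divr_ge0 // ltW.
Qed.

Lemma rkhs_complete (F : set_system rkhs) : ProperFilter F -> cauchy F -> cvg F.
Proof.
move=> FF /cauchyP hF.
(* Balls of radius 2^-n that belong to the filter; any two of them meet, so their centres form a
   Cauchy sequence with explicit rate. *)
have [|x hx] := @choice nat rkhs (fun n x => F (ball x (dy R n)%:C)).
  by move=> n; apply: hF; rewrite ltcR dy_gt0.
have near n m : nl (fun k => x n k - x m k) <= dy R n + dy R m.
  have [y [yn ym]] := filter_ex (filterI (hx n) (hx m)).
  move: yn ym; rewrite -!ball_normE /ball_ /= => yn ym.
  rewrite rkhs_nlB -lecR -[leLHS]realc_ge0 ?normr_ge0 // realcD.
  have -> : x n - x m = (x n - y) - (x m - y) by rewrite opprB addrA subrK.
  by apply: (le_trans (ler_normB _ _)); apply: lerD; exact: ltW.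
have dle n m : (n <= m)%N -> dy R m <= dy R n.
  by move=> nm; apply: ler_wiXn2l => //; lra.
have [||c [hc cx]] := @ell2_complete R (fun n => rseq (x n)).
- by [].
- move=> n m nm; apply: (le_trans (near n m)); have := dle n m nm.
  by move: (dy R n) (dy R m) => s t; lra.
have cm : rmem c.
  apply: rmem_closed hc _ => e e0.
  have [N hN] := dy_small (divr_gt0 e0 (ltr0n R 2)).
  exists (x N); apply: (le_trans (cx N)); have := hN N (leqnn N).
  by move: (dy R N) => t; lra.
apply/cvg_ex; exists (Rkhs cm); apply/cvg_ballP => e e0.
have eE := realc_ge0 (ltW e0); set r := complex.Re e in eE.
have r0 : 0 < r by rewrite -ltcR -eE.
have [N hN] := dy_small (divr_gt0 r0 (ltr0n R 4)).
apply: filterS (hx N) => y; rewrite -!ball_normE /ball_ /= => yN.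
have -> : Rkhs cm - y = (x N - y) - (x N - Rkhs cm) by rewrite opprB [RHS]addrC addrA subrK.
apply: (le_lt_trans (ler_normB _ _)).
have h : `|x N - Rkhs cm| <= (2 * dy R N)%:C.
  by rewrite [leLHS]realc_ge0 ?normr_ge0 // lecR -rkhs_nlB.
apply: (lt_le_trans (ltr_leD yN h)); rewrite -realcD eE lecR.
by have := hN N (leqnn N); move: (dy R N) => t; lra.
Qed.

HB.instance Definition _ := Uniform_isComplete.Build rkhs rkhs_complete.

Definition rinner (x y : rkhs) : R[i] := ipl x y.

Lemma rinner_linl (y : rkhs) a (x x' : rkhs) :
  rinner (a *: x + x') y = a * rinner x y + rinner x' y.
Proof.
apply: sumCE; have := sumsD (sumsZ a (ell2_sums (rmem_ell2 x) (rmem_ell2 y)))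
  (ell2_sums (rmem_ell2 x') (rmem_ell2 y)).
by apply: sums_ext => k /=; rewrite mulrDl mulrA.
Qed.

Lemma rinnerC (x y : rkhs) : rinner x y = Num.conj (rinner y x).
Proof.
apply: sumCE; apply: sums_ext (sumsJ (ell2_sums (rmem_ell2 y) (rmem_ell2 x))) => k.
by rewrite rmorphM /= conjCK mulrC.
Qed.

Lemma rinner_linr (y : rkhs) a (x x' : rkhs) :
  rinner y (a *: x + x') = Num.conj a * rinner y x + rinner y x'.
Proof. by rewrite rinnerC rinner_linl rmorphD rmorphM /= -!rinnerC. Qed.

Lemma rinner_bilinear : bilinear_for ( *%R) (Num.conj \; *%R) rinner.
Proof. by split=> [y a x x'|y a x x']; [exact: rinner_linl|exact: rinner_linr]. Qed.

HB.instance Definition _ := bilinear_isBilinear.Build R[i] rkhs rkhs R[i]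
  ( *%R) (Num.conj \; *%R) rinner rinner_bilinear.

Lemma rinner_herm (x y : rkhs) : rinner x y = (-1) ^+ false * Num.conj (rinner y x).
Proof. by rewrite expr0 mul1r rinnerC. Qed.

HB.instance Definition _ := isHermitianSesquilinear.Build R[i] rkhs false
  (@Num.conj R[i]) rinner rinner_herm.

Lemma rinner_norm (x : rkhs) : `|x| ^+ 2 = rinner x x.
Proof. by rewrite rkhs_normE /rinner ipl_nl // realcX. Qed.

Lemma rinner_gt0 (x : rkhs) : x != 0 -> 0 < rinner x x.
Proof. by move=> x0; rewrite -rinner_norm exprn_gt0 // normr_gt0. Qed.

HB.instance Definition _ := isDotProduct.Build R[i] rkhs rinner rinner_gt0.

Definition rhilbert : hilbertSpace R := @HilbertSpace R rkhs rinner rinner_norm.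

Variable K : 'rV[R[i]]_2 -> 'rV[R[i]]_2 -> R[i].
Hypothesis fK : forall z w, bidisc z -> bidisc w ->
  sums (fun k => f k z * Num.conj (f k w)) (K z w).

Lemma frame_ell2 w : bidisc w -> ell2 (fun k => Num.conj (f k w)).
Proof.
move=> hw; have [B _ hB] := cvs_bounded (fK hw hw); exists B => n.
apply: le_trans (hB n); apply: (le_trans (ler_norm _)).
rewrite -modcR realc_sum; under eq_bigr => k _ do rewrite modcJ -mulJc.
exact: lexx.
Qed.

(** Orthogonality to d is the conjugate of the vanishing at w of the function that d sums to. *)
Lemma frame_rmem w : bidisc w -> rmem (fun k => Num.conj (f k w)).
Proof.
move=> hw; split=> [|d hd d0]; first exact: frame_ell2.
have := sumsJ (d0 w hw); rewrite rmorph0; apply: sums_ext => k.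
by rewrite rmorphM /= mulrC.
Qed.

Definition reval (x : rkhs) w : R[i]^o := sumC (fun k => x k * f k w).

Lemma reval_sums (x : rkhs) w : bidisc w -> sums (fun k => x k * f k w) (reval x w).
Proof.
move=> hw; have := ell2_sums (rmem_ell2 x) (frame_ell2 hw) => h.
apply: (@sumCP _ _ (ipl x (fun k => Num.conj (f k w)))).
by apply: sums_ext h => k; rewrite conjCK.
Qed.

Lemma reval_linear a (x y : rkhs) w : bidisc w ->
  reval (a *: x + y) w = a * reval x w + reval y w.
Proof.
move=> hw; apply: sumCE; apply: sums_ext (sumsD (sumsZ a (reval_sums x hw)) (reval_sums y hw)) => k /=.
by rewrite mulrDl mulrA.
Qed.

(** The difference sums to the zero function and lies in the orthogonal complement of such
    sequences, hence it is orthogonal to itself. *)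
Lemma reval_inj (x y : rkhs) : (forall w, bidisc w -> reval x w = reval y w) -> x = y.
Proof.
move=> h; apply/eqP; rewrite -subr_eq0 -scaleN1r addrC; apply/eqP.
set z := _ + _; have z0 w : bidisc w -> sums (fun k => z k * f k w) 0.
  move=> hw; have := reval_sums z hw; congr sums.
  by rewrite /z reval_linear // h // mulN1r addNr.
have [z2 zz] := rseqP z.
apply: rnorm0_eq0; apply/eqP; rewrite -sqrf_eq0 -realcX -ipl_nl //; apply/eqP.
by apply: sumCE; apply: zz.
Qed.

Definition rkhs_space : hilbertFunctionSpace (@bidisc R) :=
  @HilbertFunctionSpace R (@bidisc R) rhilbert reval reval_linear reval_inj.

Lemma rkhs_reproducing : reproducing_kernel rkhs_space K.
Proof.
move=> w hw; exists (Rkhs (frame_rmem hw)) => [z hz|x].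
  by apply: sumCE; apply: sums_ext (fK hz hw) => k; rewrite mulrC.
apply: sums_uniq (reval_sums x hw) _.
apply: sums_ext (ell2_sums (rmem_ell2 x) (frame_ell2 hw)) => k.
by rewrite conjCK.
Qed.

End Existence.

(** * Holomorphy of the elements and density of the polynomials *)

Section Holomorphy.
Variable R : realType.
Local Notation V := 'rV[R[i]]_2.
Implicit Types (z w h : V).

Lemma coord_norm_le h i : `|h 0 i| <= `|h|.
Proof.
have : `|h 0 i|%:nng <= \big[Num.max/0%:nng]_(ij : 'I_1 * 'I_2) `|h ij.1 ij.2|%:nng.
  exact: (le_bigmax _ (fun ij : 'I_1 * 'I_2 => `|h ij.1 ij.2|%:nng) (0, i)).
by rewrite -num_le.
Qed.

Lemma modc_coord_le h i : modc (h 0 i) <= complex.Re `|h|.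
Proof.
by have := coord_norm_le h i; rewrite normE [leRHS]realc_ge0 ?normr_ge0 // lecR.
Qed.

Lemma differentiable_eps (U : normedModType R[i]) (f : U -> R[i]^o) (z : U)
    (L : {linear U -> R[i]^o}) (C : R) : 0 <= C ->
  (forall h : U, modc (L h) <= C * complex.Re `|h|) ->
  (forall e : R, 0 < e -> exists2 s : R, 0 < s & forall h : U, complex.Re `|h| < s ->
    modc (f (h + z) - f z - L h) <= e * complex.Re `|h|) ->
  differentiable f z.
Proof.
move=> C0 LC hf.
have nE (h : U) : `|h| = (complex.Re `|h|)%:C := realc_ge0 (normr_ge0 h).
have cL : continuous L.
  move=> x; apply/cvgrPdist_le => e e0.
  have eE := realc_ge0 (ltW e0); set d := complex.Re e in eE.
  have d0 : 0 < d by rewrite -ltcR -eE.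
  have s0 : 0 < (d / (C + 1))%:C :> R[i] by rewrite ltcR divr_gt0 // ltr_wpDl.
  apply/nbhs_normP; exists (d / (C + 1))%:C => // y /=; rewrite -linearB normE eE lecR nE ltcR => h.
  apply: (le_trans (LC _)).
  rewrite ltr_pdivlMr ?ltr_wpDl // in h.
  have : 0 <= complex.Re `|x - y| by rewrite -lecR -nE normr_ge0.
  by move: h; move: (complex.Re _) => t h t0; nra.
have E : f \o shift z = cst (f z) + L +o_ 0 id.
  apply/eqaddoP => e e0.
  have eE := realc_ge0 (ltW e0); set d := complex.Re e in eE.
  have d0 : 0 < d by rewrite -ltcR -eE.
  have [s s0 hs] := hf d d0.
  have s0' : 0 < s%:C :> R[i] by rewrite ltcR.
  have := @nbhs0_lt _ U _ s0'; apply: filterS => h; rewrite nE ltcR => /hs H.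
  rewrite eE -realcM.
  have -> : (f \o shift z - (cst (f z) + L)) h = f (h + z) - f z - L h.
    by rewrite -addrA -opprD.
  by rewrite normE lecR.
have eD := diff_unique cL E.
by apply/diff_locallyP; rewrite eD.
Qed.

Lemma linear_coords (D : 'I_2 -> R[i]) :
  exists L : {linear V -> R[i]^o}, forall h, L h = D 0 * h 0 0 + D 1 * h 0 1.
Proof.
pose W h : R[i]^o := D 0 * h 0 0 + D 1 * h 0 1.
have hW a x y : W (a *: x + y) = a *: W x + W y.
  by rewrite /W !mxE /GRing.scale /=; ring.
pose A := GRing.isLinear.Build R[i] V R[i]^o *:%R W hW.
by pose L : {linear V -> R[i]^o} := HB.pack W A; exists L.
Qed.

Lemma holomorphic_quadratic (A : set V) (f : V -> R[i]^o) :
  (forall z, A z -> exists (D : 'I_2 -> R[i]) (C r : R), [/\ 0 < r, 0 <= C &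
  forall h (t : R), 0 <= t <= r -> (forall i, modc (h 0 i) <= t) ->
    modc (f (h + z) - f z - (D 0 * h 0 0 + D 1 * h 0 1)) <= C * t ^+ 2]) ->
  holomorphic A f.
Proof.
move=> hf z /hf [D [C [r [r0 C0 {}hf]]]]; have [L hL] := linear_coords D.
apply: (@differentiable_eps _ f z L (modc (D 0) + modc (D 1))); first by rewrite addr_ge0.
  move=> h; rewrite hL (le_trans (modcD _ _)) // !modcM mulrDl.
  by apply: lerD; apply: ler_wpM2l => //; apply: modc_coord_le.
move=> e e0; exists (Num.min r (e / (C + 1))).
  by rewrite lt_min r0 divr_gt0 // ltr_wpDl.
move=> h; rewrite lt_min => /andP[hr he].
have t0 : 0 <= complex.Re `|h| by apply: le_trans (modc_coord_le h 0).
have := hf h (complex.Re `|h|); rewrite t0 (ltW hr) => /(_ isT (modc_coord_le h)).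
rewrite -hL => /le_trans; apply; rewrite ltr_pdivlMr ?ltr_wpDl // in he.
by move: t0 he; move: (complex.Re _) => t t0 he; nra.
Qed.

Variables (H : hilbertFunctionSpace (@bidisc R)) (K : V -> V -> R[i]).
Hypothesis hK : reproducing_kernel H K.
Variable p : nat -> mpol R.
Hypothesis pmaj : forall x : R, 0 <= x < 1 ->
  exists B : R, forall n, \sum_(k < n) mmaj (p k) x ^+ 2 <= B.
Hypothesis pK : forall z w, bidisc z -> bidisc w ->
  sums (fun k => mev (p k) z * Num.conj (mev (p k) w)) (K z w).
Local Notation ev := (@Defs.eval R (@bidisc R) H).

(** The expansion with coefficients a_k = <x, e_k> is differentiated term by term. By Bessel and
    |a_k| M_k <= |a_k|^2 + M_k^2 the majorants M_k at the larger radius X + rho are summable against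
    the coefficients. *)
Lemma holomorphic_eval (x : H) : holomorphic (@bidisc R) (ev x).
Proof.
have [e [he hn]] := frame_elements hK pK.
apply: holomorphic_quadratic => z hz; have [X [/andP[X0 X1] zX _]] := bidisc_radius hz hz.
pose rho := (1 - X) / 2; have rho0 : 0 < rho by rewrite /rho; lra.
have Xr : 0 <= X + rho < 1 by rewrite /rho; lra.
have [B hB] := pmaj Xr.
pose M k := mmaj (p k) (X + rho).
have M0 k : 0 <= M k by apply: mmaj_ge0; case/andP: Xr.
pose a k := inner H x (e k).
pose S := nr x ^+ 2 + B.
have aM n : \sum_(k < n) modc (a k) * M k <= S.
  apply: (@le_trans _ _ (\sum_(k < n) (modc (a k) ^+ 2 + M k ^+ 2))).
    apply: ler_sum => k _; move: (modc_ge0 (a k)) (M0 k).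
    by move: (modc (a k)) (M k) => u v; nra.
  by rewrite big_split lerD ?hB // (bessel hn).
have S0 : 0 <= S by have := aM 0%N; rewrite big_ord0.
have [|d hd] := @choice nat (R[i] * R[i]) (fun k d => forall (h1 h2 : R[i]) t, 0 <= t <= 1 ->
    modc h1 <= t * rho -> modc h2 <= t * rho -> forall w,
    w 0 0 = z 0 0 + h1 -> w 0 1 = z 0 1 + h2 ->
    taylor_bound (M k) t (mev (p k) z) (mev (p k) w) (d.1 * h1 + d.2 * h2)).
  move=> k; have [d1 [d2 h]] := mev_taylor (p k) zX (ltW rho0).
  by exists (d1, d2).
have t11 : 0 <= (1 : R) <= 1 by rewrite ler01 lexx.
have modrho : modc rho%:C = rho by rewrite modcR ger0_norm // ltW.
(* Cauchy's estimate for a partial derivative: the Taylor bound at [t = 1], with increment [rho] in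
   one coordinate only. *)
have d1M k : modc (d k).1 <= 2 / rho * M k.
  pose w : V := \row_i (z 0 i + if i == 0 then rho%:C else 0).
  have := hd k rho%:C 0 1 t11 _ _ w.
  rewrite modrho modc0 mul1r lexx ltW // !mxE /= => /(_ isT isT erefl erefl).
  move/(taylor_bound_diff t11); rewrite mulr0 addr0 modcM modrho mulr1 => h.
  by rewrite mulrAC ler_pdivlMr.
have d2M k : modc (d k).2 <= 2 / rho * M k.
  pose w : V := \row_i (z 0 i + if i == 0 then 0 else rho%:C).
  have := hd k 0 rho%:C 1 t11 _ _ w.
  rewrite modrho modc0 mul1r lexx ltW // !mxE /= => /(_ isT isT erefl erefl).
  move/(taylor_bound_diff t11); rewrite mulr0 add0r modcM modrho mulr1 => h.
  by rewrite mulrAC ler_pdivlMr.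
have lim (b : nat -> R[i]) : (forall k, modc (b k) <= 2 / rho * M k) ->
    exists l, sums (fun k => a k * b k) l.
  move=> hb; have [||l hl _] := @abs_sums R (fun k => a k * b k)
    (fun k => 2 / rho * (modc (a k) * M k)) (2 / rho * S); last by exists l.
  - by move=> k; rewrite modcM mulrCA ler_wpM2l.
  - by move=> n; rewrite -mulr_sumr ler_wpM2l ?aM // divr_ge0 // ltW.
have [D1 hD1] := lim _ d1M; have [D2 hD2] := lim _ d2M.
exists (fun i => if i == 0 then D1 else D2), (S / rho ^+ 2), rho; split => //.
  by rewrite divr_ge0 // exprn_ge0 // ltW.
move=> h t /andP[t0 tr] ht /=.
have hw : bidisc (h + z).
  apply/bidiscP => i; rewrite mxE; apply: le_lt_trans (modcD _ _) _.
  by have := ht i; have := zX i; have := Xr; lra.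
have trho : 0 <= t / rho <= 1 by rewrite divr_ge0 ?(ltW rho0) //= ler_pdivrMr // mul1r.
have tE : t = t / rho * rho by rewrite divfK // gt_eqF.
have hs := frame_eval hK pK he hn x.
have := sumsB (sumsB (hs _ hw) (hs _ hz)) (sumsD (sumsZ (h 0 0) hD1) (sumsZ (h 0 1) hD2)).
rewrite [D1 * _]mulrC [D2 * _]mulrC => hh.
apply: (sums_modc_le (x := fun k => (t / rho) ^+ 2 * (modc (a k) * M k)) hh).
- move=> k; have := hd k (h 0 0) (h 0 1) (t / rho) trho; rewrite -tE => /(_ (ht 0) (ht 1) (h + z)).
  rewrite !mxE ![h 0 _ + _]addrC => /(_ erefl erefl) [_ _ h3].
  have -> : a k * mev (p k) (h + z) - a k * mev (p k) z -
     (h 0 0 * (a k * (d k).1) + h 0 1 * (a k * (d k).2)) =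
     a k * (mev (p k) (h + z) - mev (p k) z - ((d k).1 * h 0 0 + (d k).2 * h 0 1)) by ring.
  by rewrite modcM mulrCA ler_wpM2l.
- move=> n; rewrite -mulr_sumr.
  have -> : S / rho ^+ 2 * t ^+ 2 = (t / rho) ^+ 2 * S by rewrite (expr_div_n t rho 2) [RHS]mulrC [RHS]mulrCA [RHS]mulrC.
  by rewrite ler_wpM2l ?sqr_ge0.
Qed.

Lemma polyval_add (q q' : {poly {poly R[i]}}) z : polyval (q + q') z = polyval q z + polyval q' z.
Proof. by rewrite /polyval !hornerD. Qed.

Lemma mev_polyval (q : mpol R) : exists q' : {poly {poly R[i]}}, forall z, polyval q' z = mev q z.
Proof.
elim: q => [|[a [j k]] q [q' hq]].
  by exists 0 => z; rewrite /polyval !horner0 /mev big_nil.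
exists ((a *: 'X^j)%:P * 'X^k + q') => z; rewrite polyval_add hq /mev big_cons /=.
rewrite -/(mev q z); congr (_ + _).
by rewrite /polyval hornerM hornerC hornerXn hornerM hornerZ hornerXn -rmorphXn hornerC mulrA.
Qed.

Definition in_polynomials (x : H) := exists q, is_polynomial x q.

Lemma eval0 z : bidisc z -> ev 0 z = 0.
Proof. by move=> hz; rewrite (eval_ip hK) // inner0l. Qed.

Lemma in_polynomials_lincomb a x y : in_polynomials x -> in_polynomials y ->
  in_polynomials (a *: x + y).
Proof.
move=> [q hq] [q' hq']; exists (a%:P%:P * q + q') => z hz.
rewrite Defs.eval_linear // hq // hq' // polyval_add; congr (_ + _).
by rewrite /polyval hornerM hornerC hornerM hornerC.
Qed.

Lemma polynomials_dense : dense [set x : H | in_polynomials x].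
Proof.
have [e [he hn]] := frame_elements hK pK.
have he' k : in_polynomials (e k).
  have [q hq] := mev_polyval (p k); exists q => z hz.
  by rewrite he // hq.
move=> O [x Ox] oO.
have /nbhs_ballP [d d0 hd] := open_nbhs_nbhs (conj oO Ox).
have dE := realc_ge0 (ltW d0); set r := complex.Re d in dE.
have r0 : 0 < r by rewrite -ltcR -dE.
have [N hN] := frame_expansion hK pK he hn x (divr_gt0 r0 (ltr0n R 2)).
exists (\sum_(k < N) inner H x (e k) *: e k); split.
  apply: hd; rewrite -ball_normE /ball_ /= normHE dE ltcR nrBC.
  by have := hN N (leqnn N); lra.
elim: N {hN} => [|N IH].
  rewrite big_ord0; exists 0 => z hz; by rewrite eval0 // /polyval !horner0.
by rewrite big_ord_recr /= addrC; apply: in_polynomials_lincomb.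
Qed.

(** Horner's scheme in each variable: constants are multiples of [x], and the variables act through
    [T]. *)
Lemma polynomials_mem (T : 'I_2 -> {linear H -> H}) (x : H) (a : R[i]) : a != 0 ->
  (forall z, bidisc z -> ev x z = a) -> (forall i, is_mult i (T i)) ->
  forall q, exists y : H, is_polynomial y q.
Proof.
move=> a0 hx hT.
have inner_poly (q : {poly R[i]}) : exists y : H, forall z, bidisc z -> ev y z = q.[z 0 0].
  elim/poly_ind: q => [|q b [y hy]].
    by exists 0 => z hz; rewrite eval0 // horner0.
  exists ((b / a) *: x + T 0 y) => z hz.
  rewrite Defs.eval_linear // hx // divfK // hT // hy //.
  by rewrite hornerMXaddC addrC mulrC.
elim/poly_ind => [|q c [y hy]].
  by exists 0 => z hz; rewrite eval0 // /polyval !horner0.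
have [u hu] := inner_poly c.
exists (1 *: T 1 y + u) => z hz.
rewrite Defs.eval_linear // hT // hy // hu // /polyval hornerMXaddC hornerD hornerM hornerC.
by rewrite mul1r [z 0 1 * _]mulrC.
Qed.

End Holomorphy.

(** * Multiplication operators and the norms of their powers *)

Section Multiplication.
Variable R : realType.
Local Notation V := 'rV[R[i]]_2.
Implicit Types (z w : V).

(** (k + lam) times the k-th coefficient is nondecreasing in k, so the quotient is at most (k + n +
    lam) / (k + lam) <= 1 + n / lam. *)
Lemma rising_ratio (lam : R) k n : 0 < lam ->
  rising lam 1 k <= (1 + n%:R / lam) * rising lam 1 (k + n).
Proof.
move=> l0; have r0 j : 0 <= rising lam 1 j by apply: rising_ge0 => //; exact: ltW.
have step j : (j%:R + lam) * rising lam 1 j <= (j.+1%:R + lam) * rising lam 1 j.+1.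
  rewrite /= mul1r mulrA ler_wpM2r // [lam + _]addrC mulrCA -[leLHS]mulr1 ler_wpM2l //.
    by rewrite addr_ge0 // ltW.
  by rewrite ler_pdivlMr ?ltr0n // mul1r lerDl ltW.
have mono : (k%:R + lam) * rising lam 1 k <= ((k + n)%:R + lam) * rising lam 1 (k + n).
  elim: n => [|n IH]; first by rewrite addn0.
  by rewrite addnS (le_trans IH).
have kl : 0 < k%:R + lam by rewrite ltr_wpDl.
rewrite -(ler_pM2l kl) (le_trans mono) // mulrA ler_wpM2r //.
rewrite natrD addrAC mulrDr mulr1 lerD2l mulrCA -[leLHS]mulr1 ler_wpM2l //.
by rewrite ler_pdivlMr // mul1r lerDr.
Qed.

Lemma shifted_binomial (lam : R) (u : R[i]) n : 0 <= lam -> modc u < 1 ->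
  sums (fun k => (if (k < n)%N then 0 else rising lam 1 (k - n))%:C * u ^+ k)
    (u ^+ n * powC (1 - u) (- lam)).
Proof.
move=> l0 u1; have h := sumsZ (u ^+ n) (binomial_series l0 u1).
apply: (@cvs_shift _ _ _ n); apply: cvs_ext h => N.
rewrite addnC big_split_ord /= [X in X + _]big1 ?add0r.
  apply: eq_bigr => k _; rewrite ltnNge leq_addr /= addKn exprD; ring.
by move=> k _; rewrite ltn_ord mul0r.
Qed.

(** By [rising_ratio] the power series of ((1 + n / lam) - u^n) (1 - u)^(-lam) has nonnegative
    coefficients. *)
Lemma nnd_mult_power (lam : R) i (K : V -> V -> R[i]) n : 0 < lam ->
  nonneg_definite (@bidisc R) K ->
  nonneg_definite (@bidisc R) (fun z w =>
    ((1 + n%:R / lam)%:C - (z 0 i * Num.conj (w 0 i)) ^+ n) *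
    powC (one_sub z w i i) (- lam) * K z w).
Proof.
move=> l0 hK.
pose c k : R := (1 + n%:R / lam) * rising lam 1 k -
   (if (k < n)%N then 0 else rising lam 1 (k - n)).
have l0' := ltW l0.
apply: (nnd_mul_series (c := c) (g := fun z => z 0 i)) => //.
  move=> k; rewrite /c subr_ge0; have [kn|nk] := ltnP k n.
    by rewrite mulr_ge0 ?rising_ge0 // addr_ge0 // divr_ge0.
  by have := rising_ratio (k - n) n l0; rewrite subnK.
move=> z w hz hw; have u1 := modc_node i i hz hw.
have := sumsB (sumsZ (1 + n%:R / lam)%:C (binomial_series l0' u1)) (shifted_binomial n l0' u1).
rewrite -mulrBl; apply: sums_ext => k.
by rewrite /c realcB realcM mulrA -mulrBl.
Qed.

Lemma detker_factor0 (lam mu c del g : R) z w :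
  detker lam mu c del g z w = powC (one_sub z w 0 0) (- lam) * detker 0 mu c del g z w.
Proof.
rewrite /detker /powC [RHS]mulrA -expCD; congr (expC _ * _).
by rewrite /logA !realcE; ring.
Qed.

Lemma detker_factor1 (lam mu c del g : R) z w :
  detker lam mu c del g z w = powC (one_sub z w 1 1) (- mu) * detker lam 0 c del g z w.
Proof.
rewrite /detker /powC [RHS]mulrA -expCD; congr (expC _ * _).
by rewrite /logB !realcE; ring.
Qed.

Variables (lam : 'I_2 -> R) (c del g : R).
Hypotheses (lam0 : forall i, 0 < lam i) (c0 : 0 <= c) (del0 : 0 <= del) (g0 : 0 <= g).
Let K := detker (lam 0) (lam 1) c del g.

Lemma detker_mult_power i n : nonneg_definite (@bidisc R) (fun z w =>
  (1 + n%:R / lam i)%:C * K z w - z 0 i ^+ n * K z w * Num.conj (w 0 i ^+ n)).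
Proof.
have i01 : i = 0 \/ i = 1 by case: i => [[|[|//]] hi]; [left|right]; apply: val_inj.
have l0 j := ltW (lam0 j).
case: i01 => ->.
  have := nnd_mult_power 0 n (lam0 0) (detker_nnd (lexx 0) (l0 1) c0 del0 g0).
  apply: nnd_ext => z w _ _; rewrite /K (detker_factor0 (lam 0)) rmorphXn exprMn /=; ring.
have := nnd_mult_power 1 n (lam0 1) (detker_nnd (l0 0) (lexx 0) c0 del0 g0).
by apply: nnd_ext => z w _ _; rewrite /K (detker_factor1 _ (lam 1)) rmorphXn exprMn /=; ring.
Qed.

Variable H : hilbertFunctionSpace (@bidisc R).
Hypothesis hK : reproducing_kernel H K.

(** Each power is bounded directly as the multiplier z_i^n; iterating the bound of the case n = 1
    would only give exponential growth. *)
Lemma mult_exists i : exists2 T : {linear H -> H}, is_mult i T &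
  forall n x, nr (iter n T x) <= Num.sqrt (1 + n%:R / lam i) * nr x.
Proof.
have ge n : 0 <= 1 + n%:R / lam i by rewrite addr_ge0 // divr_ge0 // ltW.
have W n : exists2 W : {linear H -> H},
    forall x z, bidisc z -> Defs.eval (W x) z = z 0 i ^+ n * Defs.eval x z &
    forall x, nr (W x) <= Num.sqrt (1 + n%:R / lam i) * nr x.
  have [||W h1 h2] := @weighted_composition R H K hK (fun z => z 0 i ^+ n) id
      (Num.sqrt (1 + n%:R / lam i)) (sqrtr_ge0 _); last by exists W.
  - by [].
  - by rewrite sqr_sqrtr //; exact: detker_mult_power.
have [T hT _] := W 1%N.
have hT' : is_mult i T by move=> x z hz; rewrite hT // expr1.
exists T => // n x; have [U hU nU] := W n.
suff -> : iter n T x = U x by [].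
apply: Defs.eval_inj => z hz; rewrite hU //.
elim: n {U hU nU} => [|n IH]; first by rewrite expr0 mul1r.
by rewrite iterS hT' // IH exprS mulrA.
Qed.

End Multiplication.

(** * Separability and power series in a multiplication operator *)

Section FunctionalCalculus.
Variables (R : realType) (H : hilbertFunctionSpace (@bidisc R)).
Local Notation V := 'rV[R[i]]_2.
Variable K : V -> V -> R[i].
Hypothesis hK : reproducing_kernel H K.
Local Notation ev := (@Defs.eval R (@bidisc R) H).
Implicit Types (x y : H) (z w : V).

Section Separability.
Variable f : nat -> V -> R[i].
Hypothesis hf : forall z w, bidisc z -> bidisc w ->
  sums (fun k => f k z * Num.conj (f k w)) (K z w).

Lemma gaussian_rational_dense (a : R[i]) (e : R) : 0 < e ->
  exists q : rat * rat, modc (a - ((ratr q.1 : R) +i* ratr q.2)) <= e.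
Proof.
move=> e0; have e2 : 0 < e / 2 by rewrite divr_gt0.
have approx (t : R) : exists q : rat, `|t - ratr q| <= e / 2.
  have [q] := @rat_in_itvoo R (t - e / 2) (t + e / 2) ltac:(lra).
  by rewrite in_itv /= => /andP[h1 h2]; exists q; rewrite ler_norml; lra.
have [q1 h1] := approx (complex.Re a); have [q2 h2] := approx (complex.Im a).
exists (q1, q2); apply: (le_trans (modc_le _)); rewrite ReB ImB /=; lra.
Qed.

Lemma frame_separable : separable_space H.
Proof.
have [e [he hn]] := frame_elements hK hf.
pose G (s : seq (rat * rat)) : H := \sum_(k < size s)
  ((ratr (nth (0, 0) s k).1 : R) +i* ratr (nth (0, 0) s k).2) *: e k.
exists (range G); first exact: sub_countable (card_image_le _ _) (countableP _).
move=> O [x Ox] oO.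
have /nbhs_ballP [d d0 hd] := open_nbhs_nbhs (conj oO Ox).
have dE := realc_ge0 (ltW d0); set r := complex.Re d in dE.
have r0 : 0 < r by rewrite -ltcR -dE.
have r2 : 0 < r / 3 by rewrite divr_gt0.
have [N hN] := frame_expansion hK hf he hn x r2.
(* N eta^2 <= (r / 3)^2, the bound that the frame inequality needs; the successor covers [N = 0]. *)
pose eta := r / 3 / (N.+1%:R).
have eta0 : 0 < eta by rewrite divr_gt0.
have [|q hq] := @choice nat (rat * rat) (fun k q =>
    modc (inner H x (e k) - ((ratr q.1 : R) +i* ratr q.2)) <= eta).
  by move=> k; apply: gaussian_rational_dense.
exists (G (mkseq q N)); split; last by exists (mkseq q N).
apply: hd; rewrite -ball_normE /ball_ /= normHE dE ltcR.
have -> : x - G (mkseq q N) = (x - \sum_(k < N) inner H x (e k) *: e k) +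
    \sum_(k < N) (inner H x (e k) - ((ratr (q k).1 : R) +i* ratr (q k).2)) *: e k.
  rewrite [X in _ = _ + X](eq_bigr (fun k : 'I_N => inner H x (e k) *: e k -
    ((ratr (q k).1 : R) +i* ratr (q k).2) *: e k)); last by move=> k _; rewrite scalerBl.
  rewrite sumrB addrA subrK; congr (_ - _); rewrite /G size_mkseq.
  by apply: eq_bigr => k _; rewrite nth_mkseq.
apply: (le_lt_trans (nrD _ _)).
have h1 : nr (x - \sum_(k < N) inner H x (e k) *: e k) <= r / 3.
  by rewrite nrBC; apply: hN.
suff h2 : nr (\sum_(k < N) (inner H x (e k) - ((ratr (q k).1 : R) +i* ratr (q k).2)) *: e k)
    <= r / 3 by lra.
rewrite -(@ler_sqr R) ?nnegrE ?nr_ge0 ?(ltW r2) //.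
apply: (le_trans (hn (fun k => inner H x (e k) - ((ratr (q k).1 : R) +i* ratr (q k).2)) N)).
have : \sum_(k < N) modc (inner H x (e k) - ((ratr (q k).1 : R) +i* ratr (q k).2)) ^+ 2
    <= \sum_(k < N) eta ^+ 2.
  apply: ler_sum => k _; apply: lerXn2r (hq k); rewrite nnegrE //; exact: ltW.
move/le_trans; apply.
have -> : \sum_(k < N) eta ^+ 2 = N%:R * eta ^+ 2 by rewrite sumr_const card_ord mulr_natl.
have N1 : 0 < N.+1%:R :> R by [].
have Nle : N%:R <= N.+1%:R :> R by rewrite ler_nat.
have N1' : 1 <= N.+1%:R :> R by rewrite ler1n.
have -> : r / 3 = eta * N.+1%:R by rewrite /eta divfK // gt_eqF.
rewrite [leRHS]exprMn [leRHS]mulrC; apply: ler_wpM2r; first exact: sqr_ge0.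
rewrite expr2; apply: (le_trans Nle).
by rewrite -[leLHS]mul1r ler_wpM2r.
Qed.

End Separability.

Variables (i : 'I_2) (T : {linear H -> H}) (lam : R).
Hypotheses (lam0 : 0 < lam) (hT : is_mult i T)
  (nT : forall n x, nr (iter n T x) <= Num.sqrt (1 + n%:R / lam) * nr x).

Lemma eval_iter n x z : bidisc z -> ev (iter n T x) z = z 0 i ^+ n * ev x z.
Proof.
move=> hz; elim: n => [|n IH]; first by rewrite expr0 mul1r.
by rewrite iterS hT // IH exprS mulrA.
Qed.

(* The operator norms of the powers of [T] grow at most linearly, so a series in
   [T] with geometrically decaying coefficients converges in operator norm. *)
Lemma power_series_operator (a : nat -> R[i]) (C q : R) : 0 <= C -> 0 <= q < 1 ->
  (forall k, modc (a k) <= C * q ^+ k) ->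
  exists2 S : {linear H -> H},
    (forall e : R, 0 < e -> exists N, forall n, (N <= n)%N -> forall x,
      nr (\sum_(k < n) a k *: iter k T x - S x) <= e * nr x) &
    forall x z s, bidisc z -> sums (fun k => a k * z 0 i ^+ k) s -> ev (S x) z = s * ev x z.
Proof.
move=> C0 /andP[q0 q1] ha.
pose b k : R := modc (a k) * (1 + k%:R / lam).
have nT1 n x : nr (iter n T x) <= (1 + n%:R / lam) * nr x.
  apply: (le_trans (nT n x)); apply: ler_wpM2r; first exact: nr_ge0.
  have t1 : 1 <= 1 + n%:R / lam by rewrite lerDl divr_ge0 // ltW.
  have t0 : 0 <= 1 + n%:R / lam by apply: le_trans t1.
  rewrite -(@ler_sqr R) ?nnegrE ?sqrtr_ge0 // sqr_sqrtr // expr2.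
  by rewrite -[leLHS]mul1r ler_wpM2r.
have b0 k : 0 <= b k by rewrite mulr_ge0 // addr_ge0 // divr_ge0 // ltW.
have [B hB] : exists B : R, forall n, \sum_(k < n) b k <= B.
  (* Since 1 + k / lam <= (1 + 1 / lam)(k + 1), the terms are majorized by those of (1 - q)^-2,
     whose coefficients are [rising 2 1]. *)
  have [||B hB] := @rising_bounded R 2 1 q (ler0n _ 2) ler01; rewrite ?mul1r //.
  exists (C * (1 + lam^-1) * B) => n; apply: (@le_trans _ _ (C * (1 + lam^-1) *
    \sum_(k < n) rising 2 1 k * q ^+ k)); last first.
    by rewrite ler_wpM2l // mulr_ge0 // addr_ge0 // invr_ge0 ltW.
  rewrite mulr_sumr; apply: ler_sum => k _; rewrite rising2.
  have -> : C * (1 + lam^-1) * (k.+1%:R * q ^+ k) = C * q ^+ k * ((1 + lam^-1) * k.+1%:R) by ring.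
  apply: ler_pM => //; first by rewrite addr_ge0 // divr_ge0 // ltW.
  rewrite -natr1 mulrDl mul1r mulrDr mulr1 -addrA -[1 in leLHS]add0r [leLHS]addrC.
  have : 0 <= lam^-1 by rewrite invr_ge0 ltW.
  by move: (lam^-1) => l l0; have : 0 <= k%:R :> R by []; lra.
pose P n x := \sum_(k < n) a k *: iter k T x.
have tail e : 0 < e -> exists N, forall n m x, (N <= n)%N -> (n <= m)%N ->
    nr (P m x - P n x) <= e * nr x.
  move=> e0; have [N hN] := tail_small b0 hB e0; exists N => n m x Nn nm.
  have -> : P m x - P n x = \sum_(n <= k < m) a k *: iter k T x.
    rewrite /P -!(big_mkord xpredT (fun k => a k *: iter k T x)).
    by rewrite (big_cat_nat (n := n)) //= addrAC subrr add0r.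
  apply: (@le_trans _ _ (\sum_(n <= k < m) b k * nr x)); last first.
    by rewrite -mulr_suml ler_wpM2r ?nr_ge0 // hN.
  elim/big_ind2: _ => [|u s v t h1 h2|k _]; first by rewrite nr0.
    by apply: (le_trans (nrD _ _)); apply: lerD.
  by rewrite nrZ -mulrA ler_wpM2l.
have lim x : exists y, cvh (fun n => P n x) y.
  apply: cauchy_cvh => e e0.
  have x0 : 0 < nr x + 1 by rewrite ltr_wpDl // nr_ge0.
  have [N hN] := tail _ (divr_gt0 e0 x0); exists N => m n Nm Nn.
  have key k l : (N <= k)%N -> (k <= l)%N -> nr (P l x - P k x) <= e.
    move=> Nk kl; apply: (le_trans (hN k l x Nk kl)).
    rewrite -[leRHS](divfK (lt0r_neq0 x0)); apply: ler_wpM2l; last by rewrite lerDl.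
    by rewrite divr_ge0 // ltW.
  have [nm|/ltnW mn] := leqP n m; first exact: key.
  by rewrite nrBC; exact: key.
have [S hS] := @choice _ _ (fun x y => cvh (fun n => P n x) y) lim.
have evS x z s : bidisc z -> sums (fun k => a k * z 0 i ^+ k) s -> ev (S x) z = s * ev x z.
  move=> hz hs; apply: cvs_uniq (cvh_eval hK hz (hS x)) _.
  apply: cvs_ext (cvsM hs (cvs_cst (ev x z))) => n.
  rewrite mulr_suml [ev (P n x) z](eval_ip hK) // /P inner_suml; apply: eq_bigr => k _.
  by rewrite innerZl -(eval_ip hK) // eval_iter // mulrA.
have sz z : bidisc z -> exists s, sums (fun k => a k * z 0 i ^+ k) s.
  move=> /bidiscP hz; have [|l hl _] := @abs_sums R (fun k => a k * z 0 i ^+ k) b B _ hB.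
    move=> k; rewrite modcM ler_wpM2l // modcX (@le_trans _ _ 1) ?exprn_ile1 //; last first.
      by rewrite lerDl divr_ge0 // ltW.
    exact: ltW.
  by exists l.
have [|L hL] := @linear_of_fun R H S.
  move=> c x y; apply: Defs.eval_inj => z hz; have [s hs] := sz z hz.
  by rewrite !(Defs.eval_linear, evS _ _ _ hz hs) //; ring.
exists L => [e e0|x z s]; last by rewrite hL; apply: evS.
have [N hN] := tail e e0; exists N => n Nn x; rewrite hL.
rewrite -/(P n x); apply/ler_addgt0Pl => d d0.
have [M hM] := hS x d d0.
have -> : P n x - S x = (P (n + M)%N x - S x) - (P (n + M)%N x - P n x).
  by rewrite opprB [RHS]addrC addrA subrK.
apply: (le_trans (nrB _ _)); apply: lerD; first by apply: hM; exact: leq_addl.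
by apply: hN => //; exact: leq_addr.
Qed.

End FunctionalCalculus.

(** * Covariance of the kernel under automorphisms *)

Section Covariance.
Variable R : realType.
Local Notation V := 'rV[R[i]]_2.
Implicit Types (z w : V) (a c x y : R[i]).

Lemma differentiable_cderiv (f : R[i]^o -> R[i]^o) (x : R[i]^o) : differentiable f x ->
  exists d, cderiv f x d.
Proof.
move=> /diff_locallyP [_ /eqaddoP hf]; exists ('d f x 1) => e e0.
have e0' : 0 < e%:C :> R[i] by rewrite ltcR.
have /nbhs_ballP [s s0 hs] := hf _ e0'.
have sE := realc_ge0 (ltW s0); set r := complex.Re s in sE.
have r0 : 0 < r by rewrite -ltcR -sE.
exists (r / 2); first by rewrite divr_gt0.
move=> h hr; have := hs h; rewrite -ball_normE /ball_ /= sub0r normrN normE sE ltcR.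
have hlt : modc h < r by lra.
move=> /(_ hlt); rewrite normE -realcM lecR; congr (modc _ <= _).
have -> : (f \o shift x - (cst (f x) + 'd f x)) h = f (h + x) - (f x + 'd f x h) by [].
have -> : 'd f x h = 'd f x 1 * h :> R[i].
  by rewrite -[h in LHS]mulr1 -[h * 1]/(h *: (1 : R[i]^o)) linearZ /GRing.scale /= mulrC.
by rewrite opprD addrA [h + x]addrC.
Qed.

Lemma Mobius_form (phi : R[i]^o -> R[i]^o) : Mobius phi -> exists c a,
  [/\ modc c = 1, modc a < 1 & forall x, modc x < 1 -> phi x = c * blaschke a x].
Proof.
have dP x : disc x <-> modc x < 1 by rewrite /disc /= normE -realc1 ltcR.
move=> [psi [[h1 h2] [h3 h4] h5 h6]]; apply: (@disc_auto_form _ phi psi).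
split; [split|split| |].
- by move=> x /dP /h1 /differentiable_cderiv.
- by move=> x /dP /h2 /differentiable_cderiv.
- by move=> x /dP /h3 /dP.
- by move=> x /dP /h4 /dP.
- by move=> x /dP; exact: h5.
- by move=> x /dP; exact: h6.
Qed.

(** The Taylor coefficients of [c * blaschke a x] at 0. *)
Definition blaschke_coef c a k : R[i] :=
  if k is m.+1 then c * (1 - a * Num.conj a) * Num.conj a ^+ m else - (c * a).

Lemma blaschke_series c a x : modc a < 1 -> modc x < 1 ->
  sums (fun k => blaschke_coef c a k * x ^+ k) (c * blaschke a x).
Proof.
move=> a1 x1; have d0 := blaschke_denom a1 x1.
have ax : modc (Num.conj a * x) < 1.
  rewrite modcM modcJ; apply: le_lt_trans x1.
  by rewrite -[leRHS]mul1r ler_wpM2r // ltW.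
have -> : c * blaschke a x = - (c * a) * x ^+ 0 +
    c * (1 - a * Num.conj a) * x * (1 - Num.conj a * x)^-1.
  by rewrite /blaschke expr0; field.
apply: (sums_shift1 (u := fun k => blaschke_coef c a k * x ^+ k)).
apply: sums_ext (sumsZ (c * (1 - a * Num.conj a) * x) (geometric_sums ax)) => k.
by rewrite /= exprMn exprS; ring.
Qed.

Lemma one_sub_sqr_modc a : 1 - a * Num.conj a = (1 - modc a ^+ 2)%:C.
Proof. by rewrite mulJc realcB realc1. Qed.

Lemma blaschke_coef_bound c a : modc c = 1 -> modc a < 1 ->
  exists C q : R, [/\ 0 <= C, 0 <= q < 1 & forall k, modc (blaschke_coef c a k) <= C * q ^+ k].
Proof.
move=> c1 a1; have a0 := modc_ge0 a.
(* Larger than |a| so as to stay positive when a = 0, which makes C = 1 / q available. *)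
pose q := (1 + modc a) / 2; have q0 : 0 < q by rewrite /q; lra.
have q1 : q < 1 by rewrite /q; lra.
have aq : modc a <= q by rewrite /q; lra.
exists q^-1, q; split; [by rewrite invr_ge0 ltW|by rewrite ltW|].
case=> [|k].
  rewrite /= modcN modcM c1 mul1r expr0 mulr1 (le_trans (ltW a1)) // invf_ge1 //; exact: ltW.
rewrite /= !modcM c1 mul1r exprS mulrA mulVf ?gt_eqF // mul1r modcX modcJ one_sub_sqr_modc modcR.
have a2 : modc a ^+ 2 <= 1 by rewrite exprn_ile1 // ltW.
rewrite ger0_norm ?subr_ge0 // -[leRHS]mul1r; apply: ler_pM => //.
- by rewrite subr_ge0.
- by rewrite exprn_ge0.
- by rewrite lerBlDr lerDl sqr_ge0.
- by apply: lerXn2r; rewrite // nnegrE // ltW.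
Qed.

Section Automorphism.
Variables (c a : R[i]).
Hypotheses (c1 : modc c = 1) (a1 : modc a < 1).

Definition auto x : R[i] := c * blaschke a x.
Definition auto_inv x : R[i] := blaschke (- a) (Num.conj c * x).

Lemma unimodularK : Num.conj c * c = 1.
Proof. by rewrite mulrC mulJc c1 expr1n. Qed.

Lemma modc_rot x : modc x < 1 -> modc (Num.conj c * x) < 1.
Proof. by move=> x1; rewrite modcM modcJ c1 mul1r. Qed.

Lemma auto_lt1 x : modc x < 1 -> modc (auto x) < 1.
Proof. by move=> x1; rewrite modcM c1 mul1r blaschke_lt1. Qed.

Lemma auto_inv_lt1 x : modc x < 1 -> modc (auto_inv x) < 1.
Proof. by move=> x1; rewrite blaschke_lt1 ?modcN // modc_rot. Qed.

Lemma autoK x : modc x < 1 -> auto_inv (auto x) = x.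
Proof. by move=> x1; rewrite /auto_inv /auto mulrA unimodularK mul1r blaschkeK. Qed.

Lemma auto_invK x : modc x < 1 -> auto (auto_inv x) = x.
Proof.
move=> x1; rewrite /auto /auto_inv blaschkeNK // ?modc_rot //.
by rewrite mulrA [c * _]mulrC unimodularK mul1r.
Qed.

(** With psi = [auto_inv], D(x) = 1 + conj a conj c x and s^2 = 1 - |a|^2, one has 1 - psi(x) conj
    psi(y) = (1 - x conj y) s^2 / (D(x) conj D(y)). This is the logarithm of s / D(x); the half
    shares s^2 evenly between x and y. *)
Definition logfactor x : R[i] :=
  (ln (1 - modc a ^+ 2) / 2)%:C - LogC (1 + Num.conj a * (Num.conj c * x)).

Lemma logfactor_arg x : modc x < 1 -> modc (- (Num.conj a * (Num.conj c * x))) < 1.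
Proof.
move=> /modc_rot x1; rewrite modcN modcM modcJ; apply: le_lt_trans x1.
by rewrite -[leRHS]mul1r ler_wpM2r // ltW.
Qed.

Lemma logfactor_Re x : modc x < 1 -> 0 < complex.Re (1 + Num.conj a * (Num.conj c * x)).
Proof. by move=> /logfactor_arg /Re_1sub; rewrite opprK. Qed.

Lemma modc_mulJ_lt1 x y : modc x < 1 -> modc y < 1 -> modc (x * Num.conj y) < 1.
Proof.
move=> x1 y1; rewrite modcM modcJ; apply: le_lt_trans y1.
by rewrite -[leRHS]mul1r ler_wpM2r // ltW.
Qed.

(** The exponentials of the two sides agree. Each of the four logarithms has imaginary part below pi
    / 2 in absolute value, so the two sides together stay below 2 pi and no change of branch can
    occur. *)
Lemma LogC_auto_inv x y : modc x < 1 -> modc y < 1 ->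
  LogC (1 - auto_inv x * Num.conj (auto_inv y)) =
  LogC (1 - x * Num.conj y) + logfactor x + Num.conj (logfactor y).
Proof.
move=> x1 y1; have xy := Re_1sub (modc_mulJ_lt1 x1 y1).
have xy' := Re_1sub (modc_mulJ_lt1 (auto_inv_lt1 x1) (auto_inv_lt1 y1)).
have Dx := logfactor_Re x1; have Dy := logfactor_Re y1.
have p0 : 0 < 1 - modc a ^+ 2 by rewrite subr_gt0 sqr_lt1.
apply: expC_inj; last first.
  rewrite !ImD ImJ /logfactor !ImB /= !sub0r opprK.
  have := Im_LogC xy; have := Im_LogC xy'; have := Im_LogC Dx; have := Im_LogC Dy.
  rewrite !ltr_norml => h1 h2 h3 h4.
  set u := complex.Im _ in h3; set v1 := complex.Im _ in h4.
  set v2 := complex.Im _ in h2; set v3 := complex.Im _ in h1.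
  have h5 : `|u| < pi / 2 by rewrite ltr_norml.
  have h6 : `|v1 - v2 + v3| < 3 * (pi / 2) by rewrite ltr_norml; lra.
  lra.
rewrite !expCD expCJ /logfactor !expCD !expCN !expC_LogC // expC_real.
have e2 : (expR (ln (1 - modc a ^+ 2) / 2) : R) ^+ 2 = 1 - modc a ^+ 2.
  by rewrite -expRM_natl mulrC divfK // lnK.
set s := expR _ in e2 *.
have cs (D : R[i]) : Num.conj (s%:C / D) = s%:C / Num.conj D.
  by rewrite rmorphM fmorphV /= conjR.
rewrite cs.
have hNa : modc (- a) < 1 by rewrite modcN.
rewrite one_sub_blaschke // ?modc_rot // !rmorphN /= mulrNN !mulNr !opprK.
rewrite !rmorphD /= !rmorphM /= !rmorph1 !conjCK.
have nDx : 1 + Num.conj a * (Num.conj c * x) != 0.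
  by apply/eqP => h; rewrite h /= ltxx in Dx.
have nDy : 1 + a * (c * Num.conj y) != 0.
  rewrite -(inj_eq (can_inj (@conjCK _))) rmorph0 rmorphD !rmorphM /= conjCK rmorph1.
  by apply/eqP => h; rewrite h /= ltxx in Dy.
have cc := unimodularK.
have -> : Num.conj c * x * (c * Num.conj y) = x * Num.conj y.
  by rewrite mulrACA cc mul1r.
rewrite one_sub_sqr_modc -e2 realcX.
by field; rewrite nDx nDy.
Qed.

Definition bidisc_auto z : V := \row_i auto (z 0 i).
Definition bidisc_auto_inv z : V := \row_i auto_inv (z 0 i).

Lemma bidisc_auto_mem z : bidisc z -> bidisc (bidisc_auto z).
Proof. by move=> /bidiscP hz; apply/bidiscP => i; rewrite mxE auto_lt1. Qed.

Lemma bidisc_auto_inv_mem z : bidisc z -> bidisc (bidisc_auto_inv z).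
Proof. by move=> /bidiscP hz; apply/bidiscP => i; rewrite mxE auto_inv_lt1. Qed.

Lemma bidisc_autoK z : bidisc z -> bidisc_auto_inv (bidisc_auto z) = z.
Proof. by move=> /bidiscP hz; apply/rowP => i; rewrite !mxE autoK. Qed.

Lemma bidisc_auto_invK z : bidisc z -> bidisc_auto (bidisc_auto_inv z) = z.
Proof. by move=> /bidiscP hz; apply/rowP => i; rewrite !mxE auto_invK. Qed.

Variables (lam mu k del g : R).
Local Notation K := (detker lam mu k del g).

(** The summand 2 compensates the bracket, in which both products transform by the same factor
    exp(-2 s). CD / AB is invariant, because each [logfactor] enters AB and CD once; hence the
    exponent [k] does not occur. *)
Definition cocycle z : R[i] :=
  expC ((lam + 2)%:C * logfactor (z 0 0) + (mu + 2)%:C * logfactor (z 0 1)).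

Lemma cocycle_neq0 z : cocycle z != 0. Proof. exact: expC_neq0. Qed.

Lemma inv2_expC z w i j : bidisc z -> bidisc w ->
  inv2 z w i j = expC (- (2%:R * LogC (one_sub z w i j))).
Proof.
move=> hz hw; rewrite expCN expC_nat expC_LogC //.
exact: Re_1sub (modc_node i j hz hw).
Qed.

Lemma detker_covariant z w : bidisc z -> bidisc w ->
  cocycle z * K (bidisc_auto_inv z) (bidisc_auto_inv w) * Num.conj (cocycle w) = K z w.
Proof.
move=> hz hw; have hz' := bidisc_auto_inv_mem hz; have hw' := bidisc_auto_inv_mem hw.
have E i j : LogC (one_sub (bidisc_auto_inv z) (bidisc_auto_inv w) i j) =
    LogC (one_sub z w i j) + logfactor (z 0 i) + Num.conj (logfactor (w 0 j)).
  by rewrite /one_sub !mxE LogC_auto_inv //; [exact: (bidiscP z).1|exact: (bidiscP w).1].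
pose s : R[i] := logfactor (z 0 0) + logfactor (z 0 1) +
  Num.conj (logfactor (w 0 0)) + Num.conj (logfactor (w 0 1)).
have I0 : inv2 (bidisc_auto_inv z) (bidisc_auto_inv w) 0 0 *
    inv2 (bidisc_auto_inv z) (bidisc_auto_inv w) 1 1 =
    inv2 z w 0 0 * inv2 z w 1 1 * expC (- (2%:R * s)).
  by rewrite !inv2_expC // !E -!expCD; congr expC; rewrite /s; ring.
have I1 : inv2 (bidisc_auto_inv z) (bidisc_auto_inv w) 0 1 *
    inv2 (bidisc_auto_inv z) (bidisc_auto_inv w) 1 0 =
    inv2 z w 0 1 * inv2 z w 1 0 * expC (- (2%:R * s)).
  by rewrite !inv2_expC // !E -!expCD; congr expC; rewrite /s; ring.
rewrite /detker I0 I1.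
set b := del%:C * _ + _; set b' := del%:C * _ + _.
have -> : b = expC (- (2%:R * s)) * b' by rewrite /b /b'; ring.
rewrite mulrA /cocycle -expCJ [X in X * _]mulrA -!expCD mulrAC -expCD; congr (expC _ * _).
have cj (p q : R) (u v : R[i]) : Num.conj (p%:C * u + q%:C * v) =
    p%:C * Num.conj u + q%:C * Num.conj v.
  by rewrite rmorphD !rmorphM /= !conjR.
by rewrite cj /logA /logB /logCD !E /s !realcD !realc1; ring.
Qed.

End Automorphism.

End Covariance.

(** * The spectrum, the intertwining unitary and homogeneity *)

Section Homogeneity.
Variable R : realType.
Local Notation V := 'rV[R[i]]_2.
Implicit Types (z w l : V).

Lemma sums_series_cvg (u : nat -> R[i]) s : sums u s ->
  series (fun k => u k : R[i]^o) n @[n --> \oo] --> (s : R[i]^o).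
Proof.
move=> hs; apply/cvgrPdist_le => e e0.
have eE := realc_ge0 (ltW e0); set d := complex.Re e in eE.
have d0 : 0 < d by rewrite -ltcR -eE.
have [N hN] := hs d d0; exists N => // n /= Nn.
by rewrite eE normE lecR modcBC /series /= big_mkord hN.
Qed.

Variables (H : hilbertFunctionSpace (@bidisc R)) (lam : 'I_2 -> R) (c del g : R).
Hypotheses (lam0 : forall i, 0 < lam i) (c0 : 0 <= c) (del0 : 0 < del) (g0 : 0 <= g).
Let K := detker (lam 0) (lam 1) c del g.
Hypothesis hK : reproducing_kernel H K.
Local Notation ev := (@Defs.eval R (@bidisc R) H).
Implicit Types (x y u v : H).

Lemma bounded_mult (T : {linear H -> H}) (r : R) :
  (forall x, nr (T x) <= r * nr x) -> bounded_operator T.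
Proof. by move=> hT; exists r%:C => x; rewrite !normHE -realcM lecR. Qed.

Lemma eval_sub i (T : {linear H -> H}) (a : R[i]) x z : is_mult i T -> bidisc z ->
  ev (T x - a *: x) z = (z 0 i - a) * ev x z.
Proof.
move=> hT hz; rewrite addrC -scaleNr Defs.eval_linear // hT //; ring.
Qed.

Section Operators.
Variable T : 'I_2 -> {linear H -> H}.
Hypotheses (hT : forall i, is_mult i (T i))
  (nT : forall i n x, nr (iter n (T i) x) <= Num.sqrt (1 + n%:R / lam i) * nr x).

(** The Neumann series of - a^-(k+1) T^k converges for every |a| > 1, thanks to the bound on the
    powers of T. *)
Lemma resolvent i (a : R[i]) : 1 < modc a -> exists S : {linear H -> H},
  forall x z, bidisc z -> ev (S x) z = (z 0 i - a)^-1 * ev x z.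
Proof.
move=> a1; have a0 : a != 0 by rewrite -modc_gt0 (lt_trans ltr01).
have q0 : 0 <= (modc a)^-1 by rewrite invr_ge0.
have q1 : 0 <= (modc a)^-1 < 1 by rewrite q0 invf_lt1 // (lt_trans ltr01).
have [|S _ hS] := @power_series_operator R H K hK i (T i) (lam i) (lam0 i) (hT i) (nT i)
    (fun k => - (a^-1 ^+ k.+1)) (modc a)^-1 (modc a)^-1 q0 q1.
  by move=> k; rewrite modcN modcX modcV exprS.
exists S => x z hz; apply: hS => //.
have hz1 : modc (z 0 i) < 1 by move/bidiscP: hz.
have az : modc (z 0 i / a) < 1.
  rewrite modcM modcV ltr_pdivrMr ?mul1r; last by rewrite (lt_trans ltr01).
  exact: lt_trans hz1 a1.
have za : z 0 i - a != 0.
  by rewrite subr_eq0; apply/eqP => h; move: hz1; rewrite h ltNge (ltW a1).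
have -> : (z 0 i - a)^-1 = - a^-1 * (1 - z 0 i / a)^-1.
  have n0 : 1 - z 0 i / a != 0 by rewrite subr_eq0; apply/eqP => h; rewrite -h modc1 ltxx in az.
  by field; rewrite a0 za /= -opprB oppr_eq0 za.
apply: sums_ext (sumsZ (- a^-1) (geometric_sums az)) => k.
by rewrite exprMn exprS; ring.
Qed.

Lemma mult_comm i j x : T i (T j x) = T j (T i x).
Proof. by apply: Defs.eval_inj => z hz; rewrite !hT // mulrCA. Qed.

(** One coordinate outside the closed disc suffices: the inverse of that A_i commutes with the other
    operator and is a contracting homotopy of the Koszul complex. *)
Lemma spectrum_closed_bidisc : taylor_spectrum T `<=` closed_bidisc (R := R).
Proof.
move=> l nex i; rewrite normE -realc1 lecR leNgt; apply/negP => li.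
have [S hS] := resolvent i li; apply: nex.
have za z : bidisc z -> z 0 i - l 0 i != 0.
  move=> /bidiscP /(_ i) hz; rewrite subr_eq0; apply/eqP => h.
  by move: hz; rewrite h ltNge (ltW li).
pose A j x := T j x - l 0 j *: x.
have evA j x z : bidisc z -> ev (A j x) z = (z 0 j - l 0 j) * ev x z.
  by move=> hz; apply: eval_sub.
have AS x : A i (S x) = x.
  by apply: Defs.eval_inj => z hz; rewrite evA // hS // mulrA divff ?mul1r ?za.
have SA x : S (A i x) = x.
  by apply: Defs.eval_inj => z hz; rewrite hS // evA // mulrA mulVf ?mul1r ?za.
have ASC j x : A j (S x) = S (A j x).
  by apply: Defs.eval_inj => z hz; rewrite !(evA, hS) // mulrCA.
have A0 j : A j 0 = 0 by rewrite /A linear0 scaler0 subrr.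
have AN j x : A j (- x) = - A j x by rewrite /A linearN scalerN -opprD.
have i01 : i = 0 \/ i = 1.
  by case: (i) => [[|[|//]] hi]; [left|right]; apply: val_inj.
rewrite /koszul_exact /= -!/(A _ _).
case: i01 => iE; rewrite iE in AS SA.
- split=> [u h0 _|x y|v].
  + by rewrite -(SA u) [A 0 u]h0 linear0.
  + move/eqP; rewrite subr_eq0 => /eqP h; exists (S x); first exact: AS.
    exact: etrans (ASC 1 x) (etrans (congr1 S (esym h)) (SA y)).
  + by exists 0, (S v); rewrite -/(A 1 0) A0 subr0; exact: AS.
- split=> [u _ h1|x y|v].
  + by rewrite -(SA u) [A 1 u]h1 linear0.
  + move/eqP; rewrite subr_eq0 => /eqP h; exists (S y); last exact: AS.
    exact: etrans (ASC 0 y) (etrans (congr1 S h) (SA x)).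
  + by exists (- S v), 0; rewrite -/(A 0 0) -/(A 1 _) A0 AN AS opprK add0r.
Qed.

Lemma isometry_inner (U : {linear H -> H}) : (forall x, nr (U x) = nr x) ->
  forall x y, inner H (U x) (U y) = inner H x y.
Proof.
move=> hU.
have re x y : complex.Re (inner H (U x) (U y)) = complex.Re (inner H x y).
  have := hU (x + y); rewrite linearD => /(congr1 (fun t => t ^+ 2)).
  by rewrite !sqr_nrD !hU => /addrI h; lra.
move=> x y; apply: complex_ext; first exact: re.
have := re ('i *: x) y; rewrite linearZ /= !innerZl !ReM /=; lra.
Qed.

(** Covariance turns the domination required by [weighted_composition] into an equality with r = 1,
    for the operator and for its inverse. Two mutually inverse contractions are isometries. *)
Lemma homogeneous_unitary (a b : R[i]) : modc b = 1 -> modc a < 1 ->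
  exists U : {linear H -> H}, [/\ bijective U,
    forall x y, inner H (U x) (U y) = inner H x y &
    forall x z, bidisc z ->
      ev (U x) z = cocycle b a (lam 0) (lam 1) z * ev x (bidisc_auto_inv b a z)].
Proof.
move=> b1 a1; pose j := cocycle b a (lam 0) (lam 1).
have jK := detker_covariant b1 a1 (lam 0) (lam 1) c del g.
have one K' : (forall z w, bidisc z -> bidisc w -> K' z w = K z w) ->
    nonneg_definite (@bidisc R) (fun z w => (1 ^+ 2)%:C * K z w - K' z w).
  move=> h; apply: nnd_ext (@nnd0 R V (@bidisc R)) => z w hz hw.
  by rewrite h // expr1n mul1r subrr.
have [||U hU nU] := @weighted_composition R H K hK j (bidisc_auto_inv b a) 1 ler01.
- exact: bidisc_auto_inv_mem.
- by apply: one => z w hz hw; rewrite /j jK.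
have [||W hW nW] := @weighted_composition R H K hK (fun z => (j (bidisc_auto b a z))^-1)
    (bidisc_auto b a) 1 ler01.
- exact: bidisc_auto_mem.
- apply: one => z w hz hw.
  have hz' := bidisc_auto_mem b1 a1 hz; have hw' := bidisc_auto_mem b1 a1 hw.
  rewrite -[K (bidisc_auto b a z) _]jK // !bidisc_autoK // fmorphV /= /j.
  have n1 := cocycle_neq0 b a (lam 0) (lam 1) (bidisc_auto b a z).
  have n2 := cocycle_neq0 b a (lam 0) (lam 1) (bidisc_auto b a w).
  rewrite -(fmorph_eq0 (@Num.conj R[i])) in n2.
  by rewrite /K; field; rewrite n1 n2.
have WU x : W (U x) = x.
  apply: Defs.eval_inj => z hz; have hz' := bidisc_auto_mem b1 a1 hz; rewrite hW // hU //.
  rewrite bidisc_autoK //.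
  by rewrite mulrA mulVf ?mul1r // cocycle_neq0.
have UW x : U (W x) = x.
  apply: Defs.eval_inj => z hz; have hz' := bidisc_auto_inv_mem b1 a1 hz; rewrite hU // hW //.
  rewrite bidisc_auto_invK //.
  by rewrite mulrA divff ?mul1r // cocycle_neq0.
exists U; split; [by exists W | | exact: hU].
apply: isometry_inner => x; apply/le_anti/andP; split.
  by have := nU x; rewrite mul1r.
by have := nW (U x); rewrite WU mul1r.
Qed.

Lemma mult_Mobius_homogeneous : Mobius_homogeneous T.
Proof.
have [f [_ fK _]] := detker_frame (ltW (lam0 0)) (ltW (lam0 1)) c0 (ltW del0) g0.
split.
- exact: (frame_separable hK fK).
- by move=> i; apply: bounded_mult (nT i 1).
- exact: mult_comm.
- exact: spectrum_closed_bidisc.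
move=> phi /Mobius_form [b [a [b1 a1 hphi]]].
have [C [q [C0 q01 hC]]] := blaschke_coef_bound b1 a1.
have SE i : exists S : {linear H -> H}, functional_calculus phi (T i) S /\
    forall x z, bidisc z -> ev (S x) z = auto b a (z 0 i) * ev x z.
  have [S hS evS] := @power_series_operator R H K hK i (T i) (lam i) (lam0 i) (hT i) (nT i)
    (blaschke_coef b a) C q C0 q01 hC.
  exists S; split; last first.
    by move=> x z hz; apply: evS => //; apply: blaschke_series => //; move/bidiscP: hz.
  exists (blaschke_coef b a).
    move=> z hz; have z1 : modc z < 1 by move: hz; rewrite /disc /= normE -realc1 ltcR.
    by rewrite hphi //; apply: sums_series_cvg; apply: blaschke_series.
  move=> e e0; have eE := realc_ge0 (ltW e0).
  have d0 : 0 < complex.Re e by rewrite -ltcR -eE.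
  have [N hN] := hS _ d0; exists N => n Nn x.
  by rewrite eE !normHE -realcM lecR hN.
have [S hS] := choice SE.
exists S; first by move=> i; case: (hS i).
have [U [bU iU eU]] := homogeneous_unitary b1 a1.
exists U; split=> // i x; apply: Defs.eval_inj => z hz.
have hz' := bidisc_auto_inv_mem b1 a1 hz.
have [_ evS] := hS i.
(* Composition with the inverse automorphism turns the multiplier phi(z_i) back into z_i. *)
rewrite eU // evS // hT // eU // mxE auto_invK //; last by move/bidiscP: hz.
by rewrite mulrCA.
Qed.

End Operators.

Theorem detker_module : analytic_Hilbert_module H /\ Mobius_homogeneous_module H.
Proof.
have l0 i := ltW (lam0 i).
have [f [fB fK [k0 fk0]]] := detker_frame (l0 0) (l0 1) c0 (ltW del0) g0.
have mex i : exists S : {linear H -> H}, is_mult i S /\ forall n x,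
    nr (iter n S x) <= Num.sqrt (1 + n%:R / lam i) * nr x.
  by have [S h1 h2] := mult_exists lam0 c0 (ltW del0) g0 hK i; exists S.
have [T hT] := choice mex.
have hT1 i := (hT i).1; have hT2 i := (hT i).2.
split; last by exists T => //; apply: mult_Mobius_homogeneous.
split.
- by move=> x; apply: (holomorphic_eval hK fB fK).
- by exists K.
- have [e [he _]] := frame_elements hK fK.
  apply: (@polynomials_mem _ _ _ hK T (e k0) (Num.sqrt del)%:C) => //.
    by rewrite realc_eq0 sqrtr_eq0 -ltNge.
  by move=> z hz; rewrite he // fk0.
- exact: (polynomials_dense hK fK).
- by move=> i; exists (T i) => //; apply: bounded_mult (hT2 i 1%N).
Qed.

End Homogeneity.

Theorem mainTheorem4 (R : realType) (alpha beta gamma eta : R)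
    (gamma_gt0 : 0 < gamma) (gamma_lt_alpha : gamma < alpha)
    (gamma_lt_beta : gamma < beta) (eta_gt0 : 0 < eta) :
  nonneg_definite (@bidisc R) (det_calB alpha beta gamma eta) /\
  (exists H : hilbertFunctionSpace (@bidisc R),
      reproducing_kernel H (det_calB alpha beta gamma eta)) /\
  (forall H : hilbertFunctionSpace (@bidisc R),
      reproducing_kernel H (det_calB alpha beta gamma eta) ->
      analytic_Hilbert_module H /\ Mobius_homogeneous_module H).
Proof.
pose lam (i : 'I_2) := 2 * eta * ((if i == 0 then alpha else beta) - gamma).
pose c := 2 * eta * gamma; pose del := alpha * beta - gamma ^+ 2; pose g := gamma ^+ 2.
have lam0 i : 0 < lam i by rewrite /lam !mulr_gt0 // subr_gt0; case: ifP.
have c0 : 0 <= c by rewrite ltW // !mulr_gt0.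
have del0 : 0 < del by rewrite /del; nra.
have g0 : 0 <= g by exact: sqr_ge0.
have E z w : bidisc z -> bidisc w ->
    det_calB alpha beta gamma eta z w = detker (lam 0) (lam 1) c del g z w.
  exact: det_calB_detker.
split.
  have := detker_nnd (ltW (lam0 0)) (ltW (lam0 1)) c0 (ltW del0) g0.
  by apply: nnd_ext => z w hz hw; rewrite E.
split.
  have [f [_ fK _]] := detker_frame (ltW (lam0 0)) (ltW (lam0 1)) c0 (ltW del0) g0.
  have fK' z w : bidisc z -> bidisc w ->
      sums (fun k => mev (f k) z * Num.conj (mev (f k) w)) (det_calB alpha beta gamma eta z w).
    by move=> hz hw; rewrite E //; apply: fK.
  by exists (rkhs_space fK'); apply: rkhs_reproducing.
move=> H hK; apply: (detker_module lam0 c0 del0 g0) => w hw.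
have [k hk1 hk2] := hK w hw; exists k => // z hz.
by rewrite hk1 // E.
Qed.
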